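(* Let $f:\mathbb{R}^2\to\mathbb{R}^2$ be a quadratic map. Then $f$ is affinely map equivalent to exactly one of the following 18 maps (written as functions of $(x,y)$). Moreover, the description of the critical set $J_0^f$ and of the critical image $J_1^f$, and the set of preimage cardinalities $\{\#f^{-1}(p): p\in\mathbb{R}^2\}$, are the same for all maps in the same affine map equivalence class, and are as listed (in the order: map; $J_0$; $J_1$; preimage cardinalities): $E_1=(x^2-y^2+x,\,xy)$; ellipse; closed curve with three cusps; $\{2,3,4\}$. $E_2=(x^2-y^2,\,xy)$; point; point; $\{1,2\}$. $H_1=(x^2+y^2+x,\,xy)$; hyperbola; two disjoint curves, each the image of one branch of the hyperbola, one smooth and the other smooth except for a single cusp; $\{0,1,2,3,4\}$. $H_2=(x^2+y^2+x,\,xy+\tfrac12 x)$; two intersecting lines; union of a parabola and a ray, the endpoint of the ray coinciding with the vertex of the parabola; $\{0,1,2,3,4\}$. $H_3=(x^2+y^2,\,xy)$; two intersecting lines; union of two rays emanating from the same point; $\{0,1,2,4\}$. $P_1=(x^2+y,\,xy)$; parabola; curve with a single cusp; $\{1,2,3\}$. $P_2=(x^2,\,xy+y)$; two distinct parallel lines; union of a line and a point (one of the lines of $J_0$ maps onto the line, the other maps to the point); $\{0,1,2,\infty\}$. $P_3=(x^2,\,xy)$; two coincident lines; point; $\{0,2,\infty\}$. $D^E_1=(x^2-y^2,\,y)$; line; parabola; $\{0,1,2\}$. $D^E_2=(x^2-y^2,\,x+y)$; line; point; $\{0,1,\infty\}$. $D^E_3=(x^2-y^2,\,0)$; $\mathbb{R}^2$;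 line; $\{0,\infty\}$. $D^H_1=(x^2+y^2,\,y)$; line; parabola; $\{0,1,2\}$. $D^H_2=(x^2+y^2,\,0)$; $\mathbb{R}^2$; ray; $\{0,1,\infty\}$. $D^P_1=(x^2+y,\,x)$; empty; empty; $\{1\}$. $D^P_2=(x^2,\,y)$; line; line; $\{0,1,2\}$. $D^P_3=(x^2+y,\,0)$; $\mathbb{R}^2$; line; $\{0,\infty\}$. $D^P_4=(x^2,\,x)$; $\mathbb{R}^2$; parabola; $\{0,\infty\}$. $D^P_5=(x^2,\,0)$; $\mathbb{R}^2$; ray; $\{0,\infty\}$.
   Context: A quadratic map of the plane is a map $Q:\mathbb{R}^2\to\mathbb{R}^2$ of the form $Q(x,y)=(a_{20}x^2+a_{11}xy+a_{02}y^2+a_{10}x+a_{01}y+a_{00},\ b_{20}x^2+b_{11}xy+b_{02}y^2+b_{10}x+b_{01}y+b_{00})$ with real coefficients such that at least one of the six degree-two coefficients $a_{20},a_{11},a_{02},b_{20},b_{11},b_{02}$ is nonzero. Two maps $f,g:\mathbb{R}^2\to\mathbb{R}^2$ are affinely map equivalent if there exist invertible affine maps $h,k:\mathbb{R}^2\to\mathbb{R}^2$ with $k\circ f=g\circ h$. The critical set is $J_0^f=\{(x,y):\det Df(x,y)=0\}$ and the critical image is $J_1^f=f(J_0^f)$. Since $\det Df$ is a polynomial of degree at most two, $J_0^f$ is a possibly degenerate conic; ''two coincident lines'' means that $\det Df$ is a nonzero constant times the square of a nonconstant affine function, while ''line'' for $J_0$ means that $\det Df$ is itself a nonconstant affine function.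 ''Ray'' means a closed half-line. A ''cusp'' of the image of a smooth curve is an ordinary cusp in the usual sense (locally diffeomorphic to $t\mapsto(t^2,t^3)$). The symbol $\infty$ denotes an infinite preimage set.
   Formalization: For H_2, ''the endpoint of the ray coinciding with the vertex of the parabola'' is read affinely, i.e. the endpoint lies on the parabola; the usual vertex is not affinely invariant and the clause with it is false for the listed map H_2 itself. *)

(* Defs.v *)
From Stdlib Require Import Reals List.
From Coquelicot Require Import Coquelicot.
Import ListNotations.
Open Scope R_scope.

Notation plane := (R * R)%type.

Definition seteq (S T : plane -> Prop) : Prop := forall p, S p <-> T p.
Definition union (S T : plane -> Prop) : plane -> Prop := fun p => S p \/ T p.
Definition image (f : plane -> plane) (S : plane -> Prop) : plane -> Prop :=
  fun q => exists p, S p /\ f p = q.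

Inductive cardinality : Set := Fin (n : nat) | Inf.

Definition has_cardinality (S : plane -> Prop) (k : cardinality) : Prop :=
  match k with
  | Fin n => exists l : list plane,
      NoDup l /\ length l = n /\ forall p, In p l <-> S p
  | Inf => ~ exists l : list plane, forall p, S p -> In p l
  end.

Definition quadratic_map (f : plane -> plane) : Prop :=
  exists a20 a11 a02 a10 a01 a00 b20 b11 b02 b10 b01 b00 : R,
    (a20 <> 0 \/ a11 <> 0 \/ a02 <> 0 \/ b20 <> 0 \/ b11 <> 0 \/ b02 <> 0) /\
    forall x y : R,
      f (x, y) =
        (a20 * x^2 + a11 * x * y + a02 * y^2 + a10 * x + a01 * y + a00,
         b20 * x^2 + b11 * x * y + b02 * y^2 + b10 * x + b01 * y + b00).

Definition affine_map (h : plane -> plane) : Prop :=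
  exists a b c d u v : R,
    forall x y : R, h (x, y) = (a * x + b * y + u, c * x + d * y + v).

Definition invertible_affine_map (h : plane -> plane) : Prop :=
  affine_map h /\
  exists g : plane -> plane, (forall p, g (h p) = p) /\ (forall p, h (g p) = p).

Definition affinely_map_equivalent (f g : plane -> plane) : Prop :=
  exists h k : plane -> plane,
    invertible_affine_map h /\ invertible_affine_map k /\
    forall p, k (f p) = g (h p).

Definition jacobian (f : plane -> plane) (x y : R) : R :=
  Derive (fun t => fst (f (t, y))) x * Derive (fun t => snd (f (x, t))) y
  - Derive (fun t => fst (f (x, t))) y * Derive (fun t => snd (f (t, y))) x.

Definition J0 (f : plane -> plane) : plane -> Prop :=
  fun p => jacobian f (fst p) (snd p) = 0.

Definition J1 (f : plane -> plane) : plane -> Prop := image f (J0 f).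

Definition preimage (f : plane -> plane) (p : plane) : plane -> Prop :=
  fun q => f q = p.

Definition singleton (p : plane) : plane -> Prop := fun q => q = p.
Definition is_point (S : plane -> Prop) : Prop := exists p, seteq S (singleton p).

Definition line (a b c : R) : plane -> Prop :=
  fun p => a * fst p + b * snd p + c = 0.
Definition is_line (S : plane -> Prop) : Prop :=
  exists a b c : R, (a <> 0 \/ b <> 0) /\ seteq S (line a b c).

Definition distinct_parallel_lines (L1 L2 : plane -> Prop) : Prop :=
  exists a b c1 c2 : R,
    (a <> 0 \/ b <> 0) /\ c1 <> c2 /\
    seteq L1 (line a b c1) /\ seteq L2 (line a b c2).

Definition intersecting_lines (L1 L2 : plane -> Prop) : Prop :=
  is_line L1 /\ is_line L2 /\ ~ seteq L1 L2 /\ exists p, L1 p /\ L2 p.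

Definition ray_from (p : plane) (S : plane -> Prop) : Prop :=
  exists u v : R,
    (u <> 0 \/ v <> 0) /\
    seteq S (fun q => exists t : R,
      0 <= t /\ q = (fst p + t * u, snd p + t * v)).
Definition is_ray (S : plane -> Prop) : Prop := exists p, ray_from p S.

(** Conics are taken up to affine change of coordinates: an ellipse, parabola
    or hyperbola is a set which in some affine coordinate system is the unit
    circle, [y = x^2] or [x y = 1] respectively. *)

Definition is_ellipse (S : plane -> Prop) : Prop :=
  exists h, invertible_affine_map h /\
    seteq S (image h (fun p => fst p ^ 2 + snd p ^ 2 = 1)).

(** The vertex is the origin of an affine coordinate system in which the
    parabola is [y = x^2].  The metric vertex would not do: it is not preserved
    by affine maps.  Affine maps act transitively on a parabola, so each of its
    points is a vertex in this sense. *)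
Definition parabola_with_vertex (v : plane) (S : plane -> Prop) : Prop :=
  exists h, invertible_affine_map h /\ h (0, 0) = v /\
    seteq S (image h (fun p => snd p = fst p ^ 2)).
Definition is_parabola (S : plane -> Prop) : Prop :=
  exists v, parabola_with_vertex v S.

Definition hyperbola_with_branches (S B1 B2 : plane -> Prop) : Prop :=
  exists h, invertible_affine_map h /\
    seteq S (image h (fun p => fst p * snd p = 1)) /\
    seteq B1 (image h (fun p => fst p * snd p = 1 /\ 0 < fst p)) /\
    seteq B2 (image h (fun p => fst p * snd p = 1 /\ fst p < 0)).
Definition is_hyperbola (S : plane -> Prop) : Prop :=
  exists B1 B2, hyperbola_with_branches S B1 B2.

(** [ex_diff_n] at order [n] asks for continuity of all partial derivatives of
    order at most [n], so on an open set this is [C^oo]. *)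
Definition smooth_on (U : plane -> Prop) (phi : plane -> plane) : Prop :=
  forall (n : nat) (x y : R), U (x, y) ->
    ex_diff_n (fun s t => fst (phi (s, t))) n x y /\
    ex_diff_n (fun s t => snd (phi (s, t))) n x y.

Definition diffeomorphism (U V : plane -> Prop) (phi psi : plane -> plane) : Prop :=
  open U /\ open V /\ smooth_on U phi /\ smooth_on V psi /\
  (forall p, U p -> V (phi p) /\ psi (phi p) = p) /\
  (forall q, V q -> U (psi q) /\ phi (psi q) = q).

(** This compares germs of subsets, not of parametrized curves: inside [U] the
    set [S] is exactly the preimage of [T]. *)
Definition locally_diffeomorphic
    (S : plane -> Prop) (p : plane) (T : plane -> Prop) (q : plane) : Prop :=
  exists U V phi psi,
    diffeomorphism U V phi psi /\ U p /\ phi p = q /\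
    forall r, U r -> (S r <-> T (phi r)).

Definition smooth_at (S : plane -> Prop) (p : plane) : Prop :=
  S p /\ locally_diffeomorphic S p (fun q => snd q = 0) (0, 0).

Definition cusp_at (S : plane -> Prop) (p : plane) : Prop :=
  S p /\ locally_diffeomorphic S p (fun q => exists t : R, q = (t^2, t^3)) (0, 0).

Definition smooth_path (gamma : R -> plane) : Prop :=
  forall (n : nat) (t : R),
    ex_derive_n (fun s => fst (gamma s)) n t /\
    ex_derive_n (fun s => snd (gamma s)) n t.

Definition curve (S : plane -> Prop) : Prop :=
  exists gamma, smooth_path gamma /\ seteq S (fun p => exists t, gamma t = p).

Definition closed_curve (S : plane -> Prop) : Prop :=
  exists (gamma : R -> plane) (T : R),
    smooth_path gamma /\ 0 < T /\ (forall t, gamma (t + T) = gamma t) /\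
    seteq S (fun p => exists t, gamma t = p).

Definition smooth_except_cusps (S : plane -> Prop) (cusps : list plane) : Prop :=
  NoDup cusps /\
  (forall p, In p cusps -> cusp_at S p) /\
  (forall p, S p -> ~ In p cusps -> smooth_at S p).

Definition smooth_curve (S : plane -> Prop) : Prop :=
  curve S /\ smooth_except_cusps S [].
Definition curve_with_single_cusp (S : plane -> Prop) : Prop :=
  curve S /\ exists p, smooth_except_cusps S [p].
Definition closed_curve_with_three_cusps (S : plane -> Prop) : Prop :=
  closed_curve S /\ exists p1 p2 p3, smooth_except_cusps S [p1; p2; p3].

Inductive J0_description : Set :=
  | J0_ellipse | J0_hyperbola | J0_parabola | J0_point
  | J0_two_intersecting_lines | J0_two_distinct_parallel_lines
  | J0_two_coincident_lines | J0_line | J0_empty | J0_plane.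

Definition J0_is (f : plane -> plane) (d : J0_description) : Prop :=
  match d with
  | J0_ellipse => is_ellipse (J0 f)
  | J0_hyperbola => is_hyperbola (J0 f)
  | J0_parabola => is_parabola (J0 f)
  | J0_point => is_point (J0 f)
  | J0_two_intersecting_lines => exists L1 L2,
      intersecting_lines L1 L2 /\ seteq (J0 f) (union L1 L2)
  | J0_two_distinct_parallel_lines => exists L1 L2,
      distinct_parallel_lines L1 L2 /\ seteq (J0 f) (union L1 L2)
  | J0_two_coincident_lines => exists k a b c : R,
      k <> 0 /\ (a <> 0 \/ b <> 0) /\
      forall x y, jacobian f x y = k * (a * x + b * y + c)^2
  | J0_line => exists a b c : R,
      (a <> 0 \/ b <> 0) /\ forall x y, jacobian f x y = a * x + b * y + c
  | J0_empty => forall p, ~ J0 f p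
  | J0_plane => forall p, J0 f p
  end.

Inductive J1_description : Set :=
  | J1_closed_curve_three_cusps
  | J1_images_of_branches
  | J1_parabola_and_ray_from_vertex
  | J1_two_rays
  | J1_curve_single_cusp
  | J1_line_and_point
  | J1_point | J1_parabola | J1_line | J1_ray | J1_empty.

Definition J1_is (f : plane -> plane) (d : J1_description) : Prop :=
  match d with
  | J1_closed_curve_three_cusps => closed_curve_with_three_cusps (J1 f)
  | J1_images_of_branches => exists B1 B2,
      hyperbola_with_branches (J0 f) B1 B2 /\
      seteq (J1 f) (union (image f B1) (image f B2)) /\
      (forall p, ~ (image f B1 p /\ image f B2 p)) /\
      smooth_curve (image f B1) /\ curve_with_single_cusp (image f B2)
  | J1_parabola_and_ray_from_vertex => exists P L v,
      parabola_with_vertex v P /\ ray_from v L /\ seteq (J1 f) (union P L)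
  | J1_two_rays => exists p L1 L2,
      ray_from p L1 /\ ray_from p L2 /\ ~ seteq L1 L2 /\
      seteq (J1 f) (union L1 L2)
  | J1_curve_single_cusp => curve_with_single_cusp (J1 f)
  | J1_line_and_point => exists L1 L2 p,
      distinct_parallel_lines L1 L2 /\ seteq (J0 f) (union L1 L2) /\
      is_line (image f L1) /\ seteq (image f L2) (singleton p) /\
      ~ image f L1 p /\
      seteq (J1 f) (union (image f L1) (singleton p))
  | J1_point => is_point (J1 f)
  | J1_parabola => is_parabola (J1 f)
  | J1_line => is_line (J1 f)
  | J1_ray => is_ray (J1 f)
  | J1_empty => forall p, ~ J1 f p
  end.

Definition preimage_cardinalities_are (f : plane -> plane) (l : list cardinality) : Prop :=
  forall k, (exists p, has_cardinality (preimage f p) k) <-> In k l.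

Inductive normal_form : Set :=
  | E1 | E2 | H1 | H2 | H3 | P1 | P2 | P3
  | DE1 | DE2 | DE3 | DH1 | DH2 | DP1 | DP2 | DP3 | DP4 | DP5.

Definition nf_map (c : normal_form) : plane -> plane :=
  fun '(x, y) =>
  match c with
  | E1 => (x^2 - y^2 + x, x * y)
  | E2 => (x^2 - y^2, x * y)
  | H1 => (x^2 + y^2 + x, x * y)
  | H2 => (x^2 + y^2 + x, x * y + / 2 * x)
  | H3 => (x^2 + y^2, x * y)
  | P1 => (x^2 + y, x * y)
  | P2 => (x^2, x * y + y)
  | P3 => (x^2, x * y)
  | DE1 => (x^2 - y^2, y)
  | DE2 => (x^2 - y^2, x + y)
  | DE3 => (x^2 - y^2, 0)
  | DH1 => (x^2 + y^2, y)
  | DH2 => (x^2 + y^2, 0)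
  | DP1 => (x^2 + y, x)
  | DP2 => (x^2, y)
  | DP3 => (x^2 + y, 0)
  | DP4 => (x^2, x)
  | DP5 => (x^2, 0)
  end.

Definition nf_J0 (c : normal_form) : J0_description :=
  match c with
  | E1 => J0_ellipse
  | E2 => J0_point
  | H1 => J0_hyperbola
  | H2 => J0_two_intersecting_lines
  | H3 => J0_two_intersecting_lines
  | P1 => J0_parabola
  | P2 => J0_two_distinct_parallel_lines
  | P3 => J0_two_coincident_lines
  | DE1 => J0_line
  | DE2 => J0_line
  | DE3 => J0_plane
  | DH1 => J0_line
  | DH2 => J0_plane
  | DP1 => J0_empty
  | DP2 => J0_line
  | DP3 => J0_plane
  | DP4 => J0_plane
  | DP5 => J0_plane
  end.

Definition nf_J1 (c : normal_form) : J1_description :=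
  match c with
  | E1 => J1_closed_curve_three_cusps
  | E2 => J1_point
  | H1 => J1_images_of_branches
  | H2 => J1_parabola_and_ray_from_vertex
  | H3 => J1_two_rays
  | P1 => J1_curve_single_cusp
  | P2 => J1_line_and_point
  | P3 => J1_point
  | DE1 => J1_parabola
  | DE2 => J1_point
  | DE3 => J1_line
  | DH1 => J1_parabola
  | DH2 => J1_ray
  | DP1 => J1_empty
  | DP2 => J1_line
  | DP3 => J1_line
  | DP4 => J1_parabola
  | DP5 => J1_ray
  end.

Definition nf_preimage_cardinalities (c : normal_form) : list cardinality :=
  match c with
  | E1 => [Fin 2; Fin 3; Fin 4]
  | E2 => [Fin 1; Fin 2]
  | H1 => [Fin 0; Fin 1; Fin 2; Fin 3; Fin 4]
  | H2 => [Fin 0; Fin 1; Fin 2; Fin 3; Fin 4]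
  | H3 => [Fin 0; Fin 1; Fin 2; Fin 4]
  | P1 => [Fin 1; Fin 2; Fin 3]
  | P2 => [Fin 0; Fin 1; Fin 2; Inf]
  | P3 => [Fin 0; Fin 2; Inf]
  | DE1 => [Fin 0; Fin 1; Fin 2]
  | DE2 => [Fin 0; Fin 1; Inf]
  | DE3 => [Fin 0; Inf]
  | DH1 => [Fin 0; Fin 1; Fin 2]
  | DH2 => [Fin 0; Fin 1; Inf]
  | DP1 => [Fin 1]
  | DP2 => [Fin 0; Fin 1; Fin 2]
  | DP3 => [Fin 0; Inf]
  | DP4 => [Fin 0; Inf]
  | DP5 => [Fin 0; Inf]
  end.

(* Main.v *)
Require Import Defs.
From Stdlib Require Import Reals List.
From Coquelicot Require Import Coquelicot.
From Stdlib Require Import FinFun Lra Lia Psatz Classical.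
From Stdlib Require Import FunctionalExtensionality PropExtensionality.
Import ListNotations.
Open Scope R_scope.

(** The quadratic parts of the two components span a pencil of binary forms, some member of
    which loses its [x^2] term and hence factors; making the factors coordinates brings the
    pencil to [(x^2 - y^2, xy)], [(x^2, y^2)], [(x^2, xy)] or to rank one.  In each case
    translations remove part of the linear terms and scalings normalize the rest; over
    [(x^2 - y^2, xy)] the map is [z^2 + c (conj z)] and the normalization is a complex cubic
    equation.

    The critical images with cusps are, up to affine maps, the semicubical parabola, the
    deltoid, and the curves obtained from the deltoid on replacing the circle by a hyperbola.
    A cuspidal arc has the form [(3 + 6 e w + 2 w^2, 2 w S)] with [S^2 = w (2 + e w)], so
    dividing the ordinate by [2 sqrt (2 + e w)] carries it to [(t^2, t^3)]; the threefold
    symmetry of the deltoid moves every point of it onto such an arc.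

    The sets of preimage cardinalities distinguish most normal forms; the others are told
    apart by midpoints in the critical set, in the image and in the fibres. *)

(** * Affine maps and affine map equivalence *)

(** Smoothness of every order is the technical obstacle. Differentiating a product or a composite
    yields a sum of different products, so an induction on the order cannot keep the function fixed;
    it runs over a whole family of functions closed under differentiation.

    Cusps and regular points are properties of sets, not of parametrizations. A chart must therefore
    describe every point of the curve that falls in its domain, which means solving back for the
    parameter [C] and excluding the second root of a quadratic by a sign condition.

    All descriptions survive affine changes of source and target, so they are verified only on the
    18 forms and then transported. Set equality is turned into Leibniz equality to allow rewriting
    inside these descriptions. *)

Lemma seteq_eq S T : seteq S T -> S = T.
Proof.
  intros H. apply functional_extensionality. intros p. apply propositional_extensionality, H.
Qed.

Definition affine (a b c d u v : R) : plane -> plane :=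
  fun p => (a * fst p + b * snd p + u, c * fst p + d * snd p + v).

Definition affine_inv (a b c d u v : R) : plane -> plane :=
  let D := a * d - b * c in
  affine (d / D) (- b / D) (- c / D) (a / D) ((b * v - d * u) / D) ((c * u - a * v) / D).

Lemma affine_invK a b c d u v p : a * d - b * c <> 0 ->
  affine_inv a b c d u v (affine a b c d u v p) = p.
Proof.
  intros H. destruct p as [x y]. unfold affine_inv, affine; simpl. f_equal; field; exact H.
Qed.

Lemma affineK a b c d u v p : a * d - b * c <> 0 ->
  affine a b c d u v (affine_inv a b c d u v p) = p.
Proof.
  intros H. destruct p as [x y]. unfold affine_inv, affine; simpl. f_equal; field; exact H.
Qed.

Lemma affine_inv_det a b c d : a * d - b * c <> 0 ->
  let D := a * d - b * c in d / D * (a / D) - - b / D * (- c / D) <> 0.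
Proof.
  intros H D. replace (d / D * (a / D) - - b / D * (- c / D)) with (/ D).
  - now apply Rinv_neq_0_compat.
  - unfold D. field. exact H.
Qed.

Lemma invertible_affine a b c d u v : a * d - b * c <> 0 ->
  invertible_affine_map (affine a b c d u v).
Proof.
  intros H. split.
  - exists a, b, c, d, u, v. reflexivity.
  - exists (affine_inv a b c d u v). split; intros p; [now apply affine_invK|now apply affineK].
Qed.

(** If the determinant vanished, [(b, - a)] and [(d, - c)] would lie in the kernel of the linear
    part, so injectivity would make all four entries zero, and then [(1, 0)] would collapse onto the
    origin too. *)
Lemma invertible_affineE h : invertible_affine_map h ->
  exists a b c d u v, a * d - b * c <> 0 /\ h = affine a b c d u v.
Proof.
  intros [(a & b & c & d & u & v & E) (g & Hg & _)].
  exists a, b, c, d, u, v. split.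
  - intros D.
    assert (inj : forall p q, h p = h q -> p = q) by (intros p q e; now rewrite <- (Hg p), e, Hg).
    assert (b = 0 /\ a = 0) as [-> ->].
    { assert (e : (b, - a) = (0, 0)) by (apply inj; rewrite !E; f_equal; lra).
      injection e as e1 e2. lra. }
    assert (d = 0 /\ c = 0) as [-> ->].
    { assert (e : (d, - c) = (0, 0)) by (apply inj; rewrite !E; f_equal; lra).
      injection e as e1 e2. lra. }
    assert (e : (1, 0) = (0, 0)) by (apply inj; rewrite !E; f_equal; lra).
    injection e. lra.
  - apply functional_extensionality. intros [x y]. apply E.
Qed.

Lemma invertible_affine_comp h k : invertible_affine_map h -> invertible_affine_map k ->
  invertible_affine_map (fun p => h (k p)).
Proof.
  intros [(a & b & c & d & u & v & E) (g & G1 & G2)] [(a' & b' & c' & d' & u' & v' & E') (g' & G1' & G2')].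
  split.
  - exists (a * a' + b * c'), (a * b' + b * d'), (c * a' + d * c'), (c * b' + d * d'),
      (a * u' + b * v' + u), (c * u' + d * v' + v).
    intros x y. rewrite E', E. f_equal; ring.
  - exists (fun p => g' (g p)). split; intros p.
    + now rewrite G1, G1'.
    + now rewrite G2', G2.
Qed.

Lemma invertible_affine_inverse h : invertible_affine_map h ->
  exists g, invertible_affine_map g /\ (forall p, g (h p) = p) /\ (forall p, h (g p) = p).
Proof.
  intros H. destruct (invertible_affineE h H) as (a & b & c & d & u & v & D & ->).
  exists (affine_inv a b c d u v). split; [|split]; intros.
  - apply invertible_affine. now apply affine_inv_det.
  - now apply affine_invK.
  - now apply affineK.
Qed.

Lemma equivalent_intro (f g : plane -> plane) a b c d u v a' b' c' d' u' v' :
  a * d - b * c <> 0 -> a' * d' - b' * c' <> 0 ->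
  (forall x y, affine a' b' c' d' u' v' (f (x, y)) = g (affine a b c d u v (x, y))) ->
  affinely_map_equivalent f g.
Proof.
  intros D D' E. exists (affine a b c d u v), (affine a' b' c' d' u' v').
  split; [|split]; [now apply invertible_affine|now apply invertible_affine|].
  intros [x y]. apply E.
Qed.

Lemma equivalent_sym f g : affinely_map_equivalent f g -> affinely_map_equivalent g f.
Proof.
  intros (h & k & Hh & Hk & E).
  destruct (invertible_affine_inverse h Hh) as (h' & Hh' & h1 & h2).
  destruct (invertible_affine_inverse k Hk) as (k' & Hk' & k1 & k2).
  exists h', k'. split; [|split]; auto.
  intros p. rewrite <- (h2 p) at 1. now rewrite <- E, k1.
Qed.

Lemma equivalent_trans f g e : affinely_map_equivalent f g ->
  affinely_map_equivalent g e -> affinely_map_equivalent f e.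
Proof.
  intros (h & k & Hh & Hk & E) (h' & k' & Hh' & Hk' & E').
  exists (fun p => h' (h p)), (fun p => k' (k p)).
  split; [|split]; try now apply invertible_affine_comp.
  intros p. now rewrite E, E'.
Qed.

Lemma image_comp f g S : image f (image g S) = image (fun p => f (g p)) S.
Proof.
  apply seteq_eq. intros p. split.
  - intros (q & (r & Hr & <-) & <-). now exists r.
  - intros (r & Hr & <-). exists (g r). split; [now exists r|reflexivity].
Qed.

Lemma image_inverse (h g : plane -> plane) S :
  (forall p, g (h p) = p) -> (forall p, h (g p) = p) -> image h S = fun p => S (g p).
Proof.
  intros H1 H2. apply seteq_eq. intros p. split.
  - intros (q & Hq & <-). now rewrite H1.
  - intros H. now exists (g p).
Qed.

Lemma image_union f S T : image f (union S T) = union (image f S) (image f T).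
Proof.
  apply seteq_eq. intros p. split.
  - intros (q & [H|H] & <-); [left|right]; now exists q.
  - intros [(q & H & <-)|(q & H & <-)]; exists q; split; auto; [now left|now right].
Qed.

(** * Smooth functions of two variables *)

Definition smooth2 (U : plane -> Prop) (f : R -> R -> R) : Prop :=
  forall n x y, U (x, y) -> ex_diff_n f n x y.

Definition dx (f : R -> R -> R) (x y : R) := Derive (fun z => f z y) x.
Definition dy (f : R -> R -> R) (x y : R) := Derive (fun z => f x z) y.

Lemma open_locally_2d (U : plane -> Prop) x y :
  open U -> U (x, y) -> locally_2d (fun u v => U (u, v)) x y.
Proof.
  intros HU Hp. apply locally_2d_locally.
  generalize (HU _ Hp). apply filter_imp. now intros [u v].
Qed.

(** Induction on the order for all members of [P] at once. Since [U] is open, the partial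
    derivatives agree with members of [P] on a neighbourhood of each point, which is what the
    recursive clauses of [ex_diff_n] need. *)
Lemma smooth2_tower (U : plane -> Prop) (P : (R -> R -> R) -> Prop) :
  open U ->
  (forall f, P f -> exists fx fy, P fx /\ P fy /\
     forall x y, U (x, y) -> differentiable_pt_lim f x y (fx x y) (fy x y)) ->
  forall f, P f -> smooth2 U f.
Proof.
  intros HU HP f Hf n. revert f Hf.
  induction n as [|n IH]; intros f Hf x y Hxy;
    destruct (HP f Hf) as (fx & fy & Hx & Hy & Hd).
  - split; [|exact I]. apply differentiable_continuity_pt.
    exists (fx x y), (fy x y). now apply Hd.
  - assert (E : locally_2d (fun u v => fx u v = Derive (fun z => f z v) u /\
                                      fy u v = Derive (fun z => f u z) v) x y).
    { generalize (open_locally_2d U x y HU Hxy).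
      apply locally_2d_impl, locally_2d_forall. intros u v Huv.
      destruct (differentiable_pt_lim_unique _ _ _ _ _ (Hd u v Huv)); auto. }
    split; [|split; [|split; [|split]]].
    + apply differentiable_continuity_pt. exists (fx x y), (fy x y). now apply Hd.
    + exists (fx x y). apply is_derive_Reals.
      replace (fx x y) with (fx x y * 1 + fy x y * 0) by ring.
      apply (derivable_pt_lim_comp_2d f (fun t => t) (fun _ => y)); [now apply Hd| |].
      apply derivable_pt_lim_id. apply derivable_pt_lim_const.
    + exists (fy x y). apply is_derive_Reals.
      replace (fy x y) with (fx x y * 0 + fy x y * 1) by ring.
      apply (derivable_pt_lim_comp_2d f (fun _ => x) (fun t => t)); [now apply Hd| |].
      apply derivable_pt_lim_const. apply derivable_pt_lim_id.
    + apply ex_diff_n_ext_loc with fx; [|now apply IH].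
      revert E. apply locally_2d_impl, locally_2d_forall. tauto.
    + apply ex_diff_n_ext_loc with fy; [|now apply IH].
      revert E. apply locally_2d_impl, locally_2d_forall. tauto.
Qed.

Lemma smooth2_dx U f : smooth2 U f -> smooth2 U (dx f).
Proof. intros H n x y Hp. now destruct (H (S n) x y Hp) as (_ & _ & _ & ? & _). Qed.

Lemma smooth2_dy U f : smooth2 U f -> smooth2 U (dy f).
Proof. intros H n x y Hp. now destruct (H (S n) x y Hp) as (_ & _ & _ & _ & ?). Qed.

(** Both partial derivatives exist and the one in [x] is continuous, which is enough for a total
    derivative. *)
Lemma smooth2_differentiable U f x y : open U -> smooth2 U f -> U (x, y) ->
  differentiable_pt_lim f x y (dx f x y) (dy f x y).
Proof.
  intros HU H Hp. apply filterdiff_differentiable_pt_lim.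
  eapply filterdiff_ext_lin; [apply (is_derive_filterdiff f x y (dx f) (dy f x y))|].
  - generalize (HU _ Hp). apply filter_imp. intros [u v] Huv.
    destruct (H 1%nat u v Huv) as (_ & Hx & _). now apply Derive_correct.
  - destruct (H 1%nat x y Hp) as (_ & _ & Hy & _). now apply Derive_correct.
  - apply continuity_2d_pt_filterlim, (smooth2_dx U f H 0%nat x y Hp).
  - intros [u v]. reflexivity.
Qed.

Lemma differentiable_pt_lim_plus f g x y fx fy gx gy :
  differentiable_pt_lim f x y fx fy -> differentiable_pt_lim g x y gx gy ->
  differentiable_pt_lim (fun u v => f u v + g u v) x y (fx + gx) (fy + gy).
Proof.
  rewrite <- !filterdiff_differentiable_pt_lim. intros Hf Hg.
  eapply filterdiff_ext_lin; [apply (filterdiff_plus_fct _ _ _ _ Hf Hg)|].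
  intros [u v]. simpl. unfold plus; simpl. ring.
Qed.

Lemma differentiable_pt_lim_mult f g x y fx fy gx gy :
  differentiable_pt_lim f x y fx fy -> differentiable_pt_lim g x y gx gy ->
  differentiable_pt_lim (fun u v => f u v * g u v) x y
    (fx * g x y + f x y * gx) (fy * g x y + f x y * gy).
Proof.
  rewrite <- !filterdiff_differentiable_pt_lim. intros Hf Hg.
  eapply filterdiff_ext_lin; [apply (filterdiff_mult_fct _ _ _ _ _ Rmult_comm Hf Hg)|].
  intros [u v]. simpl. unfold plus, mult; simpl. ring.
Qed.

Lemma differentiable_pt_lim_fun1 g x y l :
  derivable_pt_lim g x l -> differentiable_pt_lim (fun u _ => g u) x y l 0.
Proof. apply differentiable_pt_lim_proj1_0. Qed.

Inductive generated (U V : plane -> Prop) (p q : R -> R -> R) : (R -> R -> R) -> Prop :=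
  | gen_base b : smooth2 U b -> generated U V p q b
  | gen_comp a : smooth2 V a -> generated U V p q (fun x y => a (p x y) (q x y))
  | gen_plus f g : generated U V p q f -> generated U V p q g ->
      generated U V p q (fun x y => f x y + g x y)
  | gen_mult f g : generated U V p q f -> generated U V p q g ->
      generated U V p q (fun x y => f x y * g x y).

(* Chain and Leibniz rules: the algebra over the smooth functions generated by
   the composites [a (p, q)] is closed under partial derivatives. *)
Lemma generated_smooth2 U V p q : open U -> open V -> smooth2 U p -> smooth2 U q ->
  (forall x y, U (x, y) -> V (p x y, q x y)) ->
  forall f, generated U V p q f -> smooth2 U f.
Proof.
  intros HU HV Hp Hq HUV. apply smooth2_tower; [exact HU|].
  induction 1 as [b Hb|a Ha|f g Hf (fx & fy & Hfx & Hfy & Df) Hg (gx & gy & Hgx & Hgy & Dg)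
                 |f g Hf (fx & fy & Hfx & Hfy & Df) Hg (gx & gy & Hgx & Hgy & Dg)].
  - exists (dx b), (dy b).
    split; [|split]; [apply gen_base, smooth2_dx, Hb|apply gen_base, smooth2_dy, Hb|].
    intros x y Hxy. now apply (smooth2_differentiable U).
  - exists (fun x y => dx a (p x y) (q x y) * dx p x y + dy a (p x y) (q x y) * dx q x y).
    exists (fun x y => dx a (p x y) (q x y) * dy p x y + dy a (p x y) (q x y) * dy q x y).
    pose proof (smooth2_dx V a Ha) as Hax. pose proof (smooth2_dy V a Ha) as Hay.
    split; [|split].
    + apply gen_plus; apply gen_mult;
        [apply (gen_comp _ _ _ _ (dx a))|apply gen_base|
         apply (gen_comp _ _ _ _ (dy a))|apply gen_base];
        auto using smooth2_dx.
    + apply gen_plus; apply gen_mult;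
        [apply (gen_comp _ _ _ _ (dx a))|apply gen_base|
         apply (gen_comp _ _ _ _ (dy a))|apply gen_base];
        auto using smooth2_dy.
    + intros x y Hxy. apply differentiable_pt_lim_comp.
      apply (smooth2_differentiable V); auto.
      now apply (smooth2_differentiable U).
      now apply (smooth2_differentiable U).
  - exists (fun x y => fx x y + gx x y), (fun x y => fy x y + gy x y).
    split; [|split]; [now apply gen_plus|now apply gen_plus|].
    intros x y Hxy. apply differentiable_pt_lim_plus; auto.
  - exists (fun x y => fx x y * g x y + f x y * gx x y),
           (fun x y => fy x y * g x y + f x y * gy x y).
    split; [|split]; [apply gen_plus; now apply gen_mult|apply gen_plus; now apply gen_mult|].
    intros x y Hxy. apply differentiable_pt_lim_mult; auto.
Qed.

Lemma smooth2_const U c : smooth2 U (fun _ _ => c).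
Proof.
  intros n x y _. revert c. induction n as [|n IH]; intros c; (split; [apply continuity_2d_pt_const|]).
  - exact I.
  - split; [apply ex_derive_const|split; [apply ex_derive_const|split]].
    + apply ex_diff_n_ext_loc with (fun _ _ => 0); [|apply IH].
      apply locally_2d_forall. intros u v. now rewrite Derive_const.
    + apply ex_diff_n_ext_loc with (fun _ _ => 0); [|apply IH].
      apply locally_2d_forall. intros u v. now rewrite Derive_const.
Qed.

Lemma smooth2_fst U : smooth2 U (fun x _ => x).
Proof.
  intros n x y _. destruct n as [|n]; (split; [apply continuity_2d_pt_id1|]).
  - exact I.
  - split; [apply ex_derive_id|split; [apply ex_derive_const|split]].
    + apply ex_diff_n_ext_loc with (fun _ _ => 1); [|now apply (smooth2_const (fun _ => True))].
      apply locally_2d_forall. intros u v. now rewrite Derive_id.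
    + apply ex_diff_n_ext_loc with (fun _ _ => 0); [|now apply (smooth2_const (fun _ => True))].
      apply locally_2d_forall. intros u v. now rewrite Derive_const.
Qed.

Lemma smooth2_snd U : smooth2 U (fun _ y => y).
Proof.
  intros n x y _. destruct n as [|n]; (split; [apply continuity_2d_pt_id2|]).
  - exact I.
  - split; [apply ex_derive_const|split; [apply ex_derive_id|split]].
    + apply ex_diff_n_ext_loc with (fun _ _ => 0); [|now apply (smooth2_const (fun _ => True))].
      apply locally_2d_forall. intros u v. now rewrite Derive_const.
    + apply ex_diff_n_ext_loc with (fun _ _ => 1); [|now apply (smooth2_const (fun _ => True))].
      apply locally_2d_forall. intros u v. now rewrite Derive_id.
Qed.

(** The algebra of the chain rule, taken over the identity map, already contains sums of smooth
    functions; products are obtained in the same way. *)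
Lemma smooth2_plus U f g : open U -> smooth2 U f -> smooth2 U g ->
  smooth2 U (fun x y => f x y + g x y).
Proof.
  intros HU Hf Hg.
  apply (generated_smooth2 U U (fun x _ => x) (fun _ y => y));
    auto using smooth2_fst, smooth2_snd, gen_plus, gen_base.
Qed.

Lemma smooth2_mult U f g : open U -> smooth2 U f -> smooth2 U g ->
  smooth2 U (fun x y => f x y * g x y).
Proof.
  intros HU Hf Hg.
  apply (generated_smooth2 U U (fun x _ => x) (fun _ y => y));
    auto using smooth2_fst, smooth2_snd, gen_mult, gen_base.
Qed.

Lemma smooth2_comp U V a p q : open U -> open V -> smooth2 V a -> smooth2 U p ->
  smooth2 U q -> (forall x y, U (x, y) -> V (p x y, q x y)) ->
  smooth2 U (fun x y => a (p x y) (q x y)).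
Proof.
  intros HU HV Ha Hp Hq HUV.
  apply (generated_smooth2 U V p q); auto using gen_comp.
Qed.

Lemma smooth2_opp U f : open U -> smooth2 U f -> smooth2 U (fun x y => - f x y).
Proof.
  intros HU Hf n x y Hp.
  apply ex_diff_n_ext_loc with (fun u v => (-1) * f u v).
  - apply locally_2d_forall. intros; ring.
  - apply (smooth2_mult U (fun _ _ => -1) f); auto using smooth2_const.
Qed.

Lemma smooth2_minus U f g : open U -> smooth2 U f -> smooth2 U g ->
  smooth2 U (fun x y => f x y - g x y).
Proof. intros. apply smooth2_plus; auto. now apply smooth2_opp. Qed.

Lemma smooth2_pow U f n : open U -> smooth2 U f -> smooth2 U (fun x y => f x y ^ n).
Proof.
  intros HU Hf. induction n as [|n IH]; simpl.
  - apply smooth2_const.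
  - now apply smooth2_mult.
Qed.

(** * Inverses and square roots of positive smooth functions *)

Definition right_half_plane : plane -> Prop := fun p => 0 < fst p.

Lemma open_gt0 (g : plane -> R) : (forall p, continuous g p) -> open (fun p => 0 < g p).
Proof.
  intros H. apply (open_comp g (fun t => 0 < t)); [intros; apply H|apply open_gt].
Qed.

Lemma open_right_half_plane : open right_half_plane.
Proof. apply (open_gt0 fst). intros [x y]. apply continuous_fst. Qed.

(** Two generators suffice for closure under differentiation: the derivative of [/ x] is
    [- (/ x * / x)], and that of [sqrt x] can be written [/ 2 * (sqrt x * / x)]. *)
Inductive inv_sqrt_algebra : (R -> R -> R) -> Prop :=
  | isa_const c : inv_sqrt_algebra (fun _ _ => c)
  | isa_inv : inv_sqrt_algebra (fun x _ => / x)
  | isa_sqrt : inv_sqrt_algebra (fun x _ => sqrt x)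
  | isa_plus f g : inv_sqrt_algebra f -> inv_sqrt_algebra g ->
      inv_sqrt_algebra (fun x y => f x y + g x y)
  | isa_mult f g : inv_sqrt_algebra f -> inv_sqrt_algebra g ->
      inv_sqrt_algebra (fun x y => f x y * g x y).

Lemma inv_sqrt_algebra_smooth2 f : inv_sqrt_algebra f -> smooth2 right_half_plane f.
Proof.
  revert f. apply smooth2_tower; [apply open_right_half_plane|].
  induction 1 as [c| | |f g Hf (fx & fy & Hfx & Hfy & Df) Hg (gx & gy & Hgx & Hgy & Dg)
                 |f g Hf (fx & fy & Hfx & Hfy & Df) Hg (gx & gy & Hgx & Hgy & Dg)].
  - exists (fun _ _ => 0), (fun _ _ => 0). repeat split; try apply isa_const.
    intros x y _. apply (differentiable_pt_lim_fun1 (fun _ => c)), derivable_pt_lim_const.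
  - exists (fun x _ => -1 * (/ x * / x)), (fun _ _ => 0).
    repeat split; try apply isa_const.
    + apply (isa_mult (fun _ _ => -1)); [apply isa_const|].
      apply (isa_mult (fun x _ => / x)); apply isa_inv.
    + intros x y H. apply (differentiable_pt_lim_fun1 Rinv). apply is_derive_Reals.
      unfold right_half_plane in H; simpl in H.
      auto_derive; [lra|]. field. lra.
  - exists (fun x _ => / 2 * (sqrt x * / x)), (fun _ _ => 0).
    repeat split; try apply isa_const.
    + apply (isa_mult (fun _ _ => / 2)); [apply isa_const|].
      apply (isa_mult (fun x _ => sqrt x)); constructor.
    + intros x y H. unfold right_half_plane in H; simpl in H.
      apply (differentiable_pt_lim_fun1 sqrt). 
      replace (/ 2 * (sqrt x * / x)) with (/ (2 * sqrt x)).
      now apply derivable_pt_lim_sqrt.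
      pose proof (sqrt_lt_R0 x H).
      rewrite <- (sqrt_sqrt x) at 3 by lra. field. lra.
  - exists (fun x y => fx x y + gx x y), (fun x y => fy x y + gy x y).
    split; [|split]; [now apply isa_plus|now apply isa_plus|].
    intros x y Hxy. apply differentiable_pt_lim_plus; auto.
  - exists (fun x y => fx x y * g x y + f x y * gx x y),
           (fun x y => fy x y * g x y + f x y * gy x y).
    split; [|split]; [apply isa_plus; now apply isa_mult|apply isa_plus; now apply isa_mult|].
    intros x y Hxy. apply differentiable_pt_lim_mult; auto.
Qed.

Lemma smooth2_sqrt U f : open U -> smooth2 U f -> (forall x y, U (x, y) -> 0 < f x y) ->
  smooth2 U (fun x y => sqrt (f x y)).
Proof.
  intros HU Hf Hpos.
  (* A function of one variable is treated as one of two variables on the half plane, with [0] as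
     dummy second argument. *)
  apply (smooth2_comp U right_half_plane (fun x _ => sqrt x) f (fun _ _ => 0));
    auto using open_right_half_plane, smooth2_const, inv_sqrt_algebra_smooth2, isa_sqrt.
Qed.

Lemma smooth2_inv U f : open U -> smooth2 U f -> (forall x y, U (x, y) -> 0 < f x y) ->
  smooth2 U (fun x y => / f x y).
Proof.
  intros HU Hf Hpos.
  apply (smooth2_comp U right_half_plane (fun x _ => / x) f (fun _ _ => 0));
    auto using open_right_half_plane, smooth2_const, inv_sqrt_algebra_smooth2, isa_inv.
Qed.

(** * Local diffeomorphisms and smooth paths *)

Lemma smooth_on_continuous U phi p : smooth_on U phi -> U p ->
  filterlim phi (locally p) (locally (phi p)).
Proof.
  intros H Hp. destruct p as [x y]. destruct (H 0%nat x y Hp) as [[H1 _] [H2 _]].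
  apply continuity_2d_pt_filterlim in H1. apply continuity_2d_pt_filterlim in H2.
  assert (L : filterlim (fun z : plane => (fst (phi (fst z, snd z)), snd (phi (fst z, snd z))))
     (locally (x, y)) (filter_prod (locally (fst (phi (x, y)))) (locally (snd (phi (x, y)))))).
  { now apply filterlim_pair. }
  intros P [eps He]. unfold filtermap.
  specialize (L P). unfold filtermap in L.
  eapply filter_imp; [|apply L].
  - intros [a b] HP. simpl in HP. rewrite (surjective_pairing (phi (a, b))). exact HP.
  - exists (ball (fst (phi (x, y))) eps) (ball (snd (phi (x, y))) eps);
      [apply locally_ball|apply locally_ball|].
    intros a b Ha Hb. apply He. now split.
Qed.

Lemma open_preimage_on U V phi : open U -> open V -> smooth_on U phi ->
  open (fun p => U p /\ V (phi p)).
Proof.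
  intros HU HV Hs p [Hp Hv]. apply filter_and; [now apply HU|].
  apply (smooth_on_continuous U phi p Hs Hp V). now apply HV.
Qed.

Lemma smooth_on_subset (U V : plane -> Prop) phi : (forall p, V p -> U p) ->
  smooth_on U phi -> smooth_on V phi.
Proof. intros H Hs n x y Hp. apply Hs, H, Hp. Qed.

Lemma smooth_on_intro U (p q : R -> R -> R) : smooth2 U p -> smooth2 U q ->
  smooth_on U (fun z => (p (fst z) (snd z), q (fst z) (snd z))).
Proof. intros Hp Hq n x y H. split; [now apply Hp|now apply Hq]. Qed.

Lemma smooth_on_comp U V phi psi : open U -> open V ->
  smooth_on U phi -> smooth_on V psi -> (forall p, U p -> V (phi p)) ->
  smooth_on U (fun p => psi (phi p)).
Proof.
  intros HU HV Hphi Hpsi HUV.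
  assert (H1 : smooth2 U (fun s t => fst (phi (s, t)))) by (intros n x y H; now apply Hphi).
  assert (H2 : smooth2 U (fun s t => snd (phi (s, t)))) by (intros n x y H; now apply Hphi).
  assert (E : forall s t, phi (s, t) = (fst (phi (s, t)), snd (phi (s, t))))
    by (intros s t; apply surjective_pairing).
  assert (K1 : smooth2 U (fun s t => fst (psi (fst (phi (s, t)), snd (phi (s, t)))))).
  { apply (smooth2_comp U V (fun a b => fst (psi (a, b)))); auto.
    - intros n x y H; now apply Hpsi.
    - intros x y H. rewrite <- E. now apply HUV. }
  assert (K2 : smooth2 U (fun s t => snd (psi (fst (phi (s, t)), snd (phi (s, t)))))).
  { apply (smooth2_comp U V (fun a b => snd (psi (a, b)))); auto.
    - intros n x y H; now apply Hpsi.
    - intros x y H. rewrite <- E. now apply HUV. }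
  intros n x y H. split.
  - eapply ex_diff_n_ext_loc; [|apply (K1 n x y H)].
    apply locally_2d_forall. intros u v. now rewrite <- E.
  - eapply ex_diff_n_ext_loc; [|apply (K2 n x y H)].
    apply locally_2d_forall. intros u v. now rewrite <- E.
Qed.

(** Cuts a chart down to an open [W] on which the equation of the set is valid. The codomain shrinks
    to the preimage of [W] under [psi], which is open because [psi] is continuous. *)
Lemma locally_diffeomorphic_intro U V W phi psi S p T q :
  diffeomorphism U V phi psi -> open W -> U p -> W p -> phi p = q ->
  (forall r, U r -> W r -> (S r <-> T (phi r))) -> locally_diffeomorphic S p T q.
Proof.
  intros (HU & HV & Hphi & Hpsi & H1 & H2) HW Up Wp <- E.
  exists (fun r => U r /\ W r), (fun r => V r /\ W (psi r)), phi, psi.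
  split; [|split; [|split]]; auto.
  - split; [|split; [|split; [|split; [|split]]]].
    + now apply open_and.
    + now apply open_preimage_on.
    + apply smooth_on_subset with U; [tauto|auto].
    + apply smooth_on_subset with V; [tauto|auto].
    + intros r [Ur Wr]. destruct (H1 r Ur) as [Vr Er]. now rewrite Er.
    + intros r [Vr Wr]. destruct (H2 r Vr) as [Ur Er]. auto.
  - intros r [Ur Wr]. now apply E.
Qed.

Lemma locally_diffeomorphic_trans S p T q W r :
  locally_diffeomorphic S p T q -> locally_diffeomorphic T q W r ->
  locally_diffeomorphic S p W r.
Proof.
  intros (U & V & phi & psi & (HU & HV & Hphi & Hpsi & H1 & H2) & Up & <- & E)
         (U' & V' & phi' & psi' & (HU' & HV' & Hphi' & Hpsi' & H1' & H2') & Up' & <- & E').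
  exists (fun x => U x /\ U' (phi x)), (fun x => V' x /\ V (psi' x)),
    (fun x => phi' (phi x)), (fun x => psi (psi' x)).
  assert (O1 : open (fun x => U x /\ U' (phi x))) by now apply open_preimage_on.
  assert (O2 : open (fun x => V' x /\ V (psi' x))) by now apply open_preimage_on.
  split; [|split; [|split]]; auto.
  - split; [|split; [|split; [|split; [|split]]]]; auto.
    + apply smooth_on_comp with U'; auto; [|tauto].
      apply smooth_on_subset with U; [tauto|auto].
    + apply smooth_on_comp with V; auto; [|tauto].
      apply smooth_on_subset with V'; [tauto|auto].
    + intros x [Ux Ux']. destruct (H1 x Ux) as [Vx Ex]. destruct (H1' _ Ux') as [Vx' Ex'].
      now rewrite Ex'.
    + intros x [Vx Vx']. destruct (H2' x Vx) as [Ux Ex]. destruct (H2 _ Vx') as [Ux' Ex'].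
      now rewrite Ex'.
  - intros x [Ux Ux']. now rewrite E, E'.
Qed.

Lemma open_plane : open (fun _ : plane => True).
Proof. apply open_true. Qed.

Lemma open_affine_gt a b c : open (fun p : plane => 0 < a * fst p + b * snd p + c).
Proof.
  apply (open_gt0 (fun p => a * fst p + b * snd p + c)). intros [x y].
  apply (continuous_plus (fun p : plane => a * fst p + b * snd p) (fun _ => c)).
  - apply (continuous_plus (fun p : plane => a * fst p) (fun p => b * snd p)).
    + apply (continuous_mult (fun _ => a) fst); [apply continuous_const|apply continuous_fst].
    + apply (continuous_mult (fun _ => b) snd); [apply continuous_const|apply continuous_snd].
  - apply continuous_const.
Qed.

Ltac smooth :=
  repeat first [apply smooth2_const | apply smooth2_fst | apply smooth2_snd
    | apply smooth2_plus | apply smooth2_minus | apply smooth2_mult | apply smooth2_opp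
    | apply smooth2_pow | apply smooth2_sqrt | apply smooth2_inv ];
  auto using open_affine_gt, open_plane.

Lemma smooth_on_affine U a b c d u v : open U -> smooth_on U (affine a b c d u v).
Proof.
  intros HU.
  apply (smooth_on_intro U (fun x y => a * x + b * y + u) (fun x y => c * x + d * y + v)); smooth.
Qed.

Lemma locally_diffeomorphic_affine m S p :
  invertible_affine_map m -> locally_diffeomorphic (image m S) (m p) S p.
Proof.
  intros Hm. destruct (invertible_affine_inverse m Hm) as (g & Hg & G1 & G2).
  exists (fun _ => True), (fun _ => True), g, m.
  split; [|split; [|split]]; auto.
  - split; [|split; [|split; [|split; [|split]]]]; auto using open_plane.
    + destruct (invertible_affineE g Hg) as (a & b & c & d & u & v & _ & ->).
      apply smooth_on_affine, open_plane.
    + destruct (invertible_affineE m Hm) as (a & b & c & d & u & v & _ & ->).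
      apply smooth_on_affine, open_plane.
  - intros r _. now rewrite (image_inverse m g S G1 G2).
Qed.

Lemma smooth_at_affine m S p : invertible_affine_map m -> smooth_at S p -> smooth_at (image m S) (m p).
Proof.
  intros Hm [Sp H]. split; [now exists p|].
  apply locally_diffeomorphic_trans with S p; auto using locally_diffeomorphic_affine.
Qed.

Lemma cusp_at_affine m S p : invertible_affine_map m -> cusp_at S p -> cusp_at (image m S) (m p).
Proof.
  intros Hm [Sp H]. split; [now exists p|].
  apply locally_diffeomorphic_trans with S p; auto using locally_diffeomorphic_affine.
Qed.

Lemma smooth_except_cusps_affine m S l : invertible_affine_map m ->
  smooth_except_cusps S l -> smooth_except_cusps (image m S) (map m l).
Proof.
  intros Hm (H1 & H2 & H3). destruct (invertible_affine_inverse m Hm) as (g & Hg & G1 & G2).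
  split; [|split].
  - apply Injective_map_NoDup; auto.
    intros x y e. now rewrite <- (G1 x), e, G1.
  - intros p Hp. apply in_map_iff in Hp. destruct Hp as (q & <- & Hq).
    apply cusp_at_affine; auto.
  - intros p (q & Hq & <-) Hn. apply smooth_at_affine; auto.
    apply H3; auto. intros Hi. now apply Hn, in_map.
Qed.


(** One-variable counterpart of [smooth2_tower]: every iterated derivative of a member coincides
    with a member. *)
Lemma smooth_path_tower (P : (R -> R) -> Prop) :
  (forall f, P f -> exists f', P f' /\ forall t, is_derive f t (f' t)) ->
  forall f, P f -> forall n t, ex_derive_n f n t.
Proof.
  intros HP f Hf n t.
  assert (H : forall n, exists g, P g /\ forall t, Derive_n f n t = g t).
  { clear n t. intros n. induction n as [|n (g & Hg & E)].
    - now exists f.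
    - destruct (HP g Hg) as (g' & Hg' & D). exists g'. split; auto.
      intros t. simpl. rewrite (Derive_ext _ g) by exact E. now apply is_derive_unique. }
  destruct n as [|n]; [exact I|]. simpl.
  destruct (H n) as (g & Hg & E). destruct (HP g Hg) as (g' & _ & D).
  apply ex_derive_ext with g; [now intros|now exists (g' t)].
Qed.

Lemma smooth_path_affine m gamma : invertible_affine_map m -> smooth_path gamma ->
  smooth_path (fun t => m (gamma t)).
Proof.
  intros Hm Hs. destruct (invertible_affineE m Hm) as (a & b & c & d & u & v & _ & ->).
  assert (K : forall a b u n t, ex_derive_n (fun s => a * fst (gamma s) + b * snd (gamma s) + u) n t).
  { clear -Hs. intros a b u n t.
    apply ex_derive_n_plus; apply filter_forall; intros y k _.
    - apply ex_derive_n_plus; apply filter_forall; intros z j _;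
      apply ex_derive_n_scal_l, Hs.
    - apply ex_derive_n_const. }
  intros n t. split; apply K.
Qed.

Lemma curve_affine m S : invertible_affine_map m -> curve S -> curve (image m S).
Proof.
  intros Hm (gamma & Hs & E). exists (fun t => m (gamma t)). split; [now apply smooth_path_affine|].
  rewrite (seteq_eq _ _ E). intros p. split.
  - intros (q & (t & <-) & <-). now exists t.
  - intros (t & <-). exists (gamma t). split; [now exists t|reflexivity].
Qed.

Lemma closed_curve_affine m S : invertible_affine_map m -> closed_curve S -> closed_curve (image m S).
Proof.
  intros Hm (gamma & T & Hs & HT & Per & E). exists (fun t => m (gamma t)), T.
  split; [now apply smooth_path_affine|split; [auto|split; [intros t; now rewrite Per|]]].
  rewrite (seteq_eq _ _ E). intros p. split.
  - intros (q & (t & <-) & <-). now exists t.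
  - intros (t & <-). exists (gamma t). split; [now exists t|reflexivity].
Qed.

(** * Cardinalities and real roots *)

Lemma has_cardinality_unique S k k' : has_cardinality S k -> has_cardinality S k' -> k = k'.
Proof.
  destruct k as [n|], k' as [n'|]; simpl; auto.
  - intros (l & N & <- & E) (l' & N' & <- & E'). f_equal.
    apply Nat.le_antisymm; apply NoDup_incl_length; auto; intros p Hp.
    + now apply E', E.
    + now apply E, E'.
  - intros (l & _ & _ & E) H. elim H. exists l. intros p. apply E.
  - intros H (l & _ & _ & E). elim H. exists l. intros p. apply E.
Qed.

(** Membership in [S] is not decidable, so the list is filtered, and its repetitions removed, by
    excluded middle. *)
Lemma cardinality_le_length (S : plane -> Prop) l : (forall p, S p -> In p l) ->
  exists n, (n <= length l)%nat /\ has_cardinality S (Fin n).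
Proof.
  intros H.
  assert (K : exists l', NoDup l' /\ (length l' <= length l)%nat /\
            forall p, In p l' <-> In p l /\ S p).
  { clear H. induction l as [|q l (l' & N & L & E)].
    - exists []. split; [constructor|split; [auto|]]. simpl; tauto.
    - destruct (classic (S q /\ ~ In q l')) as [[Sq Hq]|Hq].
      + exists (q :: l'). split; [now constructor|split; [simpl; lia|]].
        intros p. simpl. rewrite E. split; [|tauto]. intros [<-|]; tauto.
      + exists l'. split; [auto|split; [simpl; lia|]].
        intros p. rewrite E. simpl. split; [tauto|].
        intros [[<-|Hp] Sp]; [|tauto].
        apply E. apply NNPP. tauto. }
  destruct K as (l' & N & L & E). exists (length l'). split; [auto|].
  exists l'. split; [auto|split; [auto|]]. intros p. rewrite E. split; [tauto|auto].
Qed.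

Lemma cardinality_list (S : plane -> Prop) l : NoDup l -> (forall p, S p <-> In p l) ->
  has_cardinality S (Fin (length l)).
Proof. intros N E. exists l. split; [auto|split; [auto|]]. intros p. now rewrite E. Qed.

Lemma length_le_cardinality S l n : NoDup l -> (forall p, In p l -> S p) ->
  has_cardinality S (Fin n) -> (length l <= n)%nat.
Proof.
  intros N H (l' & _ & <- & E). apply NoDup_incl_length; auto. intros p Hp. now apply E, H.
Qed.

Lemma cardinality_infinite S (g : R -> plane) :
  (forall t, S (g t)) -> (forall t t', g t = g t' -> t = t') -> has_cardinality S Inf.
Proof.
  intros Hg inj (l & Hl).
  (* Pigeonhole: one more sample point of the curve than the list has entries. *)
  assert (L : (length (map (fun i => g (INR i)) (seq 0 (Datatypes.S (length l)))) <= length l)%nat).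
  { apply NoDup_incl_length.
    - apply Injective_map_NoDup; [|apply seq_NoDup].
      intros i j e. now apply INR_eq, inj.
    - intros p Hp. apply in_map_iff in Hp. destruct Hp as (i & <- & _). apply Hl, Hg. }
  rewrite length_map, length_seq in L. lia.
Qed.

(** Cardinalities are unique, so it is enough that every fibre has some listed one and that every
    listed one occurs. *)
Lemma preimage_cardinalities_intro f l :
  (forall p, exists k, In k l /\ has_cardinality (preimage f p) k) ->
  (forall k, In k l -> exists p, has_cardinality (preimage f p) k) ->
  preimage_cardinalities_are f l.
Proof.
  intros H1 H2 k. split; auto.
  intros (p & Hp). destruct (H1 p) as (k' & Hk & Hp').
  now rewrite (has_cardinality_unique _ _ _ Hp Hp').
Qed.

(** The constant term comes first. Zero leading coefficients are allowed, so the length bounds the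
    degree from above only. *)
Definition horner (l : list R) (x : R) : R := fold_right (fun a s => a + x * s) 0 l.

(** Synthetic division: the coefficients of the quotient are the partial Horner values at [r]. *)
Lemma horner_divide l r : exists l', length l' = pred (length l) /\
  forall x, horner l x = horner l r + (x - r) * horner l' x.
Proof.
  induction l as [|a [|b l] (l' & L & E)].
  - exists []. split; auto. intros; simpl; ring.
  - exists []. split; auto. intros; simpl; ring.
  - exists (horner (b :: l) r :: l'). split; [simpl; now rewrite L|].
    intros x. change (horner (a :: b :: l)) with (fun x => a + x * horner (b :: l) x).
    cbv beta. rewrite E.
    change (horner (horner (b :: l) r :: l') x) with (horner (b :: l) r + x * horner l' x). ring.
Qed.

(** A nonzero value at [x0] stands for a nonzero polynomial. It passes to the quotient by a root,
    since a zero of the quotient is a zero of the polynomial. *)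
Lemma horner_roots l x0 : horner l x0 <> 0 ->
  exists rs, (length rs <= pred (length l))%nat /\ forall x, horner l x = 0 -> In x rs.
Proof.
  remember (length l) as n eqn:Hn. revert l Hn. induction n as [|n IH]; intros l Hn H0.
  - destruct l; [|easy]. now elim H0.
  - destruct (classic (exists r, horner l r = 0)) as [(r & Hr)|H].
    + destruct (horner_divide l r) as (l' & L & E).
      destruct (IH l') as (rs & Lr & Hrs).
      * rewrite L, <- Hn. reflexivity.
      * intros e. apply H0. rewrite E, Hr, e. ring.
      * exists (r :: rs). split.
        (* The length bound has room for [r] unless the list is a single constant, and a constant
           with a root would vanish at [x0]. *)
        -- destruct n; [|simpl in *; lia].
           exfalso. destruct l as [|a [|]]; try easy. simpl in *. apply H0. lra.
        -- intros x Hx. rewrite E, Hr in Hx. simpl.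
           destruct (Req_dec x r) as [->|Hxr]; [now left|right].
           apply Hrs. apply Rmult_eq_reg_l with (x - r); lra.
    + exists []. split; [simpl; lia|]. intros x Hx. elim H. now exists x.
Qed.

Lemma continuity_horner l : continuity (horner l).
Proof.
  induction l as [|a l IH].
  - now apply continuity_const.
  - apply (continuity_plus (fun _ => a) (fun x => x * horner l x)).
    + now apply continuity_const.
    + apply continuity_mult; [apply derivable_continuous, derivable_id|exact IH].
Qed.

Lemma horner_IVT l x y : x < y -> horner l x < 0 -> 0 < horner l y ->
  exists z, x < z < y /\ horner l z = 0.
Proof.
  intros Hxy Hx Hy. destruct (IVT (horner l) x y (continuity_horner l) Hxy Hx Hy) as (z & Hz & E).
  exists z. split; auto.
  assert (x <> z) by (intros ->; lra). assert (z <> y) by (intros ->; lra). lra.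
Qed.

Lemma horner_opp l x : horner (map Ropp l) x = - horner l x.
Proof. induction l as [|a l IH]; simpl; [ring|]. rewrite IH. ring. Qed.

Lemma horner_IVT_decreasing l x y : x < y -> 0 < horner l x -> horner l y < 0 ->
  exists z, x < z < y /\ horner l z = 0.
Proof.
  intros Hxy Hx Hy. destruct (horner_IVT (map Ropp l) x y) as (z & Hz & E);
    rewrite ?horner_opp in *; try lra.
  exists z. split; auto. lra.
Qed.

Lemma cubic_root p q r : exists x, x^3 + p * x^2 + q * x + r = 0.
Proof.
  (* A Cauchy bound: [M ^ 3] dominates the lower terms at [M] and at [- M], so the cubic changes
     sign between them. *)
  set (M := 1 + Rabs p + Rabs q + Rabs r).
  pose proof (Rle_abs p). pose proof (Rle_abs q). pose proof (Rle_abs r).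
  pose proof (Rle_abs (- p)). pose proof (Rle_abs (- q)). pose proof (Rle_abs (- r)).
  rewrite Rabs_Ropp in *.
  set (P := Rabs p) in *. set (Q := Rabs q) in *. set (S := Rabs r) in *.
  assert (0 <= P /\ 0 <= Q /\ 0 <= S) as (HP & HQ & HS) by (unfold P, Q, S; auto using Rabs_pos).
  assert (HM : 1 <= M) by (unfold M; lra).
  assert (B1 : P * M ^ 2 + Q * M + S < M ^ 3).
  { replace (M ^ 3) with (M^2 + P * M^2 + Q * M^2 + S * M^2) by (unfold M at 3; unfold M; ring).
    assert (Q * M <= Q * M^2) by (apply Rmult_le_compat_l; nra).
    assert (S * 1 <= S * M^2) by (apply Rmult_le_compat_l; nra). nra. }
  assert (pM : - (P * M^2) <= p * M^2 <= P * M^2) by (split; nra).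
  assert (qM : - (Q * M) <= q * M <= Q * M) by (split; nra).
  destruct (horner_IVT [r; q; p; 1] (- M) M) as (z & _ & Hz).
  - lra.
  - simpl. nra.
  - simpl. nra.
  - exists z. rewrite <- Hz. simpl. ring.
Qed.

(** * Semicubical parabola, deltoid and its hyperbolic analogue *)

Definition semicubical : plane -> Prop := fun q => exists t : R, q = (t^2, t^3).

Lemma parabola_smooth v : smooth_at (fun p => fst p = snd p ^ 2) (v ^ 2, v).
Proof.
  split; [reflexivity|].
  exists (fun _ => True), (fun _ => True).
  exists (fun p => (snd p - v, fst p - snd p ^ 2)), (fun q => (snd q + (fst q + v) ^ 2, fst q + v)).
  split; [|split; [|split]]; auto.
  - split; [|split; [|split; [|split; [|split]]]]; auto using open_plane.
    + apply (smooth_on_intro _ (fun x y => y - v) (fun x y => x - y ^ 2)); smooth.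
    + apply (smooth_on_intro _ (fun x y => y + (x + v) ^ 2) (fun x y => x + v)); smooth.
    + intros [a b] _. simpl. split; auto. f_equal; ring.
    + intros [a b] _. simpl. split; auto. f_equal; ring.
  - simpl. f_equal; ring.
  - intros [a b] _. simpl. split; intros; lra.
Qed.

(** With [s] the sign of [t], the curve is the graph [y = s x sqrt x] on the quadrant [0 < x],
    [0 < s y]; subtracting this function of [x] from [y] straightens it. *)
Lemma semicubical_smooth t : t <> 0 -> smooth_at semicubical (t ^ 2, t ^ 3).
Proof.
  intros Ht. split; [now exists t|].
  set (s := if Rlt_dec 0 t then 1 else -1).
  assert (Hs : s * s = 1) by (unfold s; destruct (Rlt_dec 0 t); ring).
  assert (Hst : 0 < s * t) by (unfold s; destruct (Rlt_dec 0 t); nra).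
  set (U := fun p : plane => 0 < 1 * fst p + 0 * snd p + 0).
  set (V := fun p : plane => 0 < 1 * fst p + 0 * snd p + t ^ 2).
  set (W := fun p : plane => 0 < 0 * fst p + s * snd p + 0).
  assert (E : s * (t ^ 2 * sqrt (t ^ 2)) = t ^ 3).
  { replace (sqrt (t ^ 2)) with (s * t).
    - replace (s * (t ^ 2 * (s * t))) with (s * s * t ^ 3) by ring. rewrite Hs. ring.
    - rewrite <- (sqrt_square (s * t)) by lra. f_equal.
      replace (s * t * (s * t)) with (s * s * t ^ 2) by ring. rewrite Hs. ring. }
  apply (locally_diffeomorphic_intro U V W
    (fun p => (fst p - t ^ 2, snd p - s * (fst p * sqrt (fst p))))
    (fun q => (fst q + t ^ 2, snd q + s * ((fst q + t ^ 2) * sqrt (fst q + t ^ 2))))).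
  - split; [|split; [|split; [|split; [|split]]]]; try apply open_affine_gt.
    + apply (smooth_on_intro U (fun x y => x - t ^ 2) (fun x y => y - s * (x * sqrt x)));
        unfold U; smooth. simpl. intros; lra.
    + apply (smooth_on_intro V (fun x y => x + t ^ 2)
         (fun x y => y + s * ((x + t ^ 2) * sqrt (x + t ^ 2)))); unfold V; smooth.
      simpl. intros; lra.
    + unfold U, V. intros [x y] H; simpl in *. split; [lra|].
      replace (x - t * (t * 1) + t * (t * 1)) with x by ring. f_equal; ring.
    + unfold U, V. intros [x y] H; simpl in *. split; [lra|]. f_equal; ring.
  - apply open_affine_gt.
  - unfold U. simpl. nra.
  - unfold W. cbn [fst snd]. replace (0 * t ^ 2 + s * t ^ 3 + 0) with (s * t * (t * t)) by ring.
    apply Rmult_lt_0_compat; nra.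
  - cbn [fst snd]. f_equal; lra.
  - intros [x y] HU HW. unfold U, W in *. cbn [fst snd] in *. split.
    + intros (r & e). apply pair_equal_spec in e. destruct e as [-> ->].
      assert (0 < s * r) by nra.
      assert (Er : sqrt (r ^ 2) = s * r).
      { rewrite <- (sqrt_square (s * r)) by lra. f_equal.
        replace (s * r * (s * r)) with (s * s * r ^ 2) by ring. rewrite Hs. ring. }
      rewrite Er. replace (s * (r ^ 2 * (s * r))) with (s * s * r ^ 3) by ring. rewrite Hs. ring.
    + intros e. exists (s * sqrt x).
      assert (Hx : sqrt x * sqrt x = x) by (apply sqrt_sqrt; lra).
      f_equal.
      * replace ((s * sqrt x) ^ 2) with ((s * s) * (sqrt x * sqrt x)) by ring.
        rewrite Hs, Hx. ring.
      * replace ((s * sqrt x) ^ 3) with ((s * s) * s * (sqrt x * sqrt x) * sqrt x) by ring.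
        rewrite Hs, Hx. lra.
Qed.

Lemma semicubical_cusp : cusp_at semicubical (0, 0).
Proof.
  split; [exists 0; f_equal; ring|].
  exists (fun _ => True), (fun _ => True), (fun p => p), (fun p => p).
  split; [|split; [|split]]; auto; [|intros; reflexivity].
  assert (K : smooth_on (fun _ => True) (fun p : plane => p)).
  { intros n x y H. split; [now apply (smooth2_fst (fun _ => True))|now apply (smooth2_snd (fun _ => True))]. }
  split; [|split; [|split; [|split; [|split]]]]; auto using open_plane.
Qed.

Lemma semicubical_chart S U V phi psi : diffeomorphism U V phi psi ->
  (forall r, U r -> (S r <-> semicubical (phi r))) -> forall p, U p -> S p ->
  (phi p = (0, 0) -> cusp_at S p) /\ (phi p <> (0, 0) -> smooth_at S p).
Proof.
  intros HD E p Up Sp.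
  assert (L : locally_diffeomorphic S p semicubical (phi p))
    by (exists U, V, phi, psi; auto).
  pose proof (proj1 (E p Up) Sp) as (t & Ht). split; intros H; (split; [exact Sp|]).
  - apply locally_diffeomorphic_trans with (1 := L). rewrite H. apply semicubical_cusp.
  - apply locally_diffeomorphic_trans with (1 := L). rewrite Ht. apply semicubical_smooth.
    intros ->. apply H. rewrite Ht. f_equal; ring.
Qed.

(** For [x = 3 + 6 e w + 2 w ^ 2] and [e ^ 2 = 1] one has [(3 + 2 e w) ^ 2 = 3 + 2 x], which gives
    [w] back. With [C = 1 + e w], the conditions [-1 < x] in the domain and [0 < C] in the codomain
    correspond. *)
Definition chart_dom : plane -> Prop := fun p => 0 < 1 * fst p + 0 * snd p + 1.
Definition chart_cod (e : R) : plane -> Prop := fun p => 0 < e * fst p + 0 * snd p + 1.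
Definition chart (e : R) : plane -> plane := fun p =>
  (e * (/ 2 * (sqrt (3 + 2 * fst p) - 3)),
   snd p * / (2 * sqrt (2 + / 2 * (sqrt (3 + 2 * fst p) - 3)))).
Definition chart_inv (e : R) : plane -> plane := fun q =>
  (3 + 6 * e * fst q + 2 * fst q ^ 2, 2 * snd q * sqrt (2 + e * fst q)).

Lemma chart_diffeomorphism e : e * e = 1 ->
  diffeomorphism chart_dom (chart_cod e) (chart e) (chart_inv e).
Proof.
  intros He.
  assert (K : forall x, 0 < 1 * x + 1 -> 1 < sqrt (3 + 2 * x)).
  { intros x Hx. rewrite <- sqrt_1 at 1. apply sqrt_lt_1; lra. }
  split; [|split; [|split; [|split; [|split]]]]; try apply open_affine_gt.
  - apply (smooth_on_intro chart_dom (fun x y => e * (/ 2 * (sqrt (3 + 2 * x) - 3)))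
      (fun x y => y * / (2 * sqrt (2 + / 2 * (sqrt (3 + 2 * x) - 3)))));
      unfold chart_dom; smooth; cbn [fst snd]; intros x y H;
      try apply Rmult_lt_0_compat; try apply sqrt_lt_R0; try lra;
      specialize (K x); lra.
  - apply (smooth_on_intro (chart_cod e) (fun x y => 3 + 6 * e * x + 2 * x ^ 2)
      (fun x y => 2 * y * sqrt (2 + e * x))); unfold chart_cod; smooth; cbn [fst snd];
      intros; lra.
  - unfold chart_dom, chart_cod, chart, chart_inv. intros [x y] H. cbn [fst snd] in *.
    set (r := sqrt (3 + 2 * x)).
    assert (1 < r) by (apply K; lra).
    assert (Hr : r * r = 3 + 2 * x) by (apply sqrt_sqrt; lra).
    replace (e * (e * (/ 2 * (r - 3)))) with (e * e * (/ 2 * (r - 3))) by ring.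
    rewrite He. split; [lra|]. f_equal.
    + replace (3 + 6 * e * (e * (/ 2 * (r - 3))) + 2 * (e * (/ 2 * (r - 3))) ^ 2)
        with (3 + 6 * (e * e) * (/ 2 * (r - 3)) + 2 * (e * e) * (/2 * (r - 3))^2) by ring.
      rewrite He. nra.
    + replace (1 * (/ 2 * (r - 3))) with (/ 2 * (r - 3)) by ring.
      field. apply Rgt_not_eq, sqrt_lt_R0. lra.
  - unfold chart_dom, chart_cod, chart, chart_inv. intros [w v] H. cbn [fst snd] in *.
    assert (E : sqrt (3 + 2 * (3 + 6 * e * w + 2 * w ^ 2)) = 3 + 2 * (e * w)).
    { rewrite <- (sqrt_square (3 + 2 * (e * w))) by lra. f_equal.
      replace ((3 + 2 * (e * w)) * (3 + 2 * (e * w))) with (9 + 12 * e * w + 4 * (e * e) * w ^ 2) by ring.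
      rewrite He. ring. }
    rewrite E. split.
    + replace (1 * (3 + 6 * e * w + 2 * w ^ 2) + 0 * (2 * v * sqrt (2 + e * w)) + 1)
        with (2 * ((e * w + 1) * (e * w + 2)) + 2 * (1 - e * e) * w ^ 2) by ring.
      rewrite He. nra.
    + f_equal.
      * replace (e * (/ 2 * (3 + 2 * (e * w) - 3))) with (e * e * w) by field. rewrite He. ring.
      * replace (2 + / 2 * (3 + 2 * (e * w) - 3)) with (2 + e * w) by field.
        field. apply Rgt_not_eq, sqrt_lt_R0. lra.
Qed.

(* [e = -1] gives an arc of the deltoid around a cusp, [e = 1] its hyperbolic analogue. *)
Definition cuspidal_arc (e : R) : plane -> Prop := fun p =>
  exists C S, 0 < C /\ S ^ 2 = e * (C ^ 2 - 1) /\
    p = (2 * C ^ 2 + 2 * C - 1, 2 * S * (e * (C - 1))).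

Lemma chart_cuspidal_arc e p : e * e = 1 -> chart_dom p ->
  (cuspidal_arc e p <-> semicubical (chart e p)).
Proof.
  intros He Hp.
  destruct (chart_diffeomorphism e He) as (_ & _ & _ & _ & D & _).
  destruct (D p Hp) as [Hq Eq]. rewrite <- Eq at 1.
  destruct (chart e p) as [w v]. clear D p Hp Eq.
  unfold chart_cod in Hq. cbn [fst snd] in Hq. unfold chart_inv; cbn [fst snd].
  assert (P2 : 0 < sqrt (2 + e * w)) by (apply sqrt_lt_R0; lra).
  assert (Q2 : sqrt (2 + e * w) * sqrt (2 + e * w) = 2 + e * w) by (apply sqrt_sqrt; lra).
  set (r := sqrt (2 + e * w)) in *.
  split.
  - intros (C & S & HC & HS & E). apply pair_equal_spec in E. destruct E as [E1 E2].
    (* The abscissa is a quadratic in [C]; its other root [- (2 + e w)] is negative here, while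
       [0 < C]. *)
    assert (EC : C = 1 + e * w).
    { assert (F : (C - (1 + e * w)) * (C + (2 + e * w)) = 0).
      { replace ((C - (1 + e * w)) * (C + (2 + e * w))) with (C^2 + C - 2 - 3 * e * w - (e * e) * w ^ 2) by ring.
        rewrite He. lra. }
      apply Rmult_integral in F. lra. }
    rewrite EC in *.
    assert (ES : S ^ 2 = w * (2 + e * w)).
    { rewrite HS. replace (e * ((1 + e * w) ^ 2 - 1)) with (e * e * (w * (2 + e * w))) by ring. rewrite He. ring. }
    assert (E3 : v * r = S * w).
    { replace (2 * S * (e * (1 + e * w - 1))) with (2 * ((e * e) * S * w)) in E2 by ring.
      rewrite He in E2. lra. }
    assert (w0 : 0 <= w) by nra.
    (* Off the cusp the parameter of [v ^ 2 = w ^ 3] is [v / w]; at [w = 0] the point is the cusp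
       itself. *)
    destruct (Req_dec w 0) as [->|Hw].
    + exists 0. assert (v * r = 0) by lra. assert (v = 0) by nra. f_equal; simpl; lra.
    + assert (F : v * v = w * w * w).
      { apply Rmult_eq_reg_r with (r * r); [|nra].
        replace (v * v * (r * r)) with ((v * r) * (v * r)) by ring. rewrite E3, Q2.
        replace (S * w * (S * w)) with (S ^ 2 * w * w) by ring. rewrite ES. ring. }
      exists (v / w). f_equal.
      * replace ((v / w) ^ 2) with (v * v / (w * w)) by (field; lra). rewrite F. field; lra.
      * replace ((v / w) ^ 3) with (v * v * v / (w * w * w)) by (field; lra). rewrite F. field; lra.
  - intros (t & E). apply pair_equal_spec in E. destruct E as [E1 E2].
    exists (1 + e * w), (t * r). split; [lra|split].
    + replace ((t * r) ^ 2) with (t ^ 2 * (r * r)) by ring. rewrite Q2.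
      rewrite <- E1.
      replace (e * ((1 + e * w) ^ 2 - 1)) with (e * e * (w * (2 + e * w))) by ring. rewrite He. ring.
    + f_equal.
      * replace (2 * (1 + e * w) ^ 2 + 2 * (1 + e * w) - 1) with (3 + 6 * e * w + 2 * (e * e) * w ^ 2) by ring.
        rewrite He. ring.
      * replace (2 * (t * r) * (e * (1 + e * w - 1))) with (2 * (e * e) * (t * w) * r) by ring.
        rewrite He, E2, E1. ring.
Qed.

Lemma cuspidal_chart e S p : e * e = 1 ->
  (forall r, chart_dom r -> (S r <-> cuspidal_arc e r)) -> chart_dom p -> S p ->
  (p = (3, 0) -> cusp_at S p) /\ (p <> (3, 0) -> smooth_at S p).
Proof.
  intros He E Hp Sp.
  pose proof (chart_diffeomorphism e He) as D.
  destruct (semicubical_chart S _ _ _ _ D) with (p := p) as [H1 H2]; auto.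
  { intros r Hr. rewrite E by auto. now apply chart_cuspidal_arc. }
  assert (E3 : chart_inv e (0, 0) = (3, 0)) by (unfold chart_inv; simpl; f_equal; ring).
  destruct D as (_ & _ & _ & _ & D1 & D2).
  assert (E4 : chart e (3, 0) = (0, 0)).
  { rewrite <- E3. apply D2. unfold chart_cod; simpl; lra. }
  split; intros H.
  - apply H1. now rewrite H.
  - apply H2. intros H0. apply H. rewrite <- E3, <- H0. symmetry. now apply D1.
Qed.

(* The critical set of [E1] is the circle [C^2 + S^2 = 1] with [C = 4 x + 1], [S = 4 y]. *)
Definition deltoid : plane -> Prop := fun p =>
  exists C S, C ^ 2 + S ^ 2 = 1 /\ p = (2 * C ^ 2 + 2 * C - 1, 2 * S * (1 - C)).

(** A rotation through a third of a turn as soon as [s * s = 3 / 4]. Leaving the sign of [s] open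
    covers both directions. *)
Definition rot (s : R) : plane -> plane := affine (- / 2) (- s) s (- / 2) 0 0.

Lemma rot_invertible s : s * s = 3 / 4 -> invertible_affine_map (rot s).
Proof. intros H. apply invertible_affine. nra. Qed.

Lemma rotK s p : s * s = 3 / 4 -> rot (- s) (rot s p) = p.
Proof.
  intros H. destruct p as [x y]. unfold rot, affine; simpl. f_equal.
  - replace (- / 2 * (- / 2 * x + - s * y + 0) + - - s * (s * x + - / 2 * y + 0) + 0)
      with (/ 4 * x + s * s * x) by field. rewrite H. field.
  - replace (- s * (- / 2 * x + - s * y + 0) + - / 2 * (s * x + - / 2 * y + 0) + 0)
      with (/ 4 * y + s * s * y) by field. rewrite H. field.
Qed.

(** With [z = C + i S] on the unit circle, the point is [2 z + (conj z) ^ 2]. Multiplying [z] by a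
    cube root of unity [o] multiplies the point by [o] as well, because [(conj o) ^ 2 = o]. *)
Lemma deltoid_rot s p : s * s = 3 / 4 -> deltoid p -> deltoid (rot s p).
Proof.
  intros H (C & S & E & ->). exists (- / 2 * C - s * S), (s * C - / 2 * S). split.
  - replace ((- / 2 * C - s * S) ^ 2 + (s * C - / 2 * S) ^ 2)
      with ((/ 4 + s * s) * (C ^ 2 + S ^ 2)) by field. rewrite H, E. field.
  - unfold rot, affine; simpl.
    assert (ES : S * S = 1 - C * C) by lra.
    f_equal.
    + transitivity (2 * (/ 4 * (C * C) + s * C * S + s * s * (S * S)) - C - 2 * s * S - 1); [|field].
      rewrite H, ES. field.
    + transitivity (2 * (s * C - / 2 * S) + s * (C * C) - / 2 * S * C + 2 * (s * s) * (C * S) - s * (S * S)); [|field].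
      rewrite H, ES. field.
Qed.

Lemma deltoid_rot_image s : s * s = 3 / 4 -> image (rot s) deltoid = deltoid.
Proof.
  intros H. apply seteq_eq. intros p. split.
  - intros (q & Hq & <-). now apply deltoid_rot.
  - intros Hp. exists (rot (- s) p). split; [apply deltoid_rot; [lra|auto]|].
    rewrite <- (Ropp_involutive s) at 1. apply rotK. lra.
Qed.

(** In the chart domain [0 < C (C + 1)], and on the circle [-1 <= C]; together they give [0 < C]. *)
Lemma deltoid_chart r : chart_dom r -> (deltoid r <-> cuspidal_arc (-1) r).
Proof.
  unfold chart_dom. intros Hr. split.
  - intros (C & S & E & ->). simpl in Hr. exists C, S.
    pose proof (pow2_ge_0 S).
    assert (-1 <= C).
    { apply Rnot_lt_le. intros H1. assert (0 < (-1 - C) * (1 - C)) by (apply Rmult_lt_0_compat; lra). lra. }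
    assert (0 < C * (C + 1)) by lra.
    split; [destruct (Rlt_dec 0 C); nra|split; [lra|]]. f_equal; ring.
  - intros (C & S & HC & E & ->). exists C, S. split; [lra|]. f_equal; ring.
Qed.

Lemma deltoid_smooth_except_cusps s : s * s = 3 / 4 ->
  smooth_except_cusps deltoid [(3, 0); rot s (3, 0); rot (- s) (3, 0)].
Proof.
  intros Hs. assert (Hs' : - s * - s = 3 / 4) by lra.
  assert (He : -1 * -1 = 1) by ring.
  assert (C0 : cusp_at deltoid (3, 0)).
  { apply (proj1 (cuspidal_chart (-1) deltoid (3, 0) He deltoid_chart
      ltac:(unfold chart_dom; simpl; lra)
      ltac:(exists 1, 0; split; [ring|f_equal; ring]))). reflexivity. }
  split; [|split].
  - assert (s <> 0) by (intros ->; lra).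
    repeat constructor; simpl; unfold rot, affine; simpl;
      intuition; repeat match goal with H : (_, _) = (_, _) |- _ => injection H; clear H; intros end; lra.
  - simpl. intros p [<-|[<-|[<-|[]]]]; auto.
    + rewrite <- (deltoid_rot_image s) by auto. apply cusp_at_affine; auto using rot_invertible.
    + rewrite <- (deltoid_rot_image (- s)) by auto. apply cusp_at_affine; auto using rot_invertible.
  - intros p Hp Hn.
    assert (K : forall q, deltoid q -> chart_dom q -> q <> (3, 0) -> smooth_at deltoid q).
    { intros q H1 H2 H3. exact (proj2 (cuspidal_chart (-1) deltoid q He deltoid_chart H2 H1) H3). }
    pose proof Hp as (C & S & E & Ep).
    assert (Hx : forall C S, C ^ 2 + S ^ 2 = 1 -> 0 < C -> chart_dom (2 * C ^ 2 + 2 * C - 1, 2 * S * (1 - C))).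
    { intros C' S' _ H. unfold chart_dom; simpl. nra. }
    (* [- / 2 * C - s * S] is the circle abscissa of the rotated point, so its positivity puts that
       point in the chart. *)
    assert (R1 : forall s, s * s = 3 / 4 -> 0 < - / 2 * C - s * S -> chart_dom (rot s p)).
    { intros s' H' Hpos. unfold chart_dom, rot, affine; rewrite Ep; cbn [fst snd].
      assert (S * S = 1 - C * C) by lra.
      replace (1 * (- / 2 * (2 * C ^ 2 + 2 * C - 1) + - s' * (2 * S * (1 - C)) + 0))
        with (2 * (- / 2 * C - s' * S) ^ 2 + 2 * (- / 2 * C - s' * S) - 1
              - 3/2 * (C ^ 2 - 1) - 2 * (s' * s') * (S * S)) by field.
      rewrite H', H. nra. }
    (* The three circle abscissae add up to zero: one is positive unless all vanish, and then
       [C = S = 0], off the circle. *)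
    assert (cases : 0 < C \/ 0 < - / 2 * C - s * S \/ 0 < - / 2 * C - - s * S).
    { destruct (Rlt_dec 0 C); [now left|]. destruct (Rlt_dec 0 (- / 2 * C - s * S)); [now right; left|].
      right; right. apply Rnot_le_lt. intros ?.
      assert (C = 0) as -> by lra. assert (s * S = 0) by lra.
      assert (S = 0) as -> by (destruct (Rmult_integral _ _ H0); [subst; lra|auto]). lra. }
    assert (R2 : forall s, s * s = 3 / 4 -> chart_dom (rot s p) -> p <> rot (- s) (3, 0) -> smooth_at deltoid p).
    { intros s' H' Hd Hne. assert (H'' : - s' * - s' = 3 / 4) by lra.
      rewrite <- (rotK s' p) by auto. rewrite <- (deltoid_rot_image (- s')) by auto.
      apply smooth_at_affine; auto using rot_invertible.
      apply K; auto using deltoid_rot. intros e. apply Hne. now rewrite <- e, rotK. }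
    simpl in Hn. destruct cases as [H|[H|H]].
    + apply K; auto. rewrite Ep. auto.
    + refine (R2 s Hs _ _); [now apply R1|]. intros e. apply Hn. rewrite e. auto.
    + refine (R2 (- s) Hs' _ _); [now apply R1|]. rewrite Ropp_involutive.
      intros e. apply Hn. rewrite e. auto.
Qed.

(** Closed under differentiation. Sine and cosine parametrize the deltoid, exponentials the branches
    of the hyperbola. *)
Inductive elementary : (R -> R) -> Prop :=
  | el_const c : elementary (fun _ => c)
  | el_id : elementary (fun t => t)
  | el_cos : elementary cos
  | el_sin : elementary sin
  | el_exp c : elementary (fun t => exp (c * t))
  | el_plus f g : elementary f -> elementary g -> elementary (fun t => f t + g t)
  | el_mult f g : elementary f -> elementary g -> elementary (fun t => f t * g t).

Lemma elementary_smooth f : elementary f -> forall n t, ex_derive_n f n t.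
Proof.
  revert f. apply smooth_path_tower.
  induction 1 as [c| | | |c|f g Hf (f' & Ef & Df) Hg (g' & Eg & Dg)
                 |f g Hf (f' & Ef & Df) Hg (g' & Eg & Dg)].
  - exists (fun _ => 0). split; [apply el_const|]. intros t. auto_derive; auto.
  - exists (fun _ => 1). split; [apply el_const|]. intros t. auto_derive; auto.
  - exists (fun t => -1 * sin t). split; [apply (el_mult (fun _ => -1)); constructor|].
    intros t. auto_derive; auto. ring.
  - exists cos. split; [constructor|]. intros t. auto_derive; auto. ring.
  - exists (fun t => c * exp (c * t)). split; [apply (el_mult (fun _ => c)); constructor|].
    intros t. auto_derive; auto. ring.
  - exists (fun t => f' t + g' t). split; [now constructor|]. intros t.
    apply (is_derive_plus f g); auto.
  - exists (fun t => f' t * g t + f t * g' t).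
    split; [constructor; now constructor|]. intros t.
    apply (is_derive_mult f g); auto. intros; apply Rmult_comm.
Qed.

Lemma elementary_path f g : elementary f -> elementary g -> smooth_path (fun t => (f t, g t)).
Proof. intros Hf Hg n t. split; simpl; now apply elementary_smooth. Qed.

Lemma circle_angle C S : C ^ 2 + S ^ 2 = 1 -> exists t, C = cos t /\ S = sin t.
Proof.
  intros E. assert (B : -1 <= C <= 1) by nra.
  destruct (Rle_dec 0 S).
  - exists (acos C). rewrite cos_acos, sin_acos by auto. split; auto.
    rewrite <- (sqrt_square S) by auto. f_equal. unfold Rsqr. lra.
  - exists (- acos C). rewrite cos_neg, sin_neg, cos_acos, sin_acos by auto. split; auto.
    rewrite <- (Ropp_involutive S). f_equal. rewrite <- (sqrt_square (- S)) by lra.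
    f_equal. unfold Rsqr. lra.
Qed.

Lemma deltoid_closed_curve : closed_curve deltoid.
Proof.
  exists (fun t => (2 * (cos t * cos t) + (2 * cos t + -1), 2 * (sin t * (1 + -1 * cos t)))), (2 * PI).
  split; [|split; [|split]].
  - apply elementary_path.
    + apply (el_plus (fun t => 2 * (cos t * cos t)) (fun t => 2 * cos t + -1)).
      * apply (el_mult (fun _ => 2)); [constructor|]. apply (el_mult cos); constructor.
      * apply (el_plus (fun t => 2 * cos t)); [|constructor].
        apply (el_mult (fun _ => 2)); constructor.
    + apply (el_mult (fun _ => 2)); [constructor|].
      apply (el_mult sin); [constructor|]. apply (el_plus (fun _ => 1)); [constructor|].
      apply (el_mult (fun _ => -1)); constructor.
  - pose proof PI_RGT_0. lra.
  - intros t. now rewrite cos_plus, sin_plus, cos_2PI, sin_2PI, !Rmult_0_r, !Rmult_1_r,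
      Rminus_0_r, Rplus_0_r.
  - intros p. split.
    + intros (C & S & E & ->). destruct (circle_angle C S E) as (t & -> & ->). exists t. f_equal; ring.
    + intros (t & <-). exists (cos t), (sin t). split.
      * rewrite <- (sin2_cos2 t). unfold Rsqr. ring.
      * f_equal; ring.
Qed.

Lemma deltoid_closed_curve_with_three_cusps : closed_curve_with_three_cusps deltoid.
Proof.
  split; [apply deltoid_closed_curve|].
  eexists _, _, _. apply (deltoid_smooth_except_cusps (sqrt (3 / 4))). apply sqrt_sqrt. lra.
Qed.

Lemma semicubical_curve : curve semicubical.
Proof.
  exists (fun t => (t * t, t * (t * t))). split.
  - apply elementary_path; repeat first [apply el_id | apply (el_mult (fun t => t))].
  - intros p. split; intros (t & H); exists t; [rewrite H|rewrite <- H]; f_equal; ring.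
Qed.

Lemma semicubical_single_cusp : curve_with_single_cusp semicubical.
Proof.
  split; [apply semicubical_curve|]. exists (0, 0). split; [|split].
  - repeat constructor. auto.
  - intros p [<-|[]]. apply semicubical_cusp.
  - intros p (t & ->) H. apply semicubical_smooth. intros ->. apply H. left. f_equal; ring.
Qed.

(* The two curves traced by [(2C^2 + 2C - 1, 2S(C - 1))] as [(C, S)] runs through
   the branches [C >= 1] and [C <= -1] of [C^2 - S^2 = 1]. *)
Definition cuspidal_branch : plane -> Prop := fun p =>
  exists C S, 1 <= C /\ C ^ 2 - S ^ 2 = 1 /\ p = (2 * C ^ 2 + 2 * C - 1, 2 * S * (C - 1)).
Definition regular_branch : plane -> Prop := fun p =>
  exists C S, C <= -1 /\ C ^ 2 - S ^ 2 = 1 /\ p = (2 * C ^ 2 + 2 * C - 1, 2 * S * (C - 1)).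

(** Equal abscissae force [D = -1 - C]. The squares of the half ordinates then differ by
    [(2 C + 1) ^ 3], which is positive for [1 <= C]. *)
Lemma branches_disjoint p : ~ (cuspidal_branch p /\ regular_branch p).
Proof.
  intros [(C & S & HC & E & ->) (D & T & HD & F & G)].
  apply pair_equal_spec in G. destruct G as [G1 G2].
  assert (D = -1 - C) as ->.
  { assert ((C - D) * (C + D + 1) = 0) by lra.
    destruct (Rmult_integral _ _ H); lra. }
  assert (H : (S * (C - 1)) ^ 2 = (T * (C + 2)) ^ 2) by (replace (S * (C - 1)) with (T * (-1 - C - 1)) by lra; ring).
  replace ((S * (C - 1)) ^ 2) with (S ^ 2 * (C - 1) ^ 2) in H by ring.
  replace ((T * (C + 2)) ^ 2) with (T ^ 2 * (C + 2) ^ 2) in H by ring.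
  replace (S ^ 2) with (C ^ 2 - 1) in H by lra.
  replace (T ^ 2) with ((-1 - C) ^ 2 - 1) in H by lra.
  assert (0 < (2 * C + 1) ^ 3) by (apply pow_lt; lra).
  assert (((-1 - C) ^ 2 - 1) * (C + 2) ^ 2 - (C ^ 2 - 1) * (C - 1) ^ 2 = (2 * C + 1) ^ 3) by ring.
  lra.
Qed.

(** Hyperbolic cosine and sine at [t = ln (C + S)], since [C - S] is the inverse of [C + S]. The
    exponents [1 * t] and [-1 * t] match the shape of [el_exp]. *)
Lemma hyperbola_parameter C S : 1 <= C -> C ^ 2 - S ^ 2 = 1 ->
  exists t, C = / 2 * (exp (1 * t) + exp (-1 * t)) /\ S = / 2 * (exp (1 * t) + -1 * exp (-1 * t)).
Proof.
  intros HC E.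
  assert (E' : (C + S) * (C - S) = 1) by lra.
  assert (0 < C + S) by nra.
  exists (ln (C + S)).
  replace (-1 * ln (C + S)) with (- ln (C + S)) by ring. rewrite exp_Ropp, Rmult_1_l, exp_ln by auto.
  replace (/ (C + S)) with (C - S) by (apply Rmult_eq_reg_l with (C + S); [rewrite E', Rinv_r; lra|lra]).
  split; field.
Qed.

Lemma hyperbola_parameterK t :
  let C := / 2 * (exp (1 * t) + exp (-1 * t)) in
  let S := / 2 * (exp (1 * t) + -1 * exp (-1 * t)) in 1 <= C /\ C ^ 2 - S ^ 2 = 1.
Proof.
  intros C S. unfold C, S.
  assert (H : exp (1 * t) * exp (-1 * t) = 1).
  { rewrite <- exp_plus. replace (1 * t + -1 * t) with 0 by ring. apply exp_0. }
  pose proof (exp_pos (1 * t)). pose proof (exp_pos (-1 * t)).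
  set (a := exp (1 * t)) in *. set (b := exp (-1 * t)) in *. split.
  - pose proof (pow2_ge_0 (a - b)). nra.
  - replace ((/ 2 * (a + b)) ^ 2 - (/ 2 * (a + -1 * b)) ^ 2) with (a * b) by field. auto.
Qed.

Lemma elementary_branch k (s : R) :
  let C := fun t => s * (/ 2 * (exp (1 * t) + exp (-1 * t))) in
  let S := fun t => / 2 * (exp (1 * t) + -1 * exp (-1 * t)) in
  smooth_path (fun t => (2 * (C t * C t) + (2 * C t + k), 2 * (S t * (C t + k)))).
Proof.
  intros C S.
  assert (HC : elementary C).
  { apply (el_mult (fun _ => s)); [constructor|]. apply (el_mult (fun _ => / 2)); [constructor|].
    apply (el_plus (fun t => exp (1 * t))); constructor. }
  assert (HS : elementary S).
  { apply (el_mult (fun _ => / 2)); [constructor|].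
    apply (el_plus (fun t => exp (1 * t))); [constructor|]. apply (el_mult (fun _ => -1)); constructor. }
  apply elementary_path.
  - apply (el_plus (fun t => 2 * (C t * C t)) (fun t => 2 * C t + k)).
    + apply (el_mult (fun _ => 2)); [constructor|]. now apply el_mult.
    + apply (el_plus (fun t => 2 * C t)); [|constructor]. apply (el_mult (fun _ => 2)); [constructor|auto].
  - apply (el_mult (fun _ => 2)); [constructor|].
    apply (el_mult S); [auto|]. apply (el_plus C); [auto|constructor].
Qed.

Lemma cuspidal_branch_curve_with_single_cusp : curve_with_single_cusp cuspidal_branch.
Proof.
  assert (He : 1 * 1 = 1) by ring.
  assert (HD : forall r, chart_dom r -> (cuspidal_branch r <-> cuspidal_arc 1 r)).
  { intros r _. split; intros (C & S & HC & E & ->); exists C, S.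
    - split; [lra|split; [lra|f_equal; ring]].
    - split; [pose proof (pow2_ge_0 S); nra|split; [lra|f_equal; ring]]. }
  assert (Hd : forall r, cuspidal_branch r -> chart_dom r).
  { intros r (C & S & HC & E & ->). unfold chart_dom. cbn [fst snd]. nra. }
  split.
  - eexists. split; [apply (elementary_branch (-1) 1)|]. intros p. split.
    + intros (C & S & HC & E & ->). destruct (hyperbola_parameter C S HC E) as (t & -> & ->).
      exists t. f_equal; field.
    + intros (t & <-). destruct (hyperbola_parameterK t). eexists _, _.
      split; [eassumption|split; [eassumption|]]. f_equal; field.
  - exists (3, 0).
    assert (C0 : cuspidal_branch (3, 0)).
    { exists 1, 0. split; [lra|split; [ring|f_equal; ring]]. }
    split; [|split].
    + repeat constructor. auto.
    + intros p [<-|[]]. apply (cuspidal_chart 1 _ _ He HD (Hd _ C0) C0). reflexivity.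
    + intros p Hp Hn. apply (cuspidal_chart 1 _ _ He HD (Hd _ Hp) Hp).
      intros ->. apply Hn. now left.
Qed.

(* With [m = -1 - C] and [v = -S / sqrt (2 + m)] the branch becomes the parabola [m = v^2]. *)
Definition regular_dom : plane -> Prop := fun p => 0 < 1 * fst p + 0 * snd p + 3 / 2.
Definition regular_cod : plane -> Prop := fun p => 0 < 1 * fst p + 0 * snd p + / 2.
Definition regular_chart : plane -> plane := fun p =>
  let m := / 2 * (sqrt (3 + 2 * fst p) - 1) in (m, snd p * / (2 * ((2 + m) * sqrt (2 + m)))).
Definition regular_chart_inv : plane -> plane := fun q =>
  let m := fst q in (2 * m * (m + 1) - 1, 2 * snd q * ((2 + m) * sqrt (2 + m))).

Lemma regular_chart_diffeomorphism :
  diffeomorphism regular_dom regular_cod regular_chart regular_chart_inv.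
Proof.
  unfold regular_dom, regular_cod, regular_chart, regular_chart_inv. cbv zeta.
  split; [|split; [|split; [|split; [|split]]]]; try apply open_affine_gt.
  - apply (smooth_on_intro _ (fun x y => / 2 * (sqrt (3 + 2 * x) - 1))
      (fun x y => y * / (2 * ((2 + / 2 * (sqrt (3 + 2 * x) - 1)) * sqrt (2 + / 2 * (sqrt (3 + 2 * x) - 1))))));
      smooth; cbn [fst snd]; intros x y H; pose proof (sqrt_pos (3 + 2 * x));
      repeat apply Rmult_lt_0_compat; try apply sqrt_lt_R0; lra.
  - apply (smooth_on_intro _ (fun x y => 2 * x * (x + 1) - 1)
      (fun x y => 2 * y * ((2 + x) * sqrt (2 + x)))); smooth; cbn [fst snd]; intros; lra.
  - intros [x y] H. cbn [fst snd] in *.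
    assert (0 < sqrt (3 + 2 * x)) by (apply sqrt_lt_R0; lra).
    assert (sqrt (3 + 2 * x) * sqrt (3 + 2 * x) = 3 + 2 * x) by (apply sqrt_sqrt; lra).
    set (r := sqrt (3 + 2 * x)) in *. split; [lra|]. f_equal; [lra|].
    field. split; [apply Rgt_not_eq, sqrt_lt_R0; lra|lra].
  - intros [m v] H. cbn [fst snd] in *.
    assert (E : sqrt (3 + 2 * (2 * m * (m + 1) - 1)) = 1 + 2 * m).
    { rewrite <- (sqrt_square (1 + 2 * m)) by lra. f_equal. ring. }
    rewrite E. split; [nra|].
    replace (/ 2 * (1 + 2 * m - 1)) with m by field. f_equal.
    field. split; [apply Rgt_not_eq, sqrt_lt_R0; lra|lra].
Qed.

Lemma regular_chart_branch p : regular_dom p ->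
  (regular_branch p <-> fst (regular_chart p) = snd (regular_chart p) ^ 2).
Proof.
  intros Hp. destruct regular_chart_diffeomorphism as (_ & _ & _ & _ & D & _).
  destruct (D p Hp) as [Hq E]. rewrite <- E at 1. clear D E Hp.
  destruct (regular_chart p) as [m v].
  unfold regular_cod, regular_chart_inv in *. cbn [fst snd] in *.
  assert (P2 : 0 < sqrt (2 + m)) by (apply sqrt_lt_R0; lra).
  assert (Q2 : sqrt (2 + m) * sqrt (2 + m) = 2 + m) by (apply sqrt_sqrt; lra).
  set (r := sqrt (2 + m)) in *. split.
  - intros (C & S & HC & E & F). apply pair_equal_spec in F. destruct F as [F1 F2].
    (* The second root [C = m] is impossible: [C <= -1], whereas [- / 2 < m]. *)
    assert (C = -1 - m) as ->.
    { assert (F : (C + 1 + m) * (C - m) = 0) by lra. apply Rmult_integral in F. lra. }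
    assert (F3 : v * r = - S) by (apply Rmult_eq_reg_r with (2 + m); lra).
    apply Rmult_eq_reg_r with (r * r); [|nra].
    replace (v ^ 2 * (r * r)) with ((v * r) ^ 2) by ring. rewrite F3, Q2.
    replace ((- S) ^ 2) with (S ^ 2) by ring. lra.
  - intros E. exists (-1 - m), (- (v * r)).
    split; [nra|split].
    + replace ((- (v * r)) ^ 2) with (v ^ 2 * (r * r)) by ring. rewrite Q2, <- E. ring.
    + f_equal; ring.
Qed.

Lemma regular_branch_smooth_curve : smooth_curve regular_branch.
Proof.
  split.
  - eexists. split; [apply (elementary_branch (-1) (-1))|]. intros p. split.
    + intros (C & S & HC & E & ->). destruct (hyperbola_parameter (- C) S) as (t & H & ->); [lra|lra|].
      exists t. rewrite <- H. f_equal; ring.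
    + intros (t & <-). destruct (hyperbola_parameterK t).
      exists (-1 * (/ 2 * (exp (1 * t) + exp (-1 * t)))), (/ 2 * (exp (1 * t) + -1 * exp (-1 * t))).
      split; [lra|split; [lra|]]. f_equal; ring.
  - split; [constructor|split; [intros p []|]]. intros p Hp _.
    assert (Up : regular_dom p).
    { destruct Hp as (C & S & HC & E & ->). unfold regular_dom. cbn [fst snd]. nra. }
    split; [exact Hp|].
    apply locally_diffeomorphic_trans with (fun p => fst p = snd p ^ 2) (regular_chart p).
    + exists regular_dom, regular_cod, regular_chart, regular_chart_inv.
      auto using regular_chart_diffeomorphism, regular_chart_branch.
    + rewrite (surjective_pairing (regular_chart p)).
      rewrite (proj1 (regular_chart_branch p Up) Hp). apply parabola_smooth.
Qed.

(** * Jacobians *)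

Lemma jacobian_unique f x y fx fy gx gy :
  is_derive (fun t => fst (f (t, y))) x fx -> is_derive (fun t => fst (f (x, t))) y fy ->
  is_derive (fun t => snd (f (t, y))) x gx -> is_derive (fun t => snd (f (x, t))) y gy ->
  jacobian f x y = fx * gy - fy * gx.
Proof.
  intros H1 H2 H3 H4. unfold jacobian.
  f_equal; f_equal; now apply is_derive_unique.
Qed.

Definition quad a20 a11 a02 a10 a01 a00 b20 b11 b02 b10 b01 b00 : plane -> plane := fun p =>
  let (x, y) := p in
  (a20 * x^2 + a11 * x * y + a02 * y^2 + a10 * x + a01 * y + a00,
   b20 * x^2 + b11 * x * y + b02 * y^2 + b10 * x + b01 * y + b00).

Lemma nf_map_quad c : exists a20 a11 a02 a10 a01 a00 b20 b11 b02 b10 b01 b00,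
  nf_map c = quad a20 a11 a02 a10 a01 a00 b20 b11 b02 b10 b01 b00.
Proof.
  destruct c;
  [ exists 1, 0, (-1), 1, 0, 0, 0, 1, 0, 0, 0, 0
  | exists 1, 0, (-1), 0, 0, 0, 0, 1, 0, 0, 0, 0
  | exists 1, 0, 1, 1, 0, 0, 0, 1, 0, 0, 0, 0
  | exists 1, 0, 1, 1, 0, 0, 0, 1, 0, (/ 2), 0, 0
  | exists 1, 0, 1, 0, 0, 0, 0, 1, 0, 0, 0, 0
  | exists 1, 0, 0, 0, 1, 0, 0, 1, 0, 0, 0, 0
  | exists 1, 0, 0, 0, 0, 0, 0, 1, 0, 0, 1, 0
  | exists 1, 0, 0, 0, 0, 0, 0, 1, 0, 0, 0, 0
  | exists 1, 0, (-1), 0, 0, 0, 0, 0, 0, 0, 1, 0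
  | exists 1, 0, (-1), 0, 0, 0, 0, 0, 0, 1, 1, 0
  | exists 1, 0, (-1), 0, 0, 0, 0, 0, 0, 0, 0, 0
  | exists 1, 0, 1, 0, 0, 0, 0, 0, 0, 0, 1, 0
  | exists 1, 0, 1, 0, 0, 0, 0, 0, 0, 0, 0, 0
  | exists 1, 0, 0, 0, 1, 0, 0, 0, 0, 1, 0, 0
  | exists 1, 0, 0, 0, 0, 0, 0, 0, 0, 0, 1, 0
  | exists 1, 0, 0, 0, 1, 0, 0, 0, 0, 0, 0, 0
  | exists 1, 0, 0, 0, 0, 0, 0, 0, 0, 1, 0, 0
  | exists 1, 0, 0, 0, 0, 0, 0, 0, 0, 0, 0, 0 ];
  apply functional_extensionality; intros [x y]; simpl; f_equal; ring.
Qed.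

Lemma jacobian_quad a20 a11 a02 a10 a01 a00 b20 b11 b02 b10 b01 b00 x y :
  jacobian (quad a20 a11 a02 a10 a01 a00 b20 b11 b02 b10 b01 b00) x y =
  (2 * a20 * x + a11 * y + a10) * (b11 * x + 2 * b02 * y + b01) -
  (a11 * x + 2 * a02 * y + a01) * (2 * b20 * x + b11 * y + b10).
Proof.
  apply jacobian_unique; unfold quad; cbn [fst snd]; auto_derive; auto; ring.
Qed.

(** Chain rule, with [r] the product of the determinants of [h] and [k]. Taking [g] in [quad] form
    makes all the partial derivatives explicit. *)
Lemma jacobian_equivalent f g h k : (exists a20 a11 a02 a10 a01 a00 b20 b11 b02 b10 b01 b00,
    g = quad a20 a11 a02 a10 a01 a00 b20 b11 b02 b10 b01 b00) ->
  invertible_affine_map h -> invertible_affine_map k ->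
  (forall p, f p = k (g (h p))) ->
  exists r, r <> 0 /\ forall p, jacobian f (fst p) (snd p) = r * jacobian g (fst (h p)) (snd (h p)).
Proof.
  intros (a20 & a11 & a02 & a10 & a01 & a00 & b20 & b11 & b02 & b10 & b01 & b00 & ->) Hh Hk E.
  destruct (invertible_affineE h Hh) as (a & b & c & d & u & v & D & ->).
  destruct (invertible_affineE k Hk) as (a' & b' & c' & d' & u' & v' & D' & ->).
  exists ((a * d - b * c) * (a' * d' - b' * c')). split; [now apply Rmult_integral_contrapositive|].
  intros [x y]. replace f with (fun p => affine a' b' c' d' u' v'
    (quad a20 a11 a02 a10 a01 a00 b20 b11 b02 b10 b01 b00 (affine a b c d u v p)))
    by (apply functional_extensionality; auto).
  rewrite jacobian_quad. unfold affine. cbn [fst snd].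
  set (X := a * x + b * y + u). set (Y := c * x + d * y + v).
  set (Ax := 2 * a20 * X + a11 * Y + a10). set (Ay := a11 * X + 2 * a02 * Y + a01).
  set (Bx := 2 * b20 * X + b11 * Y + b10). set (By := b11 * X + 2 * b02 * Y + b01).
  rewrite (jacobian_unique _ x y
    (a' * (Ax * a + Ay * c) + b' * (Bx * a + By * c)) (a' * (Ax * b + Ay * d) + b' * (Bx * b + By * d))
    (c' * (Ax * a + Ay * c) + d' * (Bx * a + By * c)) (c' * (Ax * b + Ay * d) + d' * (Bx * b + By * d)));
  [ring| | | |];
  unfold quad; cbn [fst snd]; auto_derive; auto; unfold Ax, Ay, Bx, By, X, Y; ring.
Qed.

(* [Reals] exports another [E1], hence the qualified name. *)
Definition nf_jacobian (c : normal_form) (x y : R) : R :=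
  match c with
  | Defs.E1 => (2 * x + 1) * x + 2 * y * y
  | E2 => 2 * (x * x + y * y)
  | H1 => (2 * x + 1) * x - 2 * y * y
  | H2 => (x - y) * (2 * x + 2 * y + 1)
  | H3 => 2 * ((x - y) * (x + y))
  | P1 => 2 * x * x - y
  | P2 => 2 * x * (x + 1)
  | P3 => 2 * x ^ 2
  | DE1 => 2 * x
  | DE2 => 2 * (x + y)
  | DE3 => 0
  | DH1 => 2 * x
  | DH2 => 0
  | DP1 => -1
  | DP2 => 2 * x
  | DP3 => 0
  | DP4 => 0
  | DP5 => 0
  end.

Lemma jacobian_nf c x y : jacobian (nf_map c) x y = nf_jacobian c x y.
Proof.
  unfold jacobian. destruct c; simpl;
  repeat match goal with |- context [Derive ?f ?a] =>
    erewrite (is_derive_unique f a) by (auto_derive; [exact I|reflexivity]) end; try field; try ring.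
Qed.

(** * Critical sets and critical images of the normal forms *)

Lemma J0_nf c : J0 (nf_map c) = fun p => nf_jacobian c (fst p) (snd p) = 0.
Proof. apply seteq_eq. intros p. unfold J0. now rewrite jacobian_nf. Qed.

Lemma image_affine a b c d u v S : a * d - b * c <> 0 ->
  image (affine a b c d u v) S = fun p => S (affine_inv a b c d u v p).
Proof. intros D. apply image_inverse; intros p; [now apply affine_invK|now apply affineK]. Qed.

Lemma pair_eq (a b c d : R) : a = c -> b = d -> (a, b) = (c, d).
Proof. congruence. Qed.

Lemma H1_branches : hyperbola_with_branches (J0 (nf_map H1))
  (fun p => nf_jacobian H1 (fst p) (snd p) = 0 /\ 4 * fst p + 1 < 0)
  (fun p => nf_jacobian H1 (fst p) (snd p) = 0 /\ 0 < 4 * fst p + 1).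
Proof.
  (* The inverse coordinates are [u = -4 x - 4 y - 1] and [v = -4 x + 4 y - 1]. In them the Jacobian
     is [(u v - 1) / 8], and [4 x + 1 = - (u + v) / 2] tells the branches apart. *)
  exists (affine (-1/8) (-1/8) (-1/8) (1/8) (-1/4) 0).
  rewrite !image_affine by lra. rewrite J0_nf. split; [apply invertible_affine; lra|].
  assert (Eu : forall x y, fst (affine_inv (-1/8) (-1/8) (-1/8) (1/8) (-1/4) 0 (x, y)) = -4 * x - 4 * y - 1)
    by (intros; unfold affine_inv, affine; simpl; field).
  assert (Ev : forall x y, snd (affine_inv (-1/8) (-1/8) (-1/8) (1/8) (-1/4) 0 (x, y)) = -4 * x + 4 * y - 1)
    by (intros; unfold affine_inv, affine; simpl; field).
  split; [|split]; intros [x y]; rewrite Eu, Ev; simpl; set (u := -4 * x - 4 * y - 1); set (v := -4 * x + 4 * y - 1);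
    replace ((2 * x + 1) * x - 2 * y * y) with ((u * v - 1) / 8) by (unfold u, v; field);
    try replace (4 * x + 1) with (- (u + v) / 2) by (unfold u, v; field).
  - split; intros; lra.
  - split; (intros [H1 H2]; split; [lra|nra]).
  - split; (intros [H1 H2]; split; [lra|nra]).
Qed.

Lemma J0_nf_description c : J0_is (nf_map c) (nf_J0 c).
Proof.
  destruct c; simpl; rewrite ?J0_nf; cbn [nf_jacobian].
  - exists (affine (/ 4) 0 0 (/ 4) (- / 4) 0). split; [apply invertible_affine; lra|].
    rewrite image_affine by lra. intros [x y]. unfold affine_inv, affine. cbn [fst snd].
    replace (/ 4 / (/ 4 * / 4 - 0 * 0) * x + - 0 / (/ 4 * / 4 - 0 * 0) * y + (0 * 0 - / 4 * - / 4) / (/ 4 * / 4 - 0 * 0))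
      with (4 * x + 1) by field.
    replace (- 0 / (/ 4 * / 4 - 0 * 0) * x + / 4 / (/ 4 * / 4 - 0 * 0) * y + (0 * - / 4 - / 4 * 0) / (/ 4 * / 4 - 0 * 0))
      with (4 * y) by field.
    split; intros; lra.
  - exists (0, 0). intros [x y]. unfold singleton. simpl. split.
    + intros H. apply pair_eq; nra.
    + intros H. apply pair_equal_spec in H. destruct H as [-> ->]. ring.
  - pose proof H1_branches as H. rewrite J0_nf in H. eexists _, _. exact H.
  - exists (line 1 (-1) 0), (line 2 2 1). split.
    + split; [|split; [|split]].
      * exists 1, (-1), 0. split; [lra|]. intros p; tauto.
      * exists 2, 2, 1. split; [lra|]. intros p; tauto.
      * intros H. specialize (H (0, 0)). unfold line in H. simpl in H. lra.
      * exists (- / 4, - / 4). unfold line; simpl. lra.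
    + intros [x y]. unfold union, line. simpl. split.
      * intros H. apply Rmult_integral in H. lra.
      * intros [H|H]; [replace (x - y) with 0 by lra|replace (2 * x + 2 * y + 1) with 0 by lra]; ring.
  - exists (line 1 (-1) 0), (line 1 1 0). split.
    + split; [|split; [|split]].
      * exists 1, (-1), 0. split; [lra|]. intros p; tauto.
      * exists 1, 1, 0. split; [lra|]. intros p; tauto.
      * intros H. specialize (H (1, 1)). unfold line in H. simpl in H. lra.
      * exists (0, 0). unfold line; simpl. lra.
    + intros [x y]. unfold union, line. simpl. split.
      * intros H. apply Rmult_integral in H. destruct H as [H|H]; [lra|]. apply Rmult_integral in H. lra.
      * intros [H|H]; [replace (x - y) with 0 by lra|replace (x + y) with 0 by lra]; ring.
  - exists (0, 0), (affine 1 0 0 2 0 0). split; [apply invertible_affine; lra|split].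
    + unfold affine; simpl. apply pair_eq; ring.
    + intros [x y]. simpl. split.
      * intros H. exists (x, x ^ 2). simpl. split; [auto|]. unfold affine; simpl. apply pair_eq; lra.
      * intros ([u v] & H & E). simpl in H. unfold affine in E. simpl in E.
        apply pair_equal_spec in E. destruct E as [<- <-]. rewrite H. ring.
  - exists (line 1 0 0), (line 1 0 1). split.
    + exists 1, 0, 0, 1. split; [lra|split; [lra|]]. split; intros p; tauto.
    + intros [x y]. unfold union, line. simpl. split.
      * intros H. apply Rmult_integral in H. lra.
      * intros [H|H]; [replace x with 0 by lra|replace (x + 1) with 0 by lra]; ring.
  - exists 2, 1, 0, 0. split; [lra|split; [lra|]]. intros x y. rewrite jacobian_nf. simpl. ring.
  - exists 2, 0, 0. split; [lra|]. intros x y. rewrite jacobian_nf. simpl. ring.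
  - exists 2, 2, 0. split; [lra|]. intros x y. rewrite jacobian_nf. simpl. ring.
  - reflexivity.
  - exists 2, 0, 0. split; [lra|]. intros x y. rewrite jacobian_nf. simpl. ring.
  - reflexivity.
  - intros p. lra.
  - exists 2, 0, 0. split; [lra|]. intros x y. rewrite jacobian_nf. simpl. ring.
  - reflexivity.
  - reflexivity.
  - reflexivity.
Qed.

Lemma J1_nf c q : J1 (nf_map c) q <-> exists x y, nf_jacobian c x y = 0 /\ nf_map c (x, y) = q.
Proof.
  unfold J1. rewrite J0_nf. split.
  - intros ([x y] & H & E). now exists x, y.
  - intros (x & y & H & E). now exists (x, y).
Qed.

Lemma J1_E1 : J1 (nf_map Defs.E1) = image (affine (/ 16) 0 0 (- / 32) (- 3 / 16) 0) deltoid.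
Proof.
  apply seteq_eq. intros q. rewrite J1_nf. unfold affine. simpl. split.
  - intros (x & y & H & <-). exists (2 * (4 * x + 1) ^ 2 + 2 * (4 * x + 1) - 1, 2 * (4 * y) * (1 - (4 * x + 1))). split.
    + exists (4 * x + 1), (4 * y). split; [lra|reflexivity].
    + apply pair_eq; cbn [fst snd]; [|field]. assert (y * y = - (2 * x + 1) * x / 2) by lra. simpl. lra.
  - intros (p & (C & S & E & ->) & <-). exists ((C - 1) / 4), (S / 4).
    assert (F : S * S = 1 - C * C) by lra. split; [lra|].
    apply pair_eq; cbn [fst snd]; [|field]. simpl. lra.
Qed.

Lemma J1_H1_regular : image (nf_map H1) (fun p => nf_jacobian H1 (fst p) (snd p) = 0 /\ 4 * fst p + 1 < 0)
  = image (affine (/ 16) 0 0 (/ 32) (- 3 / 16) 0) regular_branch.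
Proof.
  apply seteq_eq. intros q. unfold affine. split.
  - intros ([x y] & [H H'] & <-). simpl in H, H'.
    exists (2 * (4 * x + 1) ^ 2 + 2 * (4 * x + 1) - 1, 2 * (4 * y) * ((4 * x + 1) - 1)). split.
    + exists (4 * x + 1), (4 * y). split; [nra|split; [lra|reflexivity]].
    + apply pair_eq; cbn [fst snd]; [|field]. assert (y * y = (2 * x + 1) * x / 2) by lra. simpl. lra.
  - intros (p & (C & S & HC & E & ->) & <-). exists ((C - 1) / 4, S / 4).
    assert (F : S * S = C * C - 1) by lra. simpl. split; [lra|].
    apply pair_eq; cbn [fst snd]; [|field]. simpl. lra.
Qed.

Lemma J1_H1_cuspidal : image (nf_map H1) (fun p => nf_jacobian H1 (fst p) (snd p) = 0 /\ 0 < 4 * fst p + 1)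
  = image (affine (/ 16) 0 0 (/ 32) (- 3 / 16) 0) cuspidal_branch.
Proof.
  apply seteq_eq. intros q. unfold affine. split.
  - intros ([x y] & [H H'] & <-). simpl in H, H'.
    exists (2 * (4 * x + 1) ^ 2 + 2 * (4 * x + 1) - 1, 2 * (4 * y) * ((4 * x + 1) - 1)). split.
    + exists (4 * x + 1), (4 * y). split; [nra|split; [lra|reflexivity]].
    + apply pair_eq; cbn [fst snd]; [|field]. assert (y * y = (2 * x + 1) * x / 2) by lra. simpl. lra.
  - intros (p & (C & S & HC & E & ->) & <-). exists ((C - 1) / 4, S / 4).
    assert (F : S * S = C * C - 1) by lra. simpl. split; [lra|].
    apply pair_eq; cbn [fst snd]; [|field]. simpl. lra.
Qed.

Lemma curve_with_single_cusp_affine m S : invertible_affine_map m ->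
  curve_with_single_cusp S -> curve_with_single_cusp (image m S).
Proof.
  intros Hm [HC (p & Hp)]. split; [now apply curve_affine|].
  exists (m p). apply (smooth_except_cusps_affine m S [p]); auto.
Qed.

Lemma smooth_curve_affine m S : invertible_affine_map m -> smooth_curve S -> smooth_curve (image m S).
Proof.
  intros Hm [HC Hp]. split; [now apply curve_affine|].
  apply (smooth_except_cusps_affine m S []); auto.
Qed.

Lemma closed_curve_with_three_cusps_affine m S : invertible_affine_map m ->
  closed_curve_with_three_cusps S -> closed_curve_with_three_cusps (image m S).
Proof.
  intros Hm [HC (p1 & p2 & p3 & Hp)]. split; [now apply closed_curve_affine|].
  exists (m p1), (m p2), (m p3). apply (smooth_except_cusps_affine m S [p1; p2; p3]); auto.
Qed.

Lemma parabola_intro a b c d u v S : a * d - b * c <> 0 ->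
  (forall q, S q <-> exists t, q = (a * t + b * t ^ 2 + u, c * t + d * t ^ 2 + v)) ->
  parabola_with_vertex (u, v) S.
Proof.
  intros D E. exists (affine a b c d u v). split; [now apply invertible_affine|split].
  - unfold affine; simpl. apply pair_eq; ring.
  - intros q. rewrite E. split.
    + intros (t & ->). exists (t, t ^ 2). split; [reflexivity|]. reflexivity.
    + intros ([s t] & H & <-). simpl in H. subst t. exists s. reflexivity.
Qed.

Ltac J1_simp := intros [X Y]; rewrite J1_nf; unfold singleton, line, union; simpl.

Lemma J1_nf_description c : J1_is (nf_map c) (nf_J1 c).
Proof.
  destruct c; cbn [J1_is nf_J1].
  - rewrite J1_E1. apply closed_curve_with_three_cusps_affine; [apply invertible_affine; lra|].
    apply deltoid_closed_curve_with_three_cusps.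
  - exists (0, 0). J1_simp. split.
    + intros (x & y & H & E). assert (x = 0) as -> by nra. assert (y = 0) as -> by nra.
      rewrite <- E. apply pair_eq; ring.
    + intros ->. exists 0, 0. split; [ring|apply pair_eq; ring].
  - exists (fun p => nf_jacobian H1 (fst p) (snd p) = 0 /\ 4 * fst p + 1 < 0),
           (fun p => nf_jacobian H1 (fst p) (snd p) = 0 /\ 0 < 4 * fst p + 1).
    assert (Hm : invertible_affine_map (affine (/ 16) 0 0 (/ 32) (- 3 / 16) 0)) by (apply invertible_affine; lra).
    split; [apply H1_branches|split; [|split; [|split]]].
    + rewrite <- image_union. unfold J1. replace (J0 (nf_map H1)) with
       (union (fun p => nf_jacobian H1 (fst p) (snd p) = 0 /\ 4 * fst p + 1 < 0)
           (fun p => nf_jacobian H1 (fst p) (snd p) = 0 /\ 0 < 4 * fst p + 1)); [intros p; tauto|].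
      rewrite J0_nf. apply seteq_eq. intros [x y]. unfold union. simpl.
      (* On the separating line [4 x + 1 = 0] the Jacobian is [- / 8 - 2 y ^ 2], hence never
         zero. *)
      split; [tauto|]. intros H. destruct (Rtotal_order (4 * x + 1) 0) as [?|[?|?]]; [tauto| |tauto].
      assert (x = - / 4) by lra. subst x. exfalso. nra.
    + intros p. rewrite J1_H1_regular, J1_H1_cuspidal.
      intros [(q & Hq & <-) (r & Hr & E)].
      destruct (invertible_affine_inverse _ Hm) as (g & _ & G & _).
      assert (r = q) as -> by (now rewrite <- (G r), E, G).
      now apply (branches_disjoint q).
    + rewrite J1_H1_regular. apply smooth_curve_affine; auto using regular_branch_smooth_curve.
    + rewrite J1_H1_cuspidal. apply curve_with_single_cusp_affine;
        auto using cuspidal_branch_curve_with_single_cusp.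
  (* The critical lines meet at [(- / 4, - / 4)], whose image is [(- / 8, - / 16)]. The line [x = y]
     is folded about that point onto the ray; the line [x + y = - / 2] traces the parabola with
     parameter [x + / 4]. *)
  - exists (fun q => exists t, q = (1 * t + 2 * t ^ 2 + - / 8, / 2 * t + -1 * t ^ 2 + - / 16)),
      (fun q => exists t, 0 <= t /\ q = (- / 8 + t * 1, - / 16 + t * / 2)), (- / 8, - / 16).
    split; [|split].
    + apply (parabola_intro 1 2 (/ 2) (-1)); [lra|]. intros q; tauto.
    + exists 1, (/ 2). split; [lra|]. intros q; tauto.
    + J1_simp. split.
      * intros (x & y & H & E). apply Rmult_integral in H. destruct H as [H|H].
        -- right. assert (x = y) by lra. subst y. exists (2 * (x + / 4) ^ 2).
           split; [pose proof (pow2_ge_0 (x + / 4)); lra|]. rewrite <- E. apply pair_eq; field.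
        -- left. exists (x + / 4). assert (y = - x - / 2) by lra. subst y.
           rewrite <- E. apply pair_eq; field.
      * intros [(t & E)|(t & Ht & E)]; rewrite E.
        -- exists (t - / 4), (- (t - / 4) - / 2). split; [field|apply pair_eq; field].
        -- assert (F : sqrt (t / 2) * sqrt (t / 2) = t / 2) by (apply sqrt_sqrt; lra).
           exists (sqrt (t / 2) - / 4), (sqrt (t / 2) - / 4). split; [ring|].
           apply pair_eq; lra.
  - exists (0, 0), (fun q => exists t, 0 <= t /\ q = (fst (0,0) + t * 2, snd (0, 0) + t * 1)),
      (fun q => exists t, 0 <= t /\ q = (fst (0,0) + t * 2, snd (0, 0) + t * -1)).
    split; [|split; [|split]].
    + exists 2, 1. split; [lra|]. intros q; tauto.
    + exists 2, (-1). split; [lra|]. intros q; tauto.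
    + intros H. destruct (proj1 (H (2, 1))) as (t & Ht & E).
      * exists 1. simpl. split; [lra|]. apply pair_eq; ring.
      * simpl in E. apply pair_equal_spec in E. lra.
    + J1_simp. split.
      * intros (x & y & H & E).
        assert (H' : (x - y) * (x + y) = 0) by lra. apply Rmult_integral in H'. destruct H' as [H'|H'].
        -- left. assert (y = x) by lra. subst y. exists (x * x). split; [nra|]. rewrite <- E. apply pair_eq; ring.
        -- right. assert (y = - x) by lra. subst y. exists (x * x). split; [nra|]. rewrite <- E. apply pair_eq; ring.
      * intros [(t & Ht & E)|(t & Ht & E)]; rewrite E;
          assert (F : sqrt t * sqrt t = t) by (now apply sqrt_sqrt).
        -- exists (sqrt t), (sqrt t). split; [ring|apply pair_eq; lra].
        -- exists (sqrt t), (- sqrt t). split; [ring|apply pair_eq; lra].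
  - replace (J1 (nf_map P1)) with (image (affine 3 0 0 2 0 0) semicubical).
    { apply curve_with_single_cusp_affine; [apply invertible_affine; lra|apply semicubical_single_cusp]. }
    apply seteq_eq. intros q. rewrite J1_nf. unfold affine; simpl. split.
    + intros (p & (t & ->) & <-). exists t, (2 * t * t). cbn [fst snd]. split; [ring|apply pair_eq; ring].
    + intros (x & y & H & <-). exists (x ^ 2, x ^ 3). split; [now exists x|].
      assert (y = 2 * x * x) as -> by lra. cbn [fst snd]. apply pair_eq; ring.
  - exists (line 1 0 0), (line 1 0 1), (1, 0). unfold line.
    assert (I1 : image (nf_map P2) (line 1 0 0) = line 1 0 0).
    { apply seteq_eq. intros [X Y]. unfold line. split.
      - intros ([x y] & H & E). simpl in *. apply pair_equal_spec in E. destruct E as [<- <-].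
        assert (x = 0) as -> by lra. ring.
      - simpl. intros H. exists (0, Y). simpl. split; [ring|]. apply pair_eq; lra. }
    assert (I2 : image (nf_map P2) (line 1 0 1) = singleton (1, 0)).
    { apply seteq_eq. intros [X Y]. unfold line, singleton. split.
      - intros ([x y] & H & E). simpl in *. rewrite <- E. assert (x = -1) as -> by lra. apply pair_eq; ring.
      - intros ->. exists (-1, 0). simpl. split; [ring|]. apply pair_eq; ring. }
    split; [|split; [|split; [|split; [|split]]]].
    + exists 1, 0, 0, 1. split; [lra|split; [lra|]]. split; intros p; unfold line; tauto.
    + rewrite J0_nf. intros [x y]. unfold union. simpl. split.
      * intros H. apply Rmult_integral in H. lra.
      * intros [H|H]; [replace x with 0 by lra|replace (x + 1) with 0 by lra]; ring.
    + fold (line 1 0 0). rewrite I1. exists 1, 0, 0. split; [lra|]. intros p; tauto.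
    + fold (line 1 0 1). rewrite I2. intros p; tauto.
    + fold (line 1 0 0). rewrite I1. unfold line; simpl. lra.
    + fold (line 1 0 0). rewrite <- I2, <- image_union. unfold J1.
      replace (J0 (nf_map P2)) with (union (line 1 0 0) (line 1 0 1)); [intros p; tauto|].
      apply seteq_eq. rewrite J0_nf. intros [x y]. unfold union, line. simpl. split.
      * intros [H|H]; [replace x with 0 by lra|replace (x + 1) with 0 by lra]; ring.
      * intros H. apply Rmult_integral in H. lra.
  - exists (0, 0). J1_simp. split.
    + intros (x & y & H & E). assert (x = 0) as -> by nra. rewrite <- E. apply pair_eq; ring.
    + intros ->. exists 0, 0. split; [ring|apply pair_eq; ring].
  - exists (0, 0). apply (parabola_intro 0 (-1) 1 0); [lra|]. J1_simp. split.
    + intros (x & y & H & E). assert (x = 0) as -> by lra. exists y. rewrite <- E. apply pair_eq; ring.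
    + intros (t & ->). exists 0, t. split; [ring|apply pair_eq; ring].
  - exists (0, 0). J1_simp. split.
    + intros (x & y & H & E). assert (y = - x) as -> by lra. rewrite <- E. apply pair_eq; ring.
    + intros ->. exists 0, 0. split; [ring|apply pair_eq; ring].
  - exists 0, 1, 0. split; [lra|]. J1_simp. split.
    + intros (x & y & H & E). apply pair_equal_spec in E. lra.
    + intros H. exists ((X + 1) / 2), ((X - 1) / 2). split; [ring|apply pair_eq; lra].
  - exists (0, 0). apply (parabola_intro 0 1 1 0); [lra|]. J1_simp. split.
    + intros (x & y & H & E). assert (x = 0) as -> by lra. exists y. rewrite <- E. apply pair_eq; ring.
    + intros (t & ->). exists 0, t. split; [ring|apply pair_eq; ring].
  - exists (0, 0), 1, 0. split; [lra|]. J1_simp. split.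
    + intros (x & y & _ & E). exists (x * x + y * y). split; [nra|]. rewrite <- E. apply pair_eq; ring.
    + intros (t & Ht & E). exists (sqrt t), 0. split; [ring|]. rewrite E.
      assert (sqrt t * sqrt t = t) by (now apply sqrt_sqrt). apply pair_eq; lra.
  - intros q. rewrite J1_nf. simpl. intros (x & y & H & _). lra.
  - exists 1, 0, 0. split; [lra|]. J1_simp. split.
    + intros (x & y & H & E). apply pair_equal_spec in E. assert (x = 0) by lra. subst x. lra.
    + intros H. exists 0, Y. split; [ring|apply pair_eq; lra].
  - exists 0, 1, 0. split; [lra|]. J1_simp. split.
    + intros (x & y & H & E). apply pair_equal_spec in E. lra.
    + intros H. exists 0, X. split; [ring|apply pair_eq; lra].
  - exists (0, 0). apply (parabola_intro 0 1 1 0); [lra|]. J1_simp. split.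
    + intros (x & y & _ & E). exists x. rewrite <- E. apply pair_eq; ring.
    + intros (t & ->). exists t, 0. split; [ring|apply pair_eq; ring].
  - exists (0, 0), 1, 0. split; [lra|]. J1_simp. split.
    + intros (x & y & _ & E). exists (x * x). split; [nra|]. rewrite <- E. apply pair_eq; ring.
    + intros (t & Ht & E). exists (sqrt t), 0. split; [ring|]. rewrite E.
      assert (sqrt t * sqrt t = t) by (now apply sqrt_sqrt). apply pair_eq; lra.
Qed.

(** * Fibres of the normal forms *)

Lemma has_cardinality_of_list (S : plane -> Prop) l n : length l = n -> NoDup l ->
  (forall x y, S (x, y) <-> In (x, y) l) -> has_cardinality S (Fin n).
Proof. intros <- N E. apply cardinality_list; auto. now intros [x y]. Qed.

Ltac distinct :=
  repeat constructor; simpl; intros ?;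
  repeat match goal with
    | H : _ \/ _ |- _ => destruct H
    | H : (_, _) = (_, _) |- _ => apply pair_equal_spec in H; destruct H
    end; try easy; try nra.

Ltac in_list_cases :=
  let M := fresh "M" in intros M; simpl in M;
  repeat match goal with
    | H : _ \/ _ |- _ => destruct H as [H|H]
    | H : False |- _ => destruct H
    | H : (_, _) = (_, _) |- _ => apply pair_equal_spec in H; destruct H; subst
    end.

Ltac card0 := apply (has_cardinality_of_list _ []); [reflexivity|constructor|];
  intros x y; unfold preimage; simpl; split; [|easy]; intros E;
  apply pair_equal_spec in E; destruct E.
Ltac card l := apply (has_cardinality_of_list _ l); [reflexivity|distinct|];
  intros x y; unfold preimage; simpl; split;
  [intros E; apply pair_equal_spec in E; destruct E as [E1 E2]|in_list_cases; apply pair_eq].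

Lemma square_root a : 0 <= a -> exists r, 0 <= r /\ a = r ^ 2.
Proof. intros H. exists (sqrt a). split; [apply sqrt_pos|]. rewrite <- (sqrt_sqrt a) at 1 by auto. ring. Qed.

Lemma square_root_pos a : 0 < a -> exists r, 0 < r /\ a = r ^ 2.
Proof.
  intros H. exists (sqrt a). split; [now apply sqrt_lt_R0|].
  rewrite <- (sqrt_sqrt a) at 1 by lra. ring.
Qed.

Lemma square_eq x r : x ^ 2 = r ^ 2 -> x = r \/ x = - r.
Proof.
  intros H. assert (F : (x - r) * (x + r) = 0) by lra.
  apply Rmult_integral in F. lra.
Qed.

(** Complex squaring: [a + 2 i b = (x + i y) ^ 2], so a fibre consists of two opposite square roots.
    They coincide over the origin only, because [(x ^ 2 + y ^ 2) ^ 2 = a ^ 2 + 4 b ^ 2]. *)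
Lemma E2_cards : preimage_cardinalities_are (nf_map E2) [Fin 1; Fin 2].
Proof.
  assert (H0 : has_cardinality (preimage (nf_map E2) (0, 0)) (Fin 1)).
  { card [(0, 0)].
    - assert (F : (x * x + y * y) * (x * x + y * y) = 0).
      { transitivity ((x * (x * 1) - y * (y * 1)) * (x * (x * 1) - y * (y * 1)) + 4 * (x * y) * (x * y)); [ring|].
        rewrite E1, E2. ring. }
      assert (x * x + y * y = 0) by (apply Rmult_integral in F; lra).
      left. apply pair_eq; nra.
    - ring.
    - ring. }
  assert (H2 : forall p, p <> (0, 0) -> has_cardinality (preimage (nf_map E2) p) (Fin 2)).
  { intros [a b] Hp.
    assert (K : exists u v, a = u ^ 2 - v ^ 2 /\ b = u * v).
    { destruct (square_root (a ^ 2 + 4 * b ^ 2)) as (r & Hr & E); [nra|].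
      assert (Rabs a <= r) by (apply Rsqr_incr_0_var; [rewrite <- Rsqr_abs; unfold Rsqr; nra|auto]).
      pose proof (Rle_abs a). pose proof (Rle_abs (- a)). rewrite Rabs_Ropp in *.
      destruct (square_root ((r + a) / 2)) as (u & Hu & Eu); [lra|].
      destruct (square_root ((r - a) / 2)) as (v & Hv & Ev); [lra|].
      assert (Eb : b ^ 2 = (u * v) ^ 2).
      { replace ((u * v) ^ 2) with (u ^ 2 * v ^ 2) by ring. rewrite <- Eu, <- Ev.
        replace ((r + a) / 2 * ((r - a) / 2)) with ((r ^ 2 - a ^ 2) / 4) by field. rewrite <- E. field. }
      apply square_eq in Eb. destruct Eb as [->| ->].
      - exists u, v. split; [lra|ring].
      - exists u, (- v). split; [lra|ring]. }
    destruct K as (u & v & -> & ->).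
    assert (Hn : u <> 0 \/ v <> 0).
    { apply NNPP. intros Hn. apply Hp. assert (u = 0) as -> by tauto. assert (v = 0) as -> by tauto.
      apply pair_eq; ring. }
    card [(u, v); (- u, - v)]; try ring.
    (* Eliminating [y], [x ^ 2] is a root of [T ^ 2 - (u ^ 2 - v ^ 2) T - (u v) ^ 2]. *)
    - assert (F : (x ^ 2 - u ^ 2) * (x ^ 2 + v ^ 2) = 0).
      { replace ((x ^ 2 - u ^ 2) * (x ^ 2 + v ^ 2)) with (x ^ 2 * (x ^ 2 - (u ^ 2 - v ^ 2)) - (u * v) ^ 2) by ring.
        change (u ^ 2) with (u * (u * 1)). change (v ^ 2) with (v * (v * 1)). rewrite <- E1, <- E2. ring. }
      assert (G : x = u /\ y = v \/ x = - u /\ y = - v).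
      { apply Rmult_integral in F. destruct F as [F|F].
        - assert (F' : x ^ 2 = u ^ 2) by lra. apply square_eq in F'.
          assert (Gy : y ^ 2 = v ^ 2) by lra. apply square_eq in Gy.
          destruct F' as [-> | ->], Gy as [-> | ->]; try tauto;
            assert (G : u * v = 0) by lra; apply Rmult_integral in G; destruct G as [->| ->]; lra.
        - assert (x = 0) as -> by nra. assert (v = 0) as -> by nra. assert (u = 0) as -> by nra. lra. }
      destruct G as [[-> ->]|[-> ->]]; auto. }
  apply preimage_cardinalities_intro.
  - intros p. destruct (classic (p = (0, 0))) as [->|Hp].
    + exists (Fin 1). split; [simpl; auto|auto].
    + exists (Fin 2). split; [simpl; auto|auto].
  - intros k [<-|[<-|[]]].
    + now exists (0, 0).
    + exists (1, 0). apply H2. intros E. apply pair_equal_spec in E. lra.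
Qed.

Lemma DP1_cards : preimage_cardinalities_are (nf_map DP1) [Fin 1].
Proof.
  assert (H : forall p, has_cardinality (preimage (nf_map DP1) p) (Fin 1)).
  { intros [a b]. card [(b, a - b ^ 2)].
    - left. subst. apply pair_eq; simpl; ring.
    - simpl; ring.
    - auto. }
  apply preimage_cardinalities_intro.
  - intros p. exists (Fin 1). split; [simpl; auto|auto].
  - intros k [<-|[]]. exists (0, 0). auto.
Qed.

(* [DE1], [DH1] and [DP2] share the fibre structure [x^2 = t, y = b]. *)
Lemma fold_cards f (t : R -> R -> R) :
  (forall a b x y, f (x, y) = (a, b) <-> x ^ 2 = t a b /\ y = b) ->
  (forall s, exists a b, t a b = s) ->
  preimage_cardinalities_are f [Fin 0; Fin 1; Fin 2].
Proof.
  intros E Ht.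
  assert (H0 : forall a b, t a b < 0 -> has_cardinality (preimage f (a, b)) (Fin 0)).
  { intros a b H. apply (has_cardinality_of_list _ []); [reflexivity|constructor|].
    intros x y. unfold preimage. rewrite E. simpl. split; [|easy]. intros [F _]. nra. }
  assert (H1 : forall a b, t a b = 0 -> has_cardinality (preimage f (a, b)) (Fin 1)).
  { intros a b H. apply (has_cardinality_of_list _ [(0, b)]); [reflexivity|distinct|].
    intros x y. unfold preimage. rewrite E, H. simpl. split.
    - intros [F ->]. left. apply pair_eq; nra.
    - in_list_cases. split; [ring|auto]. }
  assert (H2 : forall a b, 0 < t a b -> has_cardinality (preimage f (a, b)) (Fin 2)).
  { intros a b H. destruct (square_root_pos _ H) as (r & Hr & Er).
    apply (has_cardinality_of_list _ [(r, b); (- r, b)]); [reflexivity|distinct|].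
    intros x y. unfold preimage. rewrite E, Er. simpl. split.
    - intros [F ->]. assert (F' : x ^ 2 = r ^ 2) by (simpl; auto).
      apply square_eq in F'. destruct F' as [-> | ->]; auto.
    - in_list_cases; split; auto; ring. }
  apply preimage_cardinalities_intro.
  - intros [a b]. destruct (Rtotal_order (t a b) 0) as [H|[H|H]].
    + exists (Fin 0). split; [simpl; auto|auto].
    + exists (Fin 1). split; [simpl; auto|auto].
    + exists (Fin 2). split; [simpl; auto|auto].
  - intros k [<-|[<-|[<-|[]]]].
    + destruct (Ht (-1)) as (a & b & e). exists (a, b). apply H0. lra.
    + destruct (Ht 0) as (a & b & e). exists (a, b). apply H1. lra.
    + destruct (Ht 1) as (a & b & e). exists (a, b). apply H2. lra.
Qed.

Lemma DE1_cards : preimage_cardinalities_are (nf_map DE1) [Fin 0; Fin 1; Fin 2].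
Proof.
  apply (fold_cards _ (fun a b => a + b ^ 2)).
  - intros a b x y. simpl. rewrite pair_equal_spec. split; intros [H ->]; split; auto; lra.
  - intros s. exists s, 0. ring.
Qed.

Lemma DH1_cards : preimage_cardinalities_are (nf_map DH1) [Fin 0; Fin 1; Fin 2].
Proof.
  apply (fold_cards _ (fun a b => a - b ^ 2)).
  - intros a b x y. simpl. rewrite pair_equal_spec. split; intros [H ->]; split; auto; lra.
  - intros s. exists s, 0. ring.
Qed.

Lemma DP2_cards : preimage_cardinalities_are (nf_map DP2) [Fin 0; Fin 1; Fin 2].
Proof.
  apply (fold_cards _ (fun a b => a)).
  - intros a b x y. simpl. rewrite pair_equal_spec. split; intros [H ->]; split; auto; lra.
  - intros s. exists s, 0. ring.
Qed.

Lemma thin_cards f (P : plane -> Prop) (q : plane) :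
  (forall x y, P (f (x, y))) -> ~ P q ->
  (forall p, P p -> exists g : R -> plane, (forall t, f (g t) = p) /\ (forall t t', g t = g t' -> t = t')) ->
  preimage_cardinalities_are f [Fin 0; Inf].
Proof.
  intros Hf Hq Hg.
  assert (H0 : forall p, ~ P p -> has_cardinality (preimage f p) (Fin 0)).
  { intros p Hp. apply (has_cardinality_of_list _ []); [reflexivity|constructor|].
    intros x y. unfold preimage. simpl. split; [|easy]. intros E. apply Hp. rewrite <- E. apply Hf. }
  assert (H1 : forall p, P p -> has_cardinality (preimage f p) Inf).
  { intros p Hp. destruct (Hg p Hp) as (g & G1 & G2). now apply (cardinality_infinite _ g). }
  apply preimage_cardinalities_intro.
  - intros p. destruct (classic (P p)); [exists Inf|exists (Fin 0)]; (split; [simpl; auto|auto]).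
  - intros k [<-|[<-|[]]].
    + now exists q; apply H0.
    + exists (f (0, 0)). apply H1, Hf.
Qed.

Lemma DE3_cards : preimage_cardinalities_are (nf_map DE3) [Fin 0; Inf].
Proof.
  apply (thin_cards _ (fun p => snd p = 0) (0, 1)); [intros; simpl; auto|simpl; lra|].
  intros [a b] H. simpl in H. subst b.
  (* A branch of [x ^ 2 - y ^ 2 = a] is a graph over the whole [y] axis when [0 <= a] and over the
     whole [x] axis otherwise. *)
  destruct (Rle_dec 0 a).
  - exists (fun t => (sqrt (t * t + a), t)). split.
    + intros t. assert (sqrt (t * t + a) * sqrt (t * t + a) = t * t + a) by (apply sqrt_sqrt; nra).
      apply pair_eq; lra.
    + intros t t' E. apply pair_equal_spec in E. tauto.
  - exists (fun t => (t, sqrt (t * t - a))). split.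
    + intros t. assert (sqrt (t * t - a) * sqrt (t * t - a) = t * t - a) by (apply sqrt_sqrt; nra).
      apply pair_eq; lra.
    + intros t t' E. apply pair_equal_spec in E. tauto.
Qed.

Lemma DP3_cards : preimage_cardinalities_are (nf_map DP3) [Fin 0; Inf].
Proof.
  apply (thin_cards _ (fun p => snd p = 0) (0, 1)); [intros; simpl; auto|simpl; lra|].
  intros [a b] H. simpl in H. subst b. exists (fun t => (t, a - t ^ 2)). split.
  - intros t. apply pair_eq; simpl; ring.
  - intros t t' E. apply pair_equal_spec in E. tauto.
Qed.

Lemma DP4_cards : preimage_cardinalities_are (nf_map DP4) [Fin 0; Inf].
Proof.
  apply (thin_cards _ (fun p => fst p = snd p ^ 2) (1, 0)); [intros; simpl; auto|simpl; lra|].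
  intros [a b] H. simpl in H. subst a. exists (fun t => (b, t)). split.
  - auto.
  - intros t t' E. apply pair_equal_spec in E. tauto.
Qed.

Lemma DP5_cards : preimage_cardinalities_are (nf_map DP5) [Fin 0; Inf].
Proof.
  apply (thin_cards _ (fun p => 0 <= fst p /\ snd p = 0) (0, 1)); simpl; [|lra|].
  - intros x y. split; [nra|auto].
  - intros [a b] H. simpl in H. destruct H as [H ->].
    exists (fun t => (sqrt a, t)). split.
    + intros t. assert (sqrt a * sqrt a = a) by (now apply sqrt_sqrt). apply pair_eq; lra.
    + intros t t' E. apply pair_equal_spec in E. tauto.
Qed.

Lemma P3_cards : preimage_cardinalities_are (nf_map P3) [Fin 0; Fin 2; Inf].
Proof.
  assert (H0 : forall a b, a < 0 \/ a = 0 /\ b <> 0 -> has_cardinality (preimage (nf_map P3) (a, b)) (Fin 0)).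
  { intros a b H. card0. destruct H as [H|[-> H]]; [nra|]. apply H. assert (x = 0) as -> by nra. lra. }
  assert (H2 : forall a b, 0 < a -> has_cardinality (preimage (nf_map P3) (a, b)) (Fin 2)).
  { intros a b H. destruct (square_root_pos _ H) as (r & Hr & ->).
    card [(r, b / r); (- r, - b / r)].
    - assert (F : x ^ 2 = r ^ 2) by (simpl; auto). apply square_eq in F. destruct F as [-> | ->]; rewrite <- E2.
      + left. apply pair_eq; field; lra.
      + right; left. apply pair_eq; field; lra.
    - auto.
    - field; lra.
    - ring.
    - field; lra. }
  assert (Hi : has_cardinality (preimage (nf_map P3) (0, 0)) Inf).
  { apply (cardinality_infinite _ (fun t => (0, t))).
    - intros t. unfold preimage; simpl. apply pair_eq; ring.
    - intros t t' E. apply pair_equal_spec in E. tauto. }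
  apply preimage_cardinalities_intro.
  - intros [a b]. destruct (Rtotal_order a 0) as [H|[H|H]].
    + exists (Fin 0). split; [simpl; auto|auto].
    + destruct (Req_dec b 0) as [->|Hb]; [subst a; exists Inf|exists (Fin 0)]; (split; [simpl; auto|auto]).
    + exists (Fin 2). split; [simpl; auto|auto].
  - intros k [<-|[<-|[<-|[]]]].
    + exists (-1, 0). apply H0. lra.
    + exists (1, 0). apply H2. lra.
    + now exists (0, 0).
Qed.

Lemma P2_cards : preimage_cardinalities_are (nf_map P2) [Fin 0; Fin 1; Fin 2; Inf].
Proof.
  assert (H0 : forall a b, a < 0 -> has_cardinality (preimage (nf_map P2) (a, b)) (Fin 0)).
  { intros a b Ha. card0. nra. }
  assert (H1 : forall b, has_cardinality (preimage (nf_map P2) (0, b)) (Fin 1)).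
  { intros b. card [(0, b)].
    - left. assert (x = 0) as -> by nra. apply pair_eq; lra.
    - ring.
    - ring. }
  (* Over [a = 1] the root [x = -1] annihilates [x y + y], so only [x = 1] contributes when
     [b <> 0]; when [b = 0] it contributes a whole line. *)
  assert (H1' : forall b, b <> 0 -> has_cardinality (preimage (nf_map P2) (1, b)) (Fin 1)).
  { intros b Hb. card [(1, b / 2)].
    - assert (F : x ^ 2 = 1 ^ 2) by (simpl; lra). apply square_eq in F. destruct F as [-> | ->].
      + left. apply pair_eq; lra.
      + lra.
    - ring.
    - field. }
  assert (H2 : forall a b, 0 < a -> a <> 1 -> has_cardinality (preimage (nf_map P2) (a, b)) (Fin 2)).
  { intros a b Ha H. destruct (square_root_pos _ Ha) as (r & Hr & ->).
    assert (r <> 1) by (intros ->; apply H; ring).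
    card [(r, b / (r + 1)); (- r, b / (1 - r))].
    - assert (F : x ^ 2 = r ^ 2) by (simpl; auto). apply square_eq in F. destruct F as [-> | ->]; rewrite <- E2.
      + left. apply pair_eq; field; lra.
      + right; left. apply pair_eq; field; lra.
    - auto.
    - field; lra.
    - ring.
    - field; lra. }
  assert (Hi : has_cardinality (preimage (nf_map P2) (1, 0)) Inf).
  { apply (cardinality_infinite _ (fun t => (-1, t))).
    - intros t. unfold preimage; simpl. apply pair_eq; ring.
    - intros t t' E. apply pair_equal_spec in E. tauto. }
  apply preimage_cardinalities_intro.
  - intros [a b]. destruct (Rtotal_order a 0) as [H|[H|H]].
    + exists (Fin 0). split; [simpl; auto|auto].
    + subst a. exists (Fin 1). split; [simpl; auto|auto].
    + destruct (Req_dec a 1) as [->|Ha].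
      * destruct (Req_dec b 0) as [->|Hb]; [exists Inf|exists (Fin 1)]; (split; [simpl; auto|auto]).
      * exists (Fin 2). split; [simpl; auto|auto].
  - intros k [<-|[<-|[<-|[<-|[]]]]].
    + exists (-1, 0). apply H0. lra.
    + exists (0, 0). apply H1.
    + exists (4, 0). apply H2; lra.
    + now exists (1, 0).
Qed.

Lemma DE2_cards : preimage_cardinalities_are (nf_map DE2) [Fin 0; Fin 1; Inf].
Proof.
  assert (H0 : forall a, a <> 0 -> has_cardinality (preimage (nf_map DE2) (a, 0)) (Fin 0)).
  { intros a Ha. card0. assert (y = - x) as -> by lra. lra. }
  assert (H1 : forall a b, b <> 0 -> has_cardinality (preimage (nf_map DE2) (a, b)) (Fin 1)).
  { intros a b Hb. card [((b + a / b) / 2, (b - a / b) / 2)].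
    - left. subst. apply pair_eq; field; auto.
    - field; auto.
    - field; auto. }
  assert (Hi : has_cardinality (preimage (nf_map DE2) (0, 0)) Inf).
  { apply (cardinality_infinite _ (fun t => (t, - t))).
    - intros t. unfold preimage; simpl. apply pair_eq; ring.
    - intros t t' E. apply pair_equal_spec in E. tauto. }
  apply preimage_cardinalities_intro.
  - intros [a b]. destruct (Req_dec b 0) as [->|Hb].
    + destruct (Req_dec a 0) as [->|Ha]; [exists Inf|exists (Fin 0)]; (split; [simpl; auto|auto]).
    + exists (Fin 1). split; [simpl; auto|auto].
  - intros k [<-|[<-|[<-|[]]]].
    + exists (1, 0). apply H0. lra.
    + exists (0, 1). apply H1. lra.
    + now exists (0, 0).
Qed.

Lemma DH2_cards : preimage_cardinalities_are (nf_map DH2) [Fin 0; Fin 1; Inf].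
Proof.
  assert (H0 : forall a b, a < 0 \/ b <> 0 -> has_cardinality (preimage (nf_map DH2) (a, b)) (Fin 0)).
  { intros a b H. card0. destruct H; [nra|]. auto. }
  assert (H1 : has_cardinality (preimage (nf_map DH2) (0, 0)) (Fin 1)).
  { card [(0, 0)].
    - left. apply pair_eq; nra.
    - ring.
    - auto. }
  assert (Hi : forall a, 0 < a -> has_cardinality (preimage (nf_map DH2) (a, 0)) Inf).
  { intros a Ha. destruct (square_root_pos _ Ha) as (r & Hr & ->).
    (* rational parametrization of the circle of radius [r], made injective on [R] by [exp] *)
    apply (cardinality_infinite _ (fun t => (r * (1 / (1 + exp t ^ 2) * (1 - exp t ^ 2)), r * (2 * exp t / (1 + exp t ^ 2))))).
    - intros t. unfold preimage; cbn [nf_map]. pose proof (exp_pos t). apply pair_eq; auto. field. nra.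
    - intros t t' E. apply pair_equal_spec in E. destruct E as [E _].
      apply exp_inv. pose proof (exp_pos t). pose proof (exp_pos t').
      apply Rmult_eq_reg_l in E; [|lra].
      set (u := exp t) in *. set (v := exp t') in *.
      assert (F : u ^ 2 = v ^ 2).
      { assert (A1 : 1 / (1 + u ^ 2) * (1 - u ^ 2) = 2 / (1 + u ^ 2) - 1) by (field; nra).
        assert (A2 : 1 / (1 + v ^ 2) * (1 - v ^ 2) = 2 / (1 + v ^ 2) - 1) by (field; nra).
        rewrite A1, A2 in E.
        assert (G : / (1 + u ^ 2) = / (1 + v ^ 2)) by (unfold Rdiv in E; lra).
        apply Rinv_eq_reg in G. lra. }
      apply square_eq in F. lra. }
  apply preimage_cardinalities_intro.
  - intros [a b]. destruct (Req_dec b 0) as [->|Hb].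
    + destruct (Rtotal_order a 0) as [H|[->|H]]; [exists (Fin 0)|exists (Fin 1)|exists Inf]; (split; [simpl; auto|auto]).
    + exists (Fin 0). split; [simpl; auto|auto].
  - intros k [<-|[<-|[<-|[]]]].
    + exists (-1, 0). apply H0. lra.
    + now exists (0, 0).
    + exists (1, 0). apply Hi. lra.
Qed.

Ltac products_zero :=
  repeat match goal with
    | H : _ * _ = 0 |- _ => apply Rmult_integral in H; destruct H as [H|H]
    end.

Lemma pow2_sqrt_mult x : x ^ 2 = sqrt (x * x) ^ 2.
Proof. pose proof (sqrt_sqrt (x * x) (Rle_0_sqr x)). lra. Qed.

(** Since [a + 2 b = (x + y) ^ 2] and [a - 2 b = (x - y) ^ 2], a fibre amounts to independent
    choices of sign for [x + y] and [x - y]. *)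
Lemma H3_cards : preimage_cardinalities_are (nf_map H3) [Fin 0; Fin 1; Fin 2; Fin 4].
Proof.
  assert (H0 : forall a b, a + 2 * b < 0 \/ a - 2 * b < 0 -> has_cardinality (preimage (nf_map H3) (a, b)) (Fin 0)).
  { intros a b H. card0. pose proof (pow2_ge_0 (x + y)). pose proof (pow2_ge_0 (x - y)). lra. }
  assert (H1 : has_cardinality (preimage (nf_map H3) (0, 0)) (Fin 1)).
  { card [(0, 0)].
    - left. apply pair_eq; nra.
    - ring.
    - ring. }
  assert (Hsd : forall x y r q, (x + y) ^ 2 = r ^ 2 -> (x - y) ^ 2 = q ^ 2 ->
    (x, y) = ((r + q) / 2, (r - q) / 2) \/ (x, y) = ((r - q) / 2, (r + q) / 2) \/
    (x, y) = ((- r + q) / 2, (- r - q) / 2) \/ (x, y) = ((- r - q) / 2, (- r + q) / 2)).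
  { intros x y r q E1 E2. apply square_eq in E1. apply square_eq in E2.
    destruct E1, E2; [left|right; left|right; right; left|right; right; right]; apply pair_eq; lra. }
  assert (Hq : forall a b r q, a + 2 * b = r ^ 2 -> a - 2 * b = q ^ 2 ->
     forall x y, nf_map H3 (x, y) = (a, b) <-> (x + y) ^ 2 = r ^ 2 /\ (x - y) ^ 2 = q ^ 2).
  { intros a b r q Er Eq x y. simpl. rewrite pair_equal_spec. split; intros [? ?]; split; simpl in *; lra. }
  assert (H2 : forall a b, a + 2 * b = 0 /\ 0 < a - 2 * b \/ 0 < a + 2 * b /\ a - 2 * b = 0 ->
     has_cardinality (preimage (nf_map H3) (a, b)) (Fin 2)).
  { intros a b [[Ea Eb]|[Ea Eb]].
    - destruct (square_root_pos _ Eb) as (q & Hq0 & Eq).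
      apply (has_cardinality_of_list _ [(q / 2, - q / 2); (- q / 2, q / 2)]); [reflexivity|distinct|].
      intros x y. unfold preimage. rewrite (Hq a b 0 q) by (simpl; lra). split.
      + intros [F G]. destruct (Hsd _ _ _ _ F G) as [-> |[-> |[-> | ->]]]; simpl;
          [left|right; left|left|right; left]; apply pair_eq; field.
      + in_list_cases; split; field.
    - destruct (square_root_pos _ Ea) as (q & Hq0 & Eq).
      apply (has_cardinality_of_list _ [(q / 2, q / 2); (- q / 2, - q / 2)]); [reflexivity|distinct|].
      intros x y. unfold preimage. rewrite (Hq a b q 0) by (simpl; lra). split.
      + intros [F G]. destruct (Hsd _ _ _ _ F G) as [-> |[-> |[-> | ->]]]; simpl;
          [left|left|right; left|right; left]; apply pair_eq; field.
      + in_list_cases; split; field. }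
  assert (H4 : forall a b, 0 < a + 2 * b -> 0 < a - 2 * b ->
     has_cardinality (preimage (nf_map H3) (a, b)) (Fin 4)).
  { intros a b Ha Hb.
    destruct (square_root_pos _ Ha) as (r & Hr0 & Er). destruct (square_root_pos _ Hb) as (q & Hq0 & Eq).
    apply (has_cardinality_of_list _ [((r + q) / 2, (r - q) / 2); ((r - q) / 2, (r + q) / 2);
      ((- r + q) / 2, (- r - q) / 2); ((- r - q) / 2, (- r + q) / 2)]); [reflexivity|distinct|].
    intros x y. unfold preimage. rewrite (Hq a b r q) by auto. split.
    - intros [F G]. destruct (Hsd _ _ _ _ F G) as [-> |[-> |[-> | ->]]]; simpl; auto.
    - in_list_cases; split; field. }
  apply preimage_cardinalities_intro.
  - intros [a b].
    destruct (Rtotal_order (a + 2 * b) 0) as [Ha|[Ha|Ha]]; [exists (Fin 0); split; [simpl; auto|auto]| |];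
    (destruct (Rtotal_order (a - 2 * b) 0) as [Hb|[Hb|Hb]]; [exists (Fin 0); split; [simpl; auto|auto]| |]).
    + exists (Fin 1). split; [simpl; auto|].
      assert (a = 0) as -> by lra. assert (b = 0) as -> by lra. auto.
    + exists (Fin 2). split; [simpl; auto|]. apply H2. lra.
    + exists (Fin 2). split; [simpl; auto|]. apply H2. lra.
    + exists (Fin 4). split; [simpl; auto|]. apply H4; lra.
  - intros k [<-|[<-|[<-|[<-|[]]]]].
    + exists (-1, 0). apply H0. lra.
    + now exists (0, 0).
    + exists (2, 1). apply H2. lra.
    + exists (1, 0). apply H4; lra.
Qed.

Lemma at_most_4_cards (f : plane -> plane) p l : (length l <= 4)%nat ->
  (forall x y, f (x, y) = p -> In (x, y) l) ->
  exists k, In k [Fin 0; Fin 1; Fin 2; Fin 3; Fin 4] /\ has_cardinality (preimage f p) k.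
Proof.
  intros L H. destruct (cardinality_le_length (preimage f p) l) as (n & Hn & C).
  - intros [x y]. apply H.
  - exists (Fin n). split; [|exact C].
    destruct n as [|[|[|[|[|n]]]]]; simpl; auto 6. lia.
Qed.

Lemma H2_cards : preimage_cardinalities_are (nf_map H2) [Fin 0; Fin 1; Fin 2; Fin 3; Fin 4].
Proof.
  apply preimage_cardinalities_intro.
  - intros [a b].
    set (q := sqrt (a - 2 * b)).
    set (r := sqrt (a + 2 * b - q + / 4)). set (t := sqrt (a + 2 * b + q + / 4)).
    pose (pt := fun s d : R => ((s + d) / 2, (s - d) / 2) : plane).
    apply (at_most_4_cards _ _ [pt (- / 2 + r) q; pt (- / 2 - r) q; pt (- / 2 + t) (- q); pt (- / 2 - t) (- q)]).
    { simpl; lia. }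
    intros x y E. cbn [nf_map] in E. apply pair_equal_spec in E. destruct E as [<- <-].
    assert (Eq : (x - y) ^ 2 = q ^ 2).
    { unfold q. replace (x ^ 2 + y ^ 2 + x - 2 * (x * y + / 2 * x)) with ((x - y) * (x - y)) by field.
      apply pow2_sqrt_mult. }
    apply square_eq in Eq. unfold pt. simpl.
    destruct Eq as [Eq|Eq].
    + assert (Er : (x + y + / 2) ^ 2 = r ^ 2).
      { unfold r. rewrite <- Eq.
        replace (x ^ 2 + y ^ 2 + x + 2 * (x * y + / 2 * x) - (x - y) + / 4) with ((x + y + / 2) * (x + y + / 2)) by field.
        apply pow2_sqrt_mult. }
      apply square_eq in Er. destruct Er; [left|right; left]; apply pair_eq; lra.
    + assert (Er : (x + y + / 2) ^ 2 = t ^ 2).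
      { unfold t. replace q with (- (x - y)) by lra.
        replace (x ^ 2 + y ^ 2 + x + 2 * (x * y + / 2 * x) + - (x - y) + / 4) with ((x + y + / 2) * (x + y + / 2)) by field.
        apply pow2_sqrt_mult. }
      apply square_eq in Er. destruct Er; [right; right; left|right; right; right; left]; apply pair_eq; lra.
  - intros k [<-|[<-|[<-|[<-|[<-|[]]]]]].
    + exists (- / 2, / 4). card0. nra.
    + exists (- / 8, - / 16). card [(- / 4, - / 4)]; try field.
      assert ((x - y) ^ 2 = 0) by lra. assert (x = y) by nra. subst y. left. apply pair_eq; nra.
    + exists (0, 0). card [(0, 0); (- / 2, - / 2)]; try field.
      assert ((x - y) ^ 2 = 0) by lra. assert (x = y) by nra. subst y.
      assert (x * (x + / 2) = 0) by lra. products_zero; [left|right; left]; apply pair_eq; lra.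
    + exists (/ 4, 0). card [(0, - / 2); (0, / 2); (-1, - / 2)]; try field.
      assert (x * (y + / 2) = 0) by lra. products_zero.
      * subst x. assert ((y - / 2) * (y + / 2) = 0) by lra. products_zero; [right; left|left]; apply pair_eq; lra.
      * assert (y = - / 2) by lra. subst y. assert (x * (x + 1) = 0) by lra. products_zero;
        [left|right; right; left]; apply pair_eq; lra.
    + exists (1, 0). card [(0, 1); (0, -1); (/ 2, - / 2); (-3 / 2, - / 2)]; try field.
      assert (x * (y + / 2) = 0) by lra. products_zero.
      * subst x. assert ((y - 1) * (y + 1) = 0) by lra. products_zero; [left|right; left]; apply pair_eq; lra.
      * assert (y = - / 2) by lra. subst y. assert ((x - / 2) * (x + 3 / 2) = 0) by lra. products_zero;
        [right; right; left|right; right; right; left]; apply pair_eq; lra.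
Qed.

Lemma H1_cards : preimage_cardinalities_are (nf_map H1) [Fin 0; Fin 1; Fin 2; Fin 3; Fin 4].
Proof.
  apply preimage_cardinalities_intro.
  - intros [a b]. destruct (Req_dec b 0) as [->|Hb].
    + apply (at_most_4_cards _ _ [(0, sqrt a); (0, - sqrt a);
        (- / 2 + sqrt (a + / 4), 0); (- / 2 - sqrt (a + / 4), 0)]); [simpl; lia|].
      intros x y E. cbn [nf_map] in E. apply pair_equal_spec in E. destruct E as [E F]. products_zero; subst; simpl.
      * assert (G : y ^ 2 = sqrt (0 ^ 2 + y ^ 2 + 0) ^ 2).
        { replace (0 ^ 2 + y ^ 2 + 0) with (y * y) by ring.
          apply pow2_sqrt_mult. }
        apply square_eq in G. simpl in G. destruct G as [G|G]; [left|right; left]; apply pair_eq; auto.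
      * assert (G : (x + / 2) ^ 2 = sqrt (x ^ 2 + 0 ^ 2 + x + / 4) ^ 2).
        { replace (x ^ 2 + 0 ^ 2 + x + / 4) with ((x + / 2) * (x + / 2)) by field.
          apply pow2_sqrt_mult. }
        apply square_eq in G. simpl in G.
        destruct G as [G|G]; [right; right; left|right; right; right; left]; apply pair_eq; lra.
    (* Substituting [y = b / x] gives [x ^ 4 + x ^ 3 - a x ^ 2 + b ^ 2 = 0], whose value at [0] is
       nonzero. *)
    + destruct (horner_roots [b ^ 2; 0; - a; 1; 1] 0) as (rs & L & Hrs).
      { simpl. nra. }
      apply (at_most_4_cards _ _ (map (fun x => (x, b / x)) rs)); [rewrite length_map; simpl in L; lia|].
      intros x y E. cbn [nf_map] in E. apply pair_equal_spec in E. destruct E as [E F].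
      assert (Hx : x <> 0) by (intros ->; apply Hb; lra).
      apply in_map_iff. exists x. split.
      * apply pair_eq; auto. rewrite <- F. field. auto.
      * apply Hrs. rewrite <- E, <- F. simpl. ring.
  - intros k [<-|[<-|[<-|[<-|[<-|[]]]]]].
    + exists (-1, 0). card0. products_zero; subst; nra.
    + exists (- / 4, 0). card [(- / 2, 0)]; try field.
      products_zero; subst; [nra|]. left. apply pair_eq; nra.
    + exists (- 3 / 16, 0). card [(- / 4, 0); (- 3 / 4, 0)]; try field.
      products_zero; subst; [nra|]. assert ((x + / 4) * (x + 3 / 4) = 0) by lra.
      products_zero; [left|right; left]; apply pair_eq; lra.
    (* Three preimages do not occur over [b = 0]. This is the image of the critical point
       [(/ 6, / 3)]: its abscissa is a double root of the quartic, the simple ones being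
       [(-2 + r) / 3] and [(-2 - r) / 3] with [r ^ 2 = 3]. *)
    + exists (11 / 36, / 18).
      destruct (square_root_pos 3) as (r & Hr & Er); [lra|].
      symmetry in Er. replace (r ^ 2) with (r * r) in Er by ring.
      card [(/ 6, / 3); ((-2 + r) / 3, (-2 - r) / 6); ((-2 - r) / 3, (-2 + r) / 6)]; try nra.
      assert (Hx : x <> 0) by (intros ->; lra).
      assert (F : (x - / 6) * ((x - / 6) * ((x - (-2 + r) / 3) * (x - (-2 - r) / 3))) = 0).
      { transitivity (x * x * (x * x + x - 11 / 36) + (x * y) * (x * y)); [|nra].
        rewrite E2. 
        replace ((x - (-2 + r) / 3) * (x - (-2 - r) / 3)) with (x * x + 4 / 3 * x + 4 / 9 - r * r / 9) by field.
        rewrite Er. field. }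
      assert (Hy : forall z, z * x = / 18 -> y = z).
      { intros z Hz. apply Rmult_eq_reg_l with x; lra. }
      products_zero.
      * left. apply pair_eq; [lra|]. symmetry. apply Hy. replace x with (/ 6) by lra. field.
      * left. apply pair_eq; [lra|]. symmetry. apply Hy. replace x with (/ 6) by lra. field.
      * right; left. apply pair_eq; [lra|]. symmetry. apply Hy. replace x with ((-2 + r) / 3) by lra. nra.
      * right; right; left. apply pair_eq; [lra|]. symmetry. apply Hy. replace x with ((-2 - r) / 3) by lra. nra.
    + exists (4 / 9, 0). card [(0, 2 / 3); (0, - 2 / 3); (/ 3, 0); (- 4 / 3, 0)]; try field.
      products_zero; subst.
      * assert ((y - 2 / 3) * (y + 2 / 3) = 0) by lra. products_zero; [left|right; left]; apply pair_eq; lra.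
      * assert ((x - / 3) * (x + 4 / 3) = 0) by lra.
        products_zero; [right; right; left|right; right; right; left]; apply pair_eq; lra.
Qed.

(* Off the axis [b = 0] the abscissae are the roots of [x^4 + x^3 - a x^2 - b^2],
   which is negative at [0] and positive at both ends. *)
Lemma E1_two_preimages a b : exists p q, p <> q /\
  preimage (nf_map Defs.E1) (a, b) p /\ preimage (nf_map Defs.E1) (a, b) q.
Proof.
  destruct (Req_dec b 0) as [->|Hb].
  - destruct (Rlt_dec a 0) as [Ha|Ha].
    + destruct (square_root_pos (- a)) as (r & Hr & E); [lra|].
      exists (0, r), (0, - r). unfold preimage; cbn [nf_map]. split; [|split].
      * intros F. apply pair_equal_spec in F. lra.
      * apply pair_eq; lra.
      * apply pair_eq; lra.
    + destruct (square_root_pos (a + / 4)) as (r & Hr & E); [lra|].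
      exists (- / 2 + r, 0), (- / 2 - r, 0). unfold preimage; cbn [nf_map]. split; [|split].
      * intros F. apply pair_equal_spec in F. lra.
      * apply pair_eq; lra.
      * apply pair_eq; lra.
  - set (l := [- b ^ 2; 0; - a; 1; 1]).
    set (M := 2 + a ^ 2 + b ^ 2).
    assert (HM : 2 <= M) by (unfold M; nra).
    assert (Hl : forall x, horner l x = x ^ 2 * (x ^ 2 + x - a) - b ^ 2) by (intros; simpl; ring).
    assert (H0 : horner l 0 < 0) by (rewrite Hl; nra).
    assert (H1 : 0 < horner l M).
    { rewrite Hl. assert (1 + b ^ 2 <= M ^ 2 + M - a) by (unfold M at 2; nra).
      assert (1 <= M ^ 2) by nra. nra. }
    assert (H2 : 0 < horner l (- M)).
    { rewrite Hl. replace ((- M) ^ 2) with (M ^ 2) by ring.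
      assert (1 + b ^ 2 <= M ^ 2 + - M - a).
      { assert (2 * M <= M ^ 2) by nra. assert (1 + b ^ 2 <= M - a) by (unfold M; nra). lra. }
      assert (1 <= M ^ 2) by nra. nra. }
    destruct (horner_IVT l 0 M) as (x1 & B1 & R1); [lra|auto|auto|].
    destruct (horner_IVT_decreasing l (- M) 0) as (x2 & B2 & R2); [lra|auto|auto|].
    assert (K : forall x, x <> 0 -> horner l x = 0 -> preimage (nf_map Defs.E1) (a, b) (x, b / x)).
    { intros x Hx E. unfold preimage; cbn [nf_map]. rewrite Hl in E. apply pair_eq; [|field; auto].
      apply Rmult_eq_reg_l with (x ^ 2); [|nra].
      replace (x ^ 2 * (x ^ 2 - (b / x) ^ 2 + x)) with (x ^ 2 * (x ^ 2 + x) - b ^ 2) by (field; auto). lra. }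
    exists (x1, b / x1), (x2, b / x2). split; [|split; apply K; auto; lra].
    intros F. apply pair_equal_spec in F. lra.
Qed.

Lemma E1_at_most_4 a b : exists l, (length l <= 4)%nat /\
  forall x y, nf_map Defs.E1 (x, y) = (a, b) -> In (x, y) l.
Proof.
  destruct (Req_dec b 0) as [->|Hb].
  - exists [(0, sqrt (- a)); (0, - sqrt (- a));
        (- / 2 + sqrt (a + / 4), 0); (- / 2 - sqrt (a + / 4), 0)]. split; [simpl; lia|].
    intros x y E. cbn [nf_map] in E. apply pair_equal_spec in E. destruct E as [E F]. products_zero; subst; simpl.
    + assert (G : y ^ 2 = sqrt (- (0 ^ 2 - y ^ 2 + 0)) ^ 2).
      { replace (- (0 ^ 2 - y ^ 2 + 0)) with (y * y) by ring.
        apply pow2_sqrt_mult. }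
      apply square_eq in G. simpl in G. destruct G as [G|G]; [left|right; left]; apply pair_eq; auto.
    + assert (G : (x + / 2) ^ 2 = sqrt (x ^ 2 - 0 ^ 2 + x + / 4) ^ 2).
      { replace (x ^ 2 - 0 ^ 2 + x + / 4) with ((x + / 2) * (x + / 2)) by field.
        apply pow2_sqrt_mult. }
      apply square_eq in G. simpl in G.
      destruct G as [G|G]; [right; right; left|right; right; right; left]; apply pair_eq; lra.
  - destruct (horner_roots [- b ^ 2; 0; - a; 1; 1] 0) as (rs & L & Hrs).
    { simpl. nra. }
    exists (map (fun x => (x, b / x)) rs). split; [rewrite length_map; simpl in L; lia|].
    intros x y E. cbn [nf_map] in E. apply pair_equal_spec in E. destruct E as [E F].
    assert (Hx : x <> 0) by (intros ->; apply Hb; lra).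
    apply in_map_iff. exists x. split.
    + apply pair_eq; auto. rewrite <- F. field. auto.
    + apply Hrs. rewrite <- E, <- F. simpl. ring.
Qed.

Lemma E1_cards : preimage_cardinalities_are (nf_map Defs.E1) [Fin 2; Fin 3; Fin 4].
Proof.
  apply preimage_cardinalities_intro.
  - intros [a b].
    destruct (E1_at_most_4 a b) as (l & L & Hl).
    destruct (cardinality_le_length (preimage (nf_map Defs.E1) (a, b)) l) as (n & Hn & C).
    { intros [x y]. apply Hl. }
    destruct (E1_two_preimages a b) as (p & q & Hpq & Hp & Hq).
    assert (H2 : (length [p; q] <= n)%nat).
    { apply (length_le_cardinality (preimage (nf_map Defs.E1) (a, b))); auto.
      - repeat constructor; simpl; intuition.
      - intros r [<-|[<-|[]]]; auto. }
    exists (Fin n). split; [|exact C]. simpl in H2.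
    destruct n as [|[|[|[|[|n]]]]]; simpl; auto; lia.
  (* Over [b = 0] a fibre splits into [y ^ 2 = - a] on [x = 0] and [x ^ 2 + x = a] on [y = 0]. At
     [a = - / 4] the second equation has a double root; for [a] between [- / 4] and [0] both have
     two solutions. *)
  - intros k [<-|[<-|[<-|[]]]].
    + exists (2, 0). card [(1, 0); (-2, 0)]; try ring.
      products_zero; subst; [nra|]. assert ((x - 1) * (x + 2) = 0) by lra.
      products_zero; [left|right; left]; apply pair_eq; lra.
    + exists (- / 4, 0). card [(0, / 2); (0, - / 2); (- / 2, 0)]; try field.
      products_zero; subst.
      * assert ((y - / 2) * (y + / 2) = 0) by lra. products_zero; [left|right; left]; apply pair_eq; lra.
      * right; right; left. apply pair_eq; nra.
    + exists (- 9 / 100, 0). card [(0, 3 / 10); (0, - 3 / 10); (- / 10, 0); (- 9 / 10, 0)]; try field.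
      products_zero; subst.
      * assert ((y - 3 / 10) * (y + 3 / 10) = 0) by lra. products_zero; [left|right; left]; apply pair_eq; lra.
      * assert ((x + / 10) * (x + 9 / 10) = 0) by lra.
        products_zero; [right; right; left|right; right; right; left]; apply pair_eq; lra.
Qed.

(** Eliminating [y] leaves the cubic [x ^ 3 - a x + b], so there is always a preimage and never more
    than three. The root bound is applied at [0], where the cubic has value [b]; this is why [b = 0]
    is listed by hand. *)
Lemma P1_cards : preimage_cardinalities_are (nf_map P1) [Fin 1; Fin 2; Fin 3].
Proof.
  apply preimage_cardinalities_intro.
  - intros [a b].
    assert (K : exists l, (length l <= 3)%nat /\ forall p, preimage (nf_map P1) (a, b) p -> In p l).
    { destruct (Req_dec b 0) as [->|Hb].
      - exists [(0, a); (sqrt a, 0); (- sqrt a, 0)]. split; [simpl; lia|].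
        intros [x y] E. unfold preimage in E; cbn [nf_map] in E. apply pair_equal_spec in E.
        destruct E as [E F]. products_zero; subst; simpl.
        + left. apply pair_eq; ring.
        + assert (G : x ^ 2 = sqrt (x ^ 2 + 0) ^ 2).
          { replace (x ^ 2 + 0) with (x * x) by ring. apply pow2_sqrt_mult. }
          apply square_eq in G. simpl in G. destruct G as [G|G]; [right; left|right; right; left]; apply pair_eq; lra.
      - destruct (horner_roots [b; - a; 0; 1] 0) as (rs & L & Hrs).
        { simpl. intros H. apply Hb. lra. }
        exists (map (fun x => (x, a - x ^ 2)) rs). split; [rewrite length_map; simpl in L; lia|].
        intros [x y] E. unfold preimage in E; cbn [nf_map] in E. apply pair_equal_spec in E.
        destruct E as [E F]. apply in_map_iff. exists x. split.
        + apply pair_eq; lra.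
        + apply Hrs. rewrite <- E, <- F. simpl. ring. }
    destruct K as (l & L & Hl).
    destruct (cardinality_le_length (preimage (nf_map P1) (a, b)) l Hl) as (n & Hn & C).
    destruct (cubic_root 0 (- a) b) as (x & Hx).
    assert (H1 : (length [(x, (a - x ^ 2)%R)] <= n)%nat).
    { apply (length_le_cardinality (preimage (nf_map P1) (a, b))); auto.
      - repeat constructor; simpl; intuition.
      - intros r [<-|[]]. unfold preimage; cbn [nf_map]. apply pair_eq; lra. }
    exists (Fin n). split; [|exact C]. simpl in H1.
    destruct n as [|[|[|[|n]]]]; simpl; auto; lia.
  - intros k [<-|[<-|[<-|[]]]].
    + exists (-1, 0). card [(0, -1)]; try ring. products_zero; subst; [left; apply pair_eq; lra|nra].
    + exists (3, 2). card [(1, 2); (-2, -1)]; try ring.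
      assert (y = 3 - x * x) by lra. subst y.
      assert ((x - 1) * ((x - 1) * (x + 2)) = 0) by lra.
      products_zero; [left|left|right; left]; apply pair_eq; nra.
    + exists (1, 0). card [(0, 1); (1, 0); (-1, 0)]; try ring.
      products_zero; subst; [left; apply pair_eq; lra|].
      assert ((x - 1) * (x + 1) = 0) by lra. products_zero; [right; left|right; right; left]; apply pair_eq; lra.
Qed.

Lemma nf_cards c : preimage_cardinalities_are (nf_map c) (nf_preimage_cardinalities c).
Proof.
  destruct c; simpl nf_preimage_cardinalities; auto using E1_cards, E2_cards, H1_cards, H2_cards, H3_cards,
    P1_cards, P2_cards, P3_cards, DE1_cards, DE2_cards, DE3_cards, DH1_cards, DH2_cards,
    DP1_cards, DP2_cards, DP3_cards, DP4_cards, DP5_cards.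
Qed.

(** * Invariance under affine map equivalence *)

(** Everything the descriptions mention is expressed as an affine image of the same object for the
    normal form; [h] and [k] are the inverses of the maps in the equivalence. The Jacobian itself is
    included because [J0_line] and [J0_two_coincident_lines] speak of the polynomial, not of its
    zero set. *)
Lemma equivalent_nf f c : affinely_map_equivalent f (nf_map c) ->
  exists h k, invertible_affine_map h /\ invertible_affine_map k /\
    (forall S, image f (image h S) = image k (image (nf_map c) S)) /\
    J0 f = image h (J0 (nf_map c)) /\
    (exists r h', r <> 0 /\ invertible_affine_map h' /\
       forall p, jacobian f (fst p) (snd p) = r * jacobian (nf_map c) (fst (h' p)) (snd (h' p))) /\
    (forall p, preimage f (k p) = image h (preimage (nf_map c) p)).
Proof.
  intros (h & k & Hh & Hk & E).
  destruct (invertible_affine_inverse h Hh) as (h' & Hh' & h1 & h2).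
  destruct (invertible_affine_inverse k Hk) as (k' & Hk' & k1 & k2).
  assert (Ef : forall p, f p = k' (nf_map c (h p))) by (intros p; now rewrite <- E, k1).
  destruct (jacobian_equivalent f (nf_map c) h k' (nf_map_quad c) Hh Hk' Ef) as (r & Hr & J).
  exists h', k'. split; [auto|split; [auto|split; [|split; [|split]]]].
  - intros S. rewrite !image_comp. f_equal. apply functional_extensionality.
    intros p. now rewrite Ef, h2.
  - rewrite (image_inverse h' h) by auto. apply seteq_eq. intros p. unfold J0. rewrite J.
    split; intros H.
    + apply Rmult_integral in H. destruct H; [easy|auto].
    + rewrite H. ring.
  - exists r, h. auto.
  - intros p. rewrite (image_inverse h' h) by auto. apply seteq_eq. intros q. unfold preimage.
    rewrite Ef. split; [|now intros ->].
    intros H. rewrite <- (k2 p), <- H. now rewrite k2.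
Qed.

Lemma has_cardinality_affine m S k : invertible_affine_map m ->
  has_cardinality S k -> has_cardinality (image m S) k.
Proof.
  intros Hm. destruct (invertible_affine_inverse m Hm) as (g & _ & G1 & G2).
  destruct k as [n|]; simpl.
  - intros (l & N & <- & E). exists (map m l). split; [|split].
    + apply Injective_map_NoDup; auto. intros x y e. now rewrite <- (G1 x), e, G1.
    + apply length_map.
    + intros p. rewrite in_map_iff. split.
      * intros (q & <- & Hq). exists q. split; auto. now apply E.
      * intros (q & Hq & <-). exists q. split; auto. now apply E.
  - intros H (l & Hl). apply H. exists (map g l). intros p Hp. rewrite <- (G1 p).
    apply in_map, Hl. now exists p.
Qed.

Lemma preimage_cardinalities_equivalent f c l : affinely_map_equivalent f (nf_map c) ->
  preimage_cardinalities_are (nf_map c) l -> preimage_cardinalities_are f l.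
Proof.
  intros He Hl. destruct (equivalent_nf f c He) as (h & k & Hh & Hk & _ & _ & _ & E).
  destruct (invertible_affine_inverse h Hh) as (h' & Hh' & h1 & h2).
  destruct (invertible_affine_inverse k Hk) as (k' & Hk' & k1 & k2).
  intros n. rewrite <- (Hl n). split.
  - intros (p & Hp). exists (k' p). rewrite <- (k2 p), E in Hp.
    apply (has_cardinality_affine h') in Hp; auto.
    rewrite image_comp in Hp. replace (image _ _) with (preimage (nf_map c) (k' p)) in Hp; auto.
    apply seteq_eq. intros q. split.
    + intros H. now exists q.
    + intros (r & Hr & <-). now rewrite h1.
  - intros (p & Hp). exists (k p). rewrite E. now apply has_cardinality_affine.
Qed.

(** * Affine transport of conics, lines, rays and descriptions *)

Lemma is_ellipse_affine m S : invertible_affine_map m -> is_ellipse S -> is_ellipse (image m S).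
Proof.
  intros Hm (h & Hh & E). exists (fun p => m (h p)). split; [now apply invertible_affine_comp|].
  rewrite (seteq_eq _ _ E), image_comp. intros p; tauto.
Qed.

Lemma parabola_with_vertex_affine m v S : invertible_affine_map m ->
  parabola_with_vertex v S -> parabola_with_vertex (m v) (image m S).
Proof.
  intros Hm (h & Hh & <- & E). exists (fun p => m (h p)).
  split; [now apply invertible_affine_comp|split; [auto|]].
  rewrite (seteq_eq _ _ E), image_comp. intros p; tauto.
Qed.

Lemma is_parabola_affine m S : invertible_affine_map m -> is_parabola S -> is_parabola (image m S).
Proof. intros Hm (v & H). exists (m v). now apply parabola_with_vertex_affine. Qed.

Lemma hyperbola_with_branches_affine m S B1 B2 : invertible_affine_map m ->
  hyperbola_with_branches S B1 B2 -> hyperbola_with_branches (image m S) (image m B1) (image m B2).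
Proof.
  intros Hm (h & Hh & E & E1 & E2). exists (fun p => m (h p)). split; [now apply invertible_affine_comp|].
  rewrite (seteq_eq _ _ E), (seteq_eq _ _ E1), (seteq_eq _ _ E2), !image_comp.
  split; [|split]; intros p; tauto.
Qed.

Lemma image_singleton m p : image m (singleton p) = singleton (m p).
Proof.
  apply seteq_eq. intros q. unfold singleton. split.
  - now intros (r & -> & <-).
  - intros ->. now exists p.
Qed.

Lemma is_point_affine m S : is_point S -> is_point (image m S).
Proof.
  intros (p & E). exists (m p). rewrite (seteq_eq _ _ E), image_singleton. intros q; tauto.
Qed.

(** The new direction is chosen before [c], so that distinct parallel lines are transported
    together. *)
Lemma image_line m a b : invertible_affine_map m -> a <> 0 \/ b <> 0 ->
  exists r a' b' u, r <> 0 /\ (a' <> 0 \/ b' <> 0) /\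
    forall c, image m (line a b c) = line a' b' (r * c + u).
Proof.
  intros Hm Hab. destruct (invertible_affine_inverse m Hm) as (g & Hg & G1 & G2).
  destruct (invertible_affineE g Hg) as (A & B & C & D & U & V & HD & Eg).
  exists 1, (a * A + b * C), (a * B + b * D), (a * U + b * V). split; [lra|split].
  - apply NNPP. intros H. apply not_or_and in H. destruct H as [H1 H2].
    apply NNPP in H1. apply NNPP in H2.
    assert (a * (A * D - B * C) = 0).
    { transitivity ((a * A + b * C) * D - (a * B + b * D) * C); [ring|]. rewrite H1, H2. ring. }
    assert (b * (A * D - B * C) = 0).
    { transitivity ((a * B + b * D) * A - (a * A + b * C) * B); [ring|]. rewrite H1, H2. ring. }
    apply Rmult_integral in H, H0. tauto.
  - intros c. rewrite (image_inverse m g) by auto. apply seteq_eq. intros p.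
    rewrite Eg. unfold line, affine. simpl. split; intros H; lra.
Qed.

Lemma is_line_affine m S : invertible_affine_map m -> is_line S -> is_line (image m S).
Proof.
  intros Hm (a & b & c & H & E). destruct (image_line m a b Hm H) as (r & a' & b' & u & _ & H' & E').
  exists a', b', (r * c + u). split; auto. rewrite (seteq_eq _ _ E), E'. intros p; tauto.
Qed.

Lemma distinct_parallel_lines_affine m L1 L2 : invertible_affine_map m ->
  distinct_parallel_lines L1 L2 -> distinct_parallel_lines (image m L1) (image m L2).
Proof.
  intros Hm (a & b & c1 & c2 & H & Hc & E1 & E2).
  destruct (image_line m a b Hm H) as (r & a' & b' & u & Hr & H' & E').
  exists a', b', (r * c1 + u), (r * c2 + u).
  split; [auto|split; [|rewrite (seteq_eq _ _ E1), (seteq_eq _ _ E2), !E'; split; intros p; tauto]].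
  intros e. apply Hc. apply Rmult_eq_reg_l with r; lra.
Qed.

Lemma image_injective m S T : invertible_affine_map m -> seteq (image m S) (image m T) -> seteq S T.
Proof.
  intros Hm H. destruct (invertible_affine_inverse m Hm) as (g & Hg & G1 & G2).
  rewrite !(image_inverse m g) in H by auto. intros p. specialize (H (m p)). cbv beta in H. now rewrite G1 in H.
Qed.

Lemma intersecting_lines_affine m L1 L2 : invertible_affine_map m ->
  intersecting_lines L1 L2 -> intersecting_lines (image m L1) (image m L2).
Proof.
  intros Hm (H1 & H2 & H3 & p & H4 & H5). split; [|split; [|split]]; try now apply is_line_affine.
  - intros E. apply H3. now apply (image_injective m).
  - exists (m p). split; now exists p.
Qed.

Lemma ray_from_affine m p S : invertible_affine_map m -> ray_from p S -> ray_from (m p) (image m S).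
Proof.
  intros Hm (u & v & H & E).
  destruct (invertible_affineE m Hm) as (A & B & C & D & U & V & HD & ->).
  exists (A * u + B * v), (C * u + D * v). split.
  - apply NNPP. intros K. apply not_or_and in K. destruct K as [K1 K2].
    apply NNPP in K1. apply NNPP in K2.
    assert (F1 : u * (A * D - B * C) = 0).
    { transitivity ((A * u + B * v) * D - (C * u + D * v) * B); [ring|]. rewrite K1, K2. ring. }
    assert (F2 : v * (A * D - B * C) = 0).
    { transitivity ((C * u + D * v) * A - (A * u + B * v) * C); [ring|]. rewrite K1, K2. ring. }
    apply Rmult_integral in F1, F2. tauto.
  - rewrite (seteq_eq _ _ E). intros q. unfold affine. split.
    + intros (r & (t & Ht & ->) & <-). exists t. split; auto. simpl. apply pair_eq; ring.
    + intros (t & Ht & ->). exists (fst p + t * u, snd p + t * v). split; [now exists t|].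
      simpl. apply pair_eq; ring.
Qed.

Lemma is_ray_affine m S : invertible_affine_map m -> is_ray S -> is_ray (image m S).
Proof. intros Hm (p & H). exists (m p). now apply ray_from_affine. Qed.

Lemma linear_form_comp a b c A B C D U V r : r <> 0 -> A * D - B * C <> 0 -> a <> 0 \/ b <> 0 ->
  exists a' b' c', (a' <> 0 \/ b' <> 0) /\
    forall x y, r * (a * (A * x + B * y + U) + b * (C * x + D * y + V) + c) = a' * x + b' * y + c'.
Proof.
  intros Hr HD H.
  exists (r * (a * A + b * C)), (r * (a * B + b * D)), (r * (a * U + b * V + c)).
  split; [|intros; ring].
  apply NNPP. intros K. apply not_or_and in K. destruct K as [K1 K2].
  apply NNPP in K1. apply NNPP in K2.
  assert (F1 : r * (a * (A * D - B * C)) = 0).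
  { transitivity (r * (a * A + b * C) * D - r * (a * B + b * D) * C); [ring|]. rewrite K1, K2. ring. }
  assert (F2 : r * (b * (A * D - B * C)) = 0).
  { transitivity (r * (a * B + b * D) * A - r * (a * A + b * C) * B); [ring|]. rewrite K1, K2. ring. }
  apply Rmult_integral in F1, F2. destruct F1 as [|F1], F2 as [|F2]; try easy.
  apply Rmult_integral in F1, F2. tauto.
Qed.

Lemma image_empty m S : (forall p, ~ S p) -> forall p, ~ image m S p.
Proof. intros H p (q & Hq & _). now apply (H q). Qed.

Lemma image_full m S : invertible_affine_map m -> (forall p, S p) -> forall p, image m S p.
Proof.
  intros Hm H p. destruct (invertible_affine_inverse m Hm) as (g & Hg & G1 & G2). now exists (g p).
Qed.

Lemma J0_equivalent f c d : affinely_map_equivalent f (nf_map c) ->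
  J0_is (nf_map c) d -> J0_is f d.
Proof.
  intros He. destruct (equivalent_nf f c He) as (h & k & Hh & Hk & EI & E0 & (r & h' & Hr & Hh' & J) & _).
  destruct (invertible_affineE h' Hh') as (A & B & C & D & U & V & HD & Eh).
  destruct d; cbn [J0_is]; rewrite ?E0.
  - now apply is_ellipse_affine.
  - intros (B1 & B2 & H). exists (image h B1), (image h B2). now apply hyperbola_with_branches_affine.
  - now apply is_parabola_affine.
  - apply is_point_affine.
  - intros (L1 & L2 & H & E). exists (image h L1), (image h L2).
    split; [now apply intersecting_lines_affine|].
    rewrite (seteq_eq _ _ E), image_union. intros p; tauto.
  - intros (L1 & L2 & H & E). exists (image h L1), (image h L2).
    split; [now apply distinct_parallel_lines_affine|].
    rewrite (seteq_eq _ _ E), image_union. intros p; tauto.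
  - intros (s & a & b & c' & Hs & Hab & E).
    destruct (linear_form_comp a b c' A B C D U V 1) as (a' & b' & c'' & H' & E'); auto.
    exists (r * s), a', b', c''. split; [now apply Rmult_integral_contrapositive|split; auto].
    intros x y. pose proof (J (x, y)) as Jxy. simpl in Jxy.
    rewrite Jxy, E, <- E', Eh. unfold affine; simpl. ring.
  - intros (a & b & c' & Hab & E).
    destruct (linear_form_comp a b c' A B C D U V r) as (a' & b' & c'' & H' & E'); auto.
    exists a', b', c''. split; auto.
    intros x y. pose proof (J (x, y)) as Jxy. simpl in Jxy.
    rewrite Jxy, E, <- E', Eh. unfold affine; simpl. ring.
  - apply image_empty.
  - now apply image_full.
Qed.

Lemma J1_equivalent f c d : affinely_map_equivalent f (nf_map c) ->
  J1_is (nf_map c) d -> J1_is f d.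
Proof.
  intros He. destruct (equivalent_nf f c He) as (h & k & Hh & Hk & EI & E0 & _ & _).
  assert (E1 : J1 f = image k (J1 (nf_map c))) by (unfold J1; now rewrite E0, EI).
  destruct d; cbn [J1_is]; rewrite ?E1.
  - now apply closed_curve_with_three_cusps_affine.
  - intros (B1 & B2 & H & E & Hd & Hs & Hc). exists (image h B1), (image h B2).
    rewrite !EI, E0. split; [|split; [|split; [|split]]].
    + now apply hyperbola_with_branches_affine.
    + rewrite (seteq_eq _ _ E), image_union. intros p; tauto.
    + destruct (invertible_affine_inverse k Hk) as (g & Hg & G1 & G2).
      intros p. rewrite !(image_inverse k g) by auto. apply Hd.
    + now apply smooth_curve_affine.
    + now apply curve_with_single_cusp_affine.
  - intros (P & L & v & HP & HL & E). exists (image k P), (image k L), (k v).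
    split; [now apply parabola_with_vertex_affine|split; [now apply ray_from_affine|]].
    rewrite (seteq_eq _ _ E), image_union. intros p; tauto.
  - intros (p & L1 & L2 & H1 & H2 & Hn & E). exists (k p), (image k L1), (image k L2).
    split; [now apply ray_from_affine|split; [now apply ray_from_affine|split]].
    + intros H. apply Hn. now apply (image_injective k).
    + rewrite (seteq_eq _ _ E), image_union. intros q; tauto.
  - now apply curve_with_single_cusp_affine.
  - intros (L1 & L2 & p & H1 & H2 & H3 & H4 & H5 & H6).
    exists (image h L1), (image h L2), (k p). rewrite !EI, E0.
    split; [now apply distinct_parallel_lines_affine|split; [|split; [|split; [|split]]]].
    + rewrite (seteq_eq _ _ H2), image_union. intros q; tauto.
    + now apply is_line_affine.
    + rewrite (seteq_eq _ _ H4), image_singleton. intros q; tauto.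
    + destruct (invertible_affine_inverse k Hk) as (g & Hg & G1 & G2).
      rewrite (image_inverse k g) by auto. cbv beta. now rewrite G1.
    + rewrite (seteq_eq _ _ H6), image_union, image_singleton. intros q; tauto.
  - apply is_point_affine.
  - now apply is_parabola_affine.
  - now apply is_line_affine.
  - now apply is_ray_affine.
  - apply image_empty.
Qed.

(** * Reduction to normal form *)

Definition classified (f : plane -> plane) : Prop := exists c, affinely_map_equivalent f (nf_map c).

(* The normal form is found from the quadratic part first; the affine part is arbitrary. *)
Definition classified_part (a20 a11 a02 b20 b11 b02 : R) : Prop :=
  forall a10 a01 a00 b10 b01 b00,
    classified (quad a20 a11 a02 a10 a01 a00 b20 b11 b02 b10 b01 b00).

(** Substituting [(a x + b y, c x + d y)] in the source and applying the matrix with rows [(a', b')]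
    and [(c', d')] in the target turns [a20 .. b02] into [n20 .. m02]. The coefficient identities
    are premises so that each use can leave them to [lra] or [field]. *)
Lemma part_step a b c d a' b' c' d' a20 a11 a02 b20 b11 b02 n20 n11 n02 m20 m11 m02 :
  classified_part n20 n11 n02 m20 m11 m02 ->
  a * d - b * c <> 0 -> a' * d' - b' * c' <> 0 ->
  n20 = a' * (a20 * a^2 + a11 * a * c + a02 * c^2) + b' * (b20 * a^2 + b11 * a * c + b02 * c^2) ->
  n11 = a' * (2 * a20 * a * b + a11 * (a * d + b * c) + 2 * a02 * c * d)
      + b' * (2 * b20 * a * b + b11 * (a * d + b * c) + 2 * b02 * c * d) ->
  n02 = a' * (a20 * b^2 + a11 * b * d + a02 * d^2) + b' * (b20 * b^2 + b11 * b * d + b02 * d^2) ->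
  m20 = c' * (a20 * a^2 + a11 * a * c + a02 * c^2) + d' * (b20 * a^2 + b11 * a * c + b02 * c^2) ->
  m11 = c' * (2 * a20 * a * b + a11 * (a * d + b * c) + 2 * a02 * c * d)
      + d' * (2 * b20 * a * b + b11 * (a * d + b * c) + 2 * b02 * c * d) ->
  m02 = c' * (a20 * b^2 + a11 * b * d + a02 * d^2) + d' * (b20 * b^2 + b11 * b * d + b02 * d^2) ->
  classified_part a20 a11 a02 b20 b11 b02.
Proof.
  intros H D D' -> -> -> -> -> -> a10 a01 a00 b10 b01 b00.
  destruct (H (a' * (a10 * a + a01 * c) + b' * (b10 * a + b01 * c))
              (a' * (a10 * b + a01 * d) + b' * (b10 * b + b01 * d)) (a' * a00 + b' * b00)
              (c' * (a10 * a + a01 * c) + d' * (b10 * a + b01 * c))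
              (c' * (a10 * b + a01 * d) + d' * (b10 * b + b01 * d)) (c' * a00 + d' * b00)) as (n & Hn).
  exists n. eapply equivalent_trans; [|exact Hn]. apply equivalent_sym.
  destruct (invertible_affine_inverse (affine a' b' c' d' 0 0)) as (g & Hg & G1 & G2);
    [now apply invertible_affine|].
  exists (affine a b c d 0 0), g. split; [now apply invertible_affine|split; [auto|]].
  intros [x y]. match goal with |- g ?p = ?q => replace p with (affine a' b' c' d' 0 0 q); [apply G1|] end.
  unfold affine, quad; cbn [fst snd]. apply pair_eq; ring.
Qed.

Ltac nf_by c h k :=
  exists c;
  match h with (?a, ?b, ?c', ?d, ?u, ?v) =>
  match k with (?p, ?q, ?r, ?s, ?m, ?n) =>
    apply (equivalent_intro _ (nf_map c) a b c' d u v p q r s m n) end end;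
  [| |intros x y; unfold affine, quad; cbn [fst snd nf_map]; apply pair_eq; try ring; try (field; auto)].

(** Relative to [x y], the linear form [p x + q y] is zero ([DE3]), a multiple of one factor ([DE2])
    or neither ([DE1]). In the last case [4 p q x y = (p x + q y) ^ 2 - (p x - q y) ^ 2]. *)
Lemma part_DE : classified_part 0 1 0 0 0 0.
Proof.
  intros a10 a01 a00 p q r.
  destruct (Req_dec p 0) as [->|Hp], (Req_dec q 0) as [->|Hq].
  - nf_by DE3 (1, 1, 1, -1, a01 + a10, a01 - a10) (4, 0, 0, 1, 4 * a01 * a10 - 4 * a00, - r); lra.
  - nf_by DE2 (1, 1, -1, 1, a01 + a10, a10 - a01) (4, 0, 0, 2 / q, 4 * a01 * a10 - 4 * a00, 2 * a10 - 2 / q * r);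
      [lra|]. replace (4 * (2 / q) - 0 * 0) with (8 / q) by (field; auto).
    apply Rmult_integral_contrapositive; split; [lra|now apply Rinv_neq_0_compat].
  - nf_by DE2 (1, 1, 1, -1, a01 + a10, a01 - a10) (4, 0, 0, 2 / p, 4 * a01 * a10 - 4 * a00, 2 * a01 - 2 / p * r);
      [lra|]. replace (4 * (2 / p) - 0 * 0) with (8 / p) by (field; auto).
    apply Rmult_integral_contrapositive; split; [lra|now apply Rinv_neq_0_compat].
  - assert (p * q <> 0) by now apply Rmult_integral_contrapositive.
    nf_by DE1 (p, - q, p, q, p * a01 - q * a10, p * a01 + q * a10)
      (-4 * (p * q), 0, 0, 1, -4 * (p * q) * (a01 * a10 - a00), p * a01 + q * a10 - r); lra.
Qed.

(** A nonzero linear form [p x + q y] becomes a coordinate by a similarity: [(p x + q y) ^ 2 + (p y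
    - q x) ^ 2 = (p ^ 2 + q ^ 2) (x ^ 2 + y ^ 2)]. *)
Lemma part_DH : classified_part 1 0 1 0 0 0.
Proof.
  intros a10 a01 a00 p q r.
  destruct (classic (p = 0 /\ q = 0)) as [[-> ->]|H].
  - nf_by DH2 (1, 0, 0, 1, a10 / 2, a01 / 2) (1, 0, 0, 1, (a10 / 2) ^ 2 + (a01 / 2) ^ 2 - a00, - r); lra.
  - assert (K : p * p + q * q <> 0) by (intros K; apply H; nra).
    nf_by DH1 (- q, p, p, q, - q * (a10 / 2) + p * (a01 / 2), p * (a10 / 2) + q * (a01 / 2))
      (p * p + q * q, 0, 0, 1, (p * p + q * q) * ((a10 / 2) ^ 2 + (a01 / 2) ^ 2 - a00),
        p * (a10 / 2) + q * (a01 / 2) - r); lra.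
Qed.

(** If the second component involves [y], it serves to remove [y] from the first and becomes a
    coordinate ([DP2]). Otherwise the vanishing of [p] and [b] separates four forms. *)
Lemma part_DP : classified_part 1 0 0 0 0 0.
Proof.
  intros a b e p q r.
  destruct (Req_dec q 0) as [->|Hq].
  - destruct (Req_dec p 0) as [->|Hp], (Req_dec b 0) as [->|Hb].
    + nf_by DP5 (1, 0, 0, 1, a / 2, 0) (1, 0, 0, 1, (a / 2) ^ 2 - e, - r); lra.
    + nf_by DP3 (1, 0, a, b, 0, 0) (1, 0, 0, 1, - e, - r); lra.
    + nf_by DP4 (1, 0, 0, 1, a / 2, 0) (1, 0, 0, / p, (a / 2) ^ 2 - e, a / 2 - r / p);
      [lra|]. pose proof (Rinv_neq_0_compat p Hp). lra.
    + nf_by DP1 (1, 0, a, b, 0, 0) (1, 0, 0, / p, - e, - r / p);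
      [lra|]. pose proof (Rinv_neq_0_compat p Hp). lra.
  - nf_by DP2 (1, 0, p, q, (a - b / q * p) / 2, r) (1, - b / q, 0, 1, ((a - b / q * p) / 2) ^ 2 - e + b / q * r, 0); lra.
Qed.

(** For [b = 0] the components are, up to constants, a square centred at [x = - a / 2] and
    [(x + d) (y + c)]; [P3] is the case where the two lines [x = - a / 2] and [x = - d] coincide. *)
Lemma part_P : classified_part 1 0 0 0 1 0.
Proof.
  intros a b e c d r.
  destruct (Req_dec b 0) as [->|Hb].
  - destruct (Req_dec (a - 2 * d) 0) as [Ha|Ha].
    + assert (a = 2 * d) as -> by lra.
      nf_by P3 (1, 0, 0, 1, d, c) (1, 0, 0, 1, d ^ 2 - e, c * d - r); lra.
    + set (s := a - 2 * d) in *. replace a with (s + 2 * d) by (unfold s; ring). clearbody s.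
      (* The scaling sends [x = - a / 2] to [0] and [x = - d] to [-1]. *)
      nf_by P2 (- (2 / s), 0, 0, 1, - (2 / s) * d - 1, c)
        (4 / (s * s), 0, 0, - (2 / s), 4 / (s * s) * (d * d + s * d - e) + 1, - (2 / s) * (c * d - r)).
      * pose proof (Rinv_neq_0_compat s Ha). lra.
      * replace (4 / (s * s) * - (2 / s) - 0 * 0) with (-8 * / (s * s * s)) by (field; auto).
        apply Rmult_integral_contrapositive; split; [lra|].
        apply Rinv_neq_0_compat; repeat apply Rmult_integral_contrapositive; auto.
  - assert (Hu : exists u, d = 3 * u - a) by (exists ((d + a) / 3); field).
    destruct Hu as (u & ->). set (w := b * c + (a - 2 * u) * (a - u)).
    (* [u] and [w] solve [X Y = b (x y + c x + d y) + (a - 2 u) (x^2 + a x + b y) + const]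
       for [X = x + u] and [Y = (a - 2 u) x + b y + w] *)
    nf_by P1 (1, 0, a - 2 * u, b, u, w)
      (1, 0, a - 2 * u, b, u ^ 2 + w - e, u * w - (a - 2 * u) * e - b * r); try lra.
    unfold w. ring.
Qed.

(* In the coordinates [s = x + y], [d = x - y] the forms [H1], [H2], [H3] are, up to
   translations and scalings, [(s^2 + beta d, d^2 + gamma s)] with two, one or no nonzero [beta], [gamma]. *)
Lemma part_H : classified_part 1 0 0 0 0 1.
Proof.
  intros a b e c d r.
  destruct (Req_dec b 0) as [->|Hb], (Req_dec c 0) as [->|Hc].
  - nf_by H3 (/ 2, / 2, / 2, - / 2, a / 4 + d / 4, a / 4 - d / 4)
      (/ 2, / 2, / 4, - / 4, ((a / 2) ^ 2 - e + (d / 2) ^ 2 - r) / 2, ((a / 2) ^ 2 - e - (d / 2) ^ 2 + r) / 4); lra.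
  - nf_by H2 (c / 2, / 2, - c / 2, / 2, c * a / 4 + d / 4 - / 4, - c * a / 4 + d / 4 - / 4)
      (c ^ 2 / 2, / 2, - c ^ 2 / 4, / 4,
        (c ^ 2 * ((a / 2) ^ 2 - e) + ((d / 2) ^ 2 - r + c * a / 2 - / 4)) / 2,
        (- c ^ 2 * ((a / 2) ^ 2 - e) + ((d / 2) ^ 2 - r + c * a / 2 - / 4)) / 4); [lra|nra].
  - nf_by H2 (/ 2, b / 2, / 2, - b / 2, a / 4 + b * d / 4 - / 4, a / 4 - b * d / 4 - / 4)
      (/ 2, b ^ 2 / 2, / 4, - b ^ 2 / 4,
        (((a / 2) ^ 2 - e + b * d / 2 - / 4) + b ^ 2 * ((d / 2) ^ 2 - r)) / 2,
        (((a / 2) ^ 2 - e + b * d / 2 - / 4) - b ^ 2 * ((d / 2) ^ 2 - r)) / 4); [lra|nra].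
  (* Scaling the coordinates by [l] and [m] normalizes both mixed linear terms when
     [l ^ 2 b = m / 2] and [m ^ 2 c = l / 2]. Eliminating [m] gives [l ^ 3 = / (8 b ^ 2 c)], hence a
     real cube root [s] of [b ^ 2 c]. *)
  - destruct (cubic_root 0 0 (- (b ^ 2 * c))) as (s & Hs).
    assert (Es : c = s ^ 3 / b ^ 2) by (apply Rmult_eq_reg_l with (b ^ 2); [|nra]; field_simplify; [lra|auto]).
    assert (s <> 0) by (intros ->; apply Hc; rewrite Es; field; auto).
    clear Hs. subst c.
    set (l := / (2 * s)). set (m := b / (2 * s ^ 2)).
    assert (Hl : l <> 0) by (apply Rinv_neq_0_compat; lra).
    assert (Hm : m <> 0).
    { apply Rmult_integral_contrapositive; split; auto. apply Rinv_neq_0_compat. nra. }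
    nf_by H1 (l / 2, m / 2, l / 2, - m / 2, l * a / 4 + m * d / 4 - / 4, l * a / 4 - m * d / 4)
      (l ^ 2 / 2, m ^ 2 / 2, l ^ 2 / 4, - m ^ 2 / 4,
       (l ^ 2 * ((a / 2) ^ 2 - e) + m * d / 4 - 3 / 16 + m ^ 2 * ((d / 2) ^ 2 - r) + l * a / 4 - 3 / 16) / 2,
       (l ^ 2 * ((a / 2) ^ 2 - e) + m * d / 4 - m ^ 2 * ((d / 2) ^ 2 - r) - l * a / 4) / 4).
    + replace (l / 2 * (- m / 2) - m / 2 * (l / 2)) with (- / 2 * (l * m)) by field.
      apply Rmult_integral_contrapositive; split; [lra|now apply Rmult_integral_contrapositive].
    + replace (l ^ 2 / 2 * (- m ^ 2 / 4) - m ^ 2 / 2 * (l ^ 2 / 4)) with (- / 4 * (l * m * (l * m))) by field.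
      repeat (apply Rmult_integral_contrapositive; split; auto). lra.
    + unfold l, m. field. auto.
    + unfold l, m. field. auto.
Qed.

(* For [w = p + i q] and [c = c1 + i c2] this reads [conj w = 2 w^2 c], so that
   [w^2 (z^2 + c conj z) = (w z)^2 + conj (w z) / 2].  Up to a real factor, [w] is a
   nonzero solution of [Im (w^3 c) = 0], a real cubic equation. *)
Lemma conj_square_root c1 c2 : c1 <> 0 \/ c2 <> 0 -> exists p q, (p <> 0 \/ q <> 0) /\
  p = 2 * ((p ^ 2 - q ^ 2) * c1 - 2 * p * q * c2) /\
  - q = 2 * ((p ^ 2 - q ^ 2) * c2 + 2 * p * q * c1).
Proof.
  intros Hc.
  (* For [w = g + i h] the left side is the imaginary part of [w ^ 3 c]. With [h = 1] it is a cubic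
     in [g] with leading coefficient [c2]; if [c2 = 0], then [w = 1] works. *)
  assert (K : exists g h, (g <> 0 \/ h <> 0) /\
    g * ((g ^ 2 - h ^ 2) * c2 + 2 * g * h * c1) + h * ((g ^ 2 - h ^ 2) * c1 - 2 * g * h * c2) = 0).
  { destruct (Req_dec c2 0) as [->|H2].
    - exists 1, 0. split; [lra|ring].
    - destruct (cubic_root (3 * c1 / c2) (-3) (- c1 / c2)) as (g & Hg). exists g, 1. split; [lra|].
      transitivity (c2 * (g ^ 3 + 3 * c1 / c2 * g ^ 2 + -3 * g + - c1 / c2)); [field; auto|].
      rewrite Hg. ring. }
  destruct K as (g & h & Hgh & E).
  set (U := (g ^ 2 - h ^ 2) * c1 - 2 * g * h * c2) in *.
  set (V := (g ^ 2 - h ^ 2) * c2 + 2 * g * h * c1) in *.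
  assert (N : 0 < g ^ 2 + h ^ 2) by (destruct Hgh; nra).
  (* [U + i V = w ^ 2 c] and [w (U + i V) = R] is real, so [U + i V] is [R / (g ^ 2 + h ^ 2)] times
     [conj w]. *)
  set (R := g * U - h * V).
  assert (EU : (g ^ 2 + h ^ 2) * U = g * R).
  { unfold R. replace (g * (g * U - h * V)) with (g ^ 2 * U - h * (g * V)) by ring.
    replace (g * V) with (- (h * U)) by lra. ring. }
  assert (EV : (g ^ 2 + h ^ 2) * V = - h * R).
  { unfold R. replace (- h * (g * U - h * V)) with (- g * (h * U) + h ^ 2 * V) by ring.
    replace (h * U) with (- (g * V)) by lra. ring. }
  assert (HR : R <> 0).
  { intros R0. rewrite R0, Rmult_0_r in *.
    apply Rmult_integral in EU, EV. destruct EU as [|EU]; [lra|]. destruct EV as [|EV]; [lra|].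
    assert (F : (g ^ 2 + h ^ 2) ^ 2 * (c1 ^ 2 + c2 ^ 2) = 0).
    { transitivity (U ^ 2 + V ^ 2); [unfold U, V; ring|]. rewrite EU, EV. ring. }
    assert (0 < c1 ^ 2 + c2 ^ 2) by (destruct Hc; nra).
    assert (0 < (g ^ 2 + h ^ 2) ^ 2) by now apply pow_lt. nra. }
  (* The real factor for which [2 (t w) ^ 2 c = conj (t w)]. *)
  set (t := (g ^ 2 + h ^ 2) / (2 * R)).
  assert (Ht : t <> 0).
  { unfold t. apply Rmult_integral_contrapositive; split; [lra|apply Rinv_neq_0_compat; lra]. }
  assert (EtU : g = 2 * t * U).
  { unfold t. replace (2 * ((g ^ 2 + h ^ 2) / (2 * R)) * U) with ((g ^ 2 + h ^ 2) * U / R) by (field; auto).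
    rewrite EU. field; auto. }
  assert (EtV : - h = 2 * t * V).
  { unfold t. replace (2 * ((g ^ 2 + h ^ 2) / (2 * R)) * V) with ((g ^ 2 + h ^ 2) * V / R) by (field; auto).
    rewrite EV. field; auto. }
  exists (t * g), (t * h). split; [|split].
  - destruct Hgh; [left|right]; now apply Rmult_integral_contrapositive.
  - transitivity (t * (2 * t * U)); [now rewrite <- EtU|unfold U; ring].
  - transitivity (t * (2 * t * V)); [rewrite <- EtV; ring|unfold V; ring].
Qed.

(* In complex notation the map is [z^2 + m z + c (conj z)] up to a constant, with
   [m = m1 + i m2] and [c = c1 + i c2]; translating [z] by [m / 2] removes [m z]. *)
Lemma part_E : classified_part 1 0 (-1) 0 2 0.
Proof.
  intros a b e c d r.
  set (m1 := (a + d) / 2). set (c1 := (a - d) / 2). set (c2 := (b + c) / 2). set (m2 := (c - b) / 2).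
  replace a with (c1 + m1) by (unfold c1, m1; field).
  replace b with (c2 - m2) by (unfold c2, m2; field).
  replace c with (c2 + m2) by (unfold c2, m2; field).
  replace d with (m1 - c1) by (unfold c1, m1; field).
  clearbody m1 m2 c1 c2. clear a b c d.
  destruct (classic (c1 <> 0 \/ c2 <> 0)) as [H|H].
  - destruct (conj_square_root c1 c2 H) as (p & q & Hpq & E1 & E2).
    set (k1 := p ^ 2 - q ^ 2) in *. set (k2 := 2 * p * q).
    exists Defs.E1.
    (* The source is multiplied by [w = p + i q] and the target by [w ^ 2 = k1 + i k2], with the
       second row halved since the form has [x y], not [2 x y]. As [z ^ 2 + Re z = (z + / 4) ^ 2 +
       (conj z) / 2 - / 16], the shift by [/ 4] removes the remaining multiple of [z] and leaves the
       constant [3 / 16]. *)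
    apply (equivalent_intro _ (nf_map Defs.E1) p (- q) q p (p * m1 / 2 - q * m2 / 2 - / 4) (q * m1 / 2 + p * m2 / 2)
      k1 (- k2) (k2 / 2) (k1 / 2)
      (k1 * (m1 ^ 2 / 4 - m2 ^ 2 / 4 + c1 * m1 / 2 + c2 * m2 / 2 - e)
        - k2 * (m1 * m2 / 2 + c2 * m1 / 2 - c1 * m2 / 2 - r) - 3 / 16)
      ((k2 * (m1 ^ 2 / 4 - m2 ^ 2 / 4 + c1 * m1 / 2 + c2 * m2 / 2 - e)
        + k1 * (m1 * m2 / 2 + c2 * m1 / 2 - c1 * m2 / 2 - r)) / 2)).
    + destruct Hpq; nra.
    + replace (k1 * (k1 / 2) - - k2 * (k2 / 2)) with ((p ^ 2 + q ^ 2) ^ 2 / 2) by (unfold k1, k2; field).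
      assert (0 < p ^ 2 + q ^ 2) by (destruct Hpq; nra).
      assert (0 < (p ^ 2 + q ^ 2) ^ 2) by now apply pow_lt. lra.
    + intros x y. unfold affine, quad; cbn [fst snd nf_map].
      set (X := x + m1 / 2). set (Y := y + m2 / 2).
      replace x with (X - m1 / 2) by (unfold X; ring). replace y with (Y - m2 / 2) by (unfold Y; ring).
      clearbody X Y.
      assert (F1 : k1 * c1 - k2 * c2 = p / 2) by (unfold k2; lra).
      assert (F2 : k1 * c2 + k2 * c1 = - q / 2) by (unfold k2; lra).
      apply pair_eq.
      * transitivity (k1 * (X ^ 2 - Y ^ 2) - 2 * k2 * X * Y + (k1 * c1 - k2 * c2) * X + (k1 * c2 + k2 * c1) * Y - 3 / 16);
          [field|]. rewrite F1, F2. unfold k1, k2. field.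
      * transitivity (k2 / 2 * (X ^ 2 - Y ^ 2) + k1 * X * Y + (k1 * c2 + k2 * c1) / 2 * X - (k1 * c1 - k2 * c2) / 2 * Y);
          [field|]. rewrite F1, F2. unfold k1, k2. field.
  - apply not_or_and in H. destruct H as [H1 H2]. apply NNPP in H1. apply NNPP in H2. subst c1 c2.
    nf_by Defs.E2 (1, 0, 0, 1, m1 / 2, m2 / 2) (1, 0, 0, / 2, m1 ^ 2 / 4 - m2 ^ 2 / 4 - e, (m1 * m2 / 2 - r) / 2); lra.
Qed.

(** * Reduction of the pencil of quadratic parts *)

Ltac nonzero :=
  repeat (apply Rmult_integral_contrapositive; split; auto); auto;
  try (now apply Rinv_neq_0_compat); lra.

Lemma part_xy b : b <> 0 -> classified_part 0 b 0 0 0 0.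
Proof.
  intros Hb. apply (part_step 1 0 0 1 (/ b) 0 0 1) with (1 := part_DE); try (field; auto); [lra|].
  pose proof (Rinv_neq_0_compat b Hb). lra.
Qed.

Lemma part_sum_squares g : classified_part 1 0 g 0 0 0.
Proof.
  destruct (Rtotal_order g 0) as [Hg|[->|Hg]].
  - destruct (square_root_pos (- g)) as (r & Hr & Er); [lra|].
    apply (part_step (/ 2) (/ 2) (/ (2 * r)) (- / (2 * r)) 1 0 0 1) with (1 := part_DE); try lra.
    + pose proof (Rinv_neq_0_compat (2 * r)). lra.
    + replace g with (- r ^ 2) by lra. field. lra.
    + replace g with (- r ^ 2) by lra. field. lra.
    + replace g with (- r ^ 2) by lra. field. lra.
  - apply part_DP.
  - destruct (square_root_pos g Hg) as (r & Hr & ->).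
    apply (part_step 1 0 0 (/ r) 1 0 0 1) with (1 := part_DH); try (field; lra); try lra.
    pose proof (Rinv_neq_0_compat r). lra.
Qed.

Lemma part_form a b c : a <> 0 \/ b <> 0 \/ c <> 0 -> classified_part a b c 0 0 0.
Proof.
  assert (K : forall a b c, a <> 0 -> classified_part a b c 0 0 0).
  { clear. intros a b c Ha.
    apply (part_step 1 (- b / (2 * a)) 0 1 (/ a) 0 0 1)
      with (1 := part_sum_squares ((c - b ^ 2 / (4 * a)) / a)); try (field; auto); [lra|].
    pose proof (Rinv_neq_0_compat a Ha). lra. }
  intros H. destruct (Req_dec a 0) as [->|Ha]; [|now apply K].
  destruct (Req_dec c 0) as [->|Hc].
  - apply part_xy. tauto.
  - apply (part_step 0 1 1 0 1 0 0 1) with (1 := K c b 0 Hc); lra.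
Qed.

(** The sign of [c / a] decides. If [c = - r ^ 2 a], rescaling [y] gives the two parts of a complex
    square. If [c = r ^ 2 a], the pencil contains the squares of [x + r y] and [x - r y]. *)
Lemma part_square_xy a c : classified_part a 0 c 0 1 0.
Proof.
  destruct (Req_dec a 0) as [->|Ha], (Req_dec c 0) as [->|Hc].
  - apply (part_step 1 0 0 1 0 1 1 0) with (1 := part_DE); lra.
  - apply (part_step 0 1 1 0 (/ c) 0 0 1) with (1 := part_P); try (field; auto); [lra|].
    pose proof (Rinv_neq_0_compat c Hc). lra.
  - apply (part_step 1 0 0 1 (/ a) 0 0 1) with (1 := part_P); try (field; auto); [lra|].
    pose proof (Rinv_neq_0_compat a Ha). lra.
  - pose proof (Rinv_neq_0_compat a Ha) as Ia.
    assert (Hg : c / a <> 0) by nonzero.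
    destruct (Rtotal_order (c / a) 0) as [H|[H|H]]; [|easy|].
    + destruct (square_root_pos (- (c / a))) as (r & Hr & Er); [lra|].
      assert (Ec : c = - r ^ 2 * a) by (rewrite <- Er; field; auto).
      apply (part_step 1 0 0 (/ r) (/ a) 0 0 (2 * r)) with (1 := part_E); try (rewrite Ec; field; repeat split; auto; lra).
      * pose proof (Rinv_neq_0_compat r). lra.
      * replace (/ a * (2 * r) - 0 * 0) with (2 * (/ a * r)) by ring. nonzero.
    + destruct (square_root_pos (c / a)) as (r & Hr & Er); [lra|].
      assert (Ec : c = r ^ 2 * a) by (rewrite <- Er; field; auto).
      apply (part_step (/ 2) (/ 2) (/ (2 * r)) (- / (2 * r)) (/ a) (2 * r) (/ a) (- (2 * r))) with (1 := part_H);
        try (rewrite Ec; field; repeat split; auto; lra).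
      * pose proof (Rinv_neq_0_compat (2 * r)). lra.
      * replace (/ a * - (2 * r) - 2 * r * / a) with (-4 * (/ a * r)) by ring. nonzero.
Qed.

(** When [c <> 0], completing the square in [y] and subtracting a multiple of [x ^ 2] leaves
    [(x ^ 2, y ^ 2)]. *)
Lemma part_square b c : classified_part 1 0 0 0 b c.
Proof.
  destruct (Req_dec c 0) as [->|Hc].
  - destruct (Req_dec b 0) as [->|Hb]; [apply part_DP|].
    apply (part_step 1 0 0 1 1 0 0 (/ b)) with (1 := part_P); try (field; auto); [lra|].
    pose proof (Rinv_neq_0_compat b Hb). lra.
  - apply (part_step 1 0 (- b / (2 * c)) 1 1 0 (b ^ 2 / (4 * c * c)) (/ c)) with (1 := part_H);
      try (field; auto); [lra|].
    pose proof (Rinv_neq_0_compat c Hc). lra.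
Qed.

(** The second form is [y (b11 x + b02 y)]. If [b11 <> 0], its factors become the coordinates, and
    [be] is the mixed coefficient that must then be removed from the first form; otherwise the
    second form is a multiple of [y ^ 2]. *)
Lemma part_triangular a20 a11 a02 b11 b02 : a20 <> 0 \/ a11 <> 0 \/ a02 <> 0 \/ b11 <> 0 \/ b02 <> 0 ->
  classified_part a20 a11 a02 0 b11 b02.
Proof.
  intros H. destruct (Req_dec b11 0) as [->|H1].
  - destruct (Req_dec b02 0) as [->|H2].
    + apply part_form. tauto.
    + apply (part_step 0 1 1 0 0 (/ b02) 1 (- a02 / b02)) with (1 := part_square a11 a20);
        try (field; auto); [lra|].
      pose proof (Rinv_neq_0_compat b02 H2). lra.
  - set (al := a20 / b11 ^ 2). set (be := -2 * a20 * b02 / b11 ^ 2 + a11 / b11).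
    apply (part_step (/ b11) (- b02 / b11) 0 1 1 (- be) 0 1)
      with (1 := part_square_xy al (a20 * b02 ^ 2 / b11 ^ 2 - a11 * b02 / b11 + a02));
      unfold al, be; try (field; auto); [|lra].
    pose proof (Rinv_neq_0_compat b11 H1). lra.
Qed.

Lemma part_all a20 a11 a02 b20 b11 b02 :
  a20 <> 0 \/ a11 <> 0 \/ a02 <> 0 \/ b20 <> 0 \/ b11 <> 0 \/ b02 <> 0 ->
  classified_part a20 a11 a02 b20 b11 b02.
Proof.
  intros H. destruct (Req_dec b20 0) as [->|Hb].
  - apply part_triangular. tauto.
  - apply (part_step 1 0 0 1 0 1 1 (- a20 / b20))
      with (1 := part_triangular b20 b11 b02 (a11 - a20 / b20 * b11) (a02 - a20 / b20 * b02) (or_introl Hb));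
      try (field; auto); lra.
Qed.

Lemma quadratic_classified f : quadratic_map f -> classified f.
Proof.
  intros (a20 & a11 & a02 & a10 & a01 & a00 & b20 & b11 & b02 & b10 & b01 & b00 & H & E).
  replace f with (quad a20 a11 a02 a10 a01 a00 b20 b11 b02 b10 b01 b00).
  - now apply part_all.
  - apply functional_extensionality. intros [x y]. now rewrite E.
Qed.

(** * Separation of the normal forms *)

Definition mid (p q : plane) : plane := ((fst p + fst q) / 2, (snd p + snd q) / 2).

Lemma affine_mid m p q : invertible_affine_map m -> m (mid p q) = mid (m p) (m q).
Proof.
  intros Hm. destruct (invertible_affineE m Hm) as (a & b & c & d & u & v & _ & ->).
  unfold mid, affine. cbn [fst snd]. apply pair_eq; field.
Qed.

Definition affine_invariant (P : (plane -> plane) -> Prop) : Prop :=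
  forall f g, affinely_map_equivalent f g -> P f -> P g.

Definition convex_image (f : plane -> plane) : Prop := forall p q, exists r, f r = mid (f p) (f q).

Lemma convex_image_invariant : affine_invariant convex_image.
Proof.
  intros f g (h & k & Hh & Hk & E) H p q.
  destruct (invertible_affine_inverse h Hh) as (h' & _ & _ & h2).
  destruct (H (h' p) (h' q)) as (r & Er). exists (h r).
  now rewrite <- E, Er, affine_mid, !E, !h2.
Qed.

(** Contrapositive of midpoint convexity of the complement of the image: true for a half plane,
    false for the closed convex side of a parabola. *)
Definition convex_complement (f : plane -> plane) : Prop := forall p q r, f r = mid p q ->
  (exists s, f s = p) \/ (exists s, f s = q).

Lemma convex_complement_invariant : affine_invariant convex_complement.
Proof.
  intros f g (h & k & Hh & Hk & E) H p q r Er.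
  destruct (invertible_affine_inverse h Hh) as (h' & _ & _ & h2).
  destruct (invertible_affine_inverse k Hk) as (k' & Hk' & k1 & k2).
  destruct (H (k' p) (k' q) (h' r)) as [(s & Es)|(s & Es)].
  - rewrite <- affine_mid, <- Er, <- (h2 r), <- E, k1, h2 by auto. reflexivity.
  - left. exists (h s). now rewrite <- E, Es.
  - right. exists (h s). now rewrite <- E, Es.
Qed.

(** The image is symmetric about each of its points, as a line is and a ray is not. *)
Definition symmetric_image (f : plane -> plane) : Prop := forall p q, exists r, mid (f q) (f r) = f p.

Lemma symmetric_image_invariant : affine_invariant symmetric_image.
Proof.
  intros f g (h & k & Hh & Hk & E) H p q.
  destruct (invertible_affine_inverse h Hh) as (h' & _ & _ & h2).
  destruct (H (h' p) (h' q)) as (r & Er). exists (h r).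
  now rewrite <- (h2 q), <- (h2 p), <- !E, <- affine_mid, Er.
Qed.

(** Separates [DE3], which has a fibre made of two lines, from [DP3], whose fibres over its image
    are parabolas. *)
Definition midpoint_fibre (f : plane -> plane) : Prop :=
  exists p q, p <> q /\ f p = f q /\ f (mid p q) = f p.

Lemma midpoint_fibre_invariant : affine_invariant midpoint_fibre.
Proof.
  intros f g (h & k & Hh & Hk & E) (p & q & Hpq & H1 & H2).
  destruct (invertible_affine_inverse h Hh) as (h' & _ & h1 & _).
  exists (h p), (h q). split; [|split].
  - intros e. apply Hpq. now rewrite <- (h1 p), e, h1.
  - now rewrite <- !E, H1.
  - now rewrite <- affine_mid, <- !E, H2.
Qed.

(** A critical set made of lines contains two distinct points together with their midpoint; a
    hyperbola does not. *)
Lemma H1_not_H2 : ~ affinely_map_equivalent (nf_map H1) (nf_map H2).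
Proof.
  intros He. destruct (equivalent_nf _ _ He) as (h & k & Hh & Hk & _ & E0 & _).
  destruct (invertible_affine_inverse h Hh) as (h' & _ & h1 & h2).
  assert (K : forall p, J0 (nf_map H2) p -> J0 (nf_map H1) (h p)).
  { intros p Hp. rewrite E0. now exists p. }
  assert (J : J0 (nf_map H1) (h (0, 0)) /\ J0 (nf_map H1) (h (2, 2)) /\ J0 (nf_map H1) (mid (h (0, 0)) (h (2, 2)))).
  { rewrite <- affine_mid by auto. split; [|split]; apply K; rewrite J0_nf; unfold mid; simpl; field. }
  destruct J as (J1 & J2 & J3).
  assert (N : h (0, 0) <> h (2, 2)).
  { intros e. assert (e' : (0, 0) = (2, 2)) by now rewrite <- (h1 (0, 0)), e, h1.
    apply pair_equal_spec in e'. lra. }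
  destruct (h (0, 0)) as [x y], (h (2, 2)) as [x' y'].
  rewrite J0_nf in *. unfold mid in *. simpl in *.
  apply N. clear - J1 J2 J3.
  set (X := x + / 4) in *. set (X' := x' + / 4) in *.
  assert (E1 : (X - y) * (X + y) = / 16) by (unfold X; lra).
  assert (E2 : (X' - y') * (X' + y') = / 16) by (unfold X'; lra).
  (* For two points of [u v = / 16], the midpoint lies on the curve only if [(u - u') (v - v') = 0],
     and either coordinate determines the other. *)
  assert (E3 : ((X - y) - (X' - y')) * ((X + y) - (X' + y')) = 0) by (unfold X, X' in *; lra).
  assert (Ex : X = X' /\ y = y'); [|apply pair_eq; unfold X, X' in Ex; lra].
  apply Rmult_integral in E3. destruct E3 as [E3|E3].
  - assert (X + y = X' + y'); [|lra].
    apply Rmult_eq_reg_l with (X - y); [|intros e; rewrite e in E1; lra].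
    rewrite E1. replace (X - y) with (X' - y') by lra. auto.
  - assert (X - y = X' - y'); [|lra].
    apply Rmult_eq_reg_r with (X + y); [|intros e; rewrite e in E1; lra].
    rewrite E1. replace (X + y) with (X' + y') by lra. auto.
Qed.

Lemma DE1_image : ~ convex_image (nf_map DE1).
Proof.
  intros H. destruct (H (0, 1) (0, -1)) as ([x y] & E). unfold mid in E. simpl in E.
  apply pair_equal_spec in E. destruct E as [E1 E2]. assert (y = 0) as -> by lra. nra.
Qed.

Lemma DH1_image : convex_image (nf_map DH1).
Proof.
  intros [x y] [x' y']. unfold mid. simpl.
  destruct (square_root ((x * x + x' * x') / 2 + (y - y') ^ 2 / 4)) as (r & _ & E).
  { pose proof (pow2_ge_0 x). pose proof (pow2_ge_0 x'). pose proof (pow2_ge_0 (y - y')). lra. }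
  exists (r, (y + y') / 2). apply pair_eq; [|field].
  simpl in *. lra.
Qed.

Lemma DP2_image : convex_image (nf_map DP2).
Proof.
  intros [x y] [x' y']. unfold mid. simpl.
  destruct (square_root ((x * x + x' * x') / 2)) as (r & _ & E);
    [pose proof (pow2_ge_0 x); pose proof (pow2_ge_0 x'); lra|].
  exists (r, (y + y') / 2). apply pair_eq; [|auto]. simpl in *. lra.
Qed.

Lemma DP4_image : ~ convex_image (nf_map DP4).
Proof.
  intros H. destruct (H (1, 0) (-1, 0)) as ([x y] & E). unfold mid in E. simpl in E.
  apply pair_equal_spec in E. destruct E as [E1 E2]. assert (x = 0) as -> by lra. nra.
Qed.

Lemma line_convex_image f : (forall a, exists p, f p = (a, 0)) -> (forall p, snd (f p) = 0) -> convex_image f.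
Proof.
  intros H H0 p q. destruct (H ((fst (f p) + fst (f q)) / 2)) as (r & E). exists r. rewrite E.
  unfold mid. rewrite !H0. apply pair_eq; field.
Qed.

Lemma line_symmetric_image f : (forall a, exists p, f p = (a, 0)) -> (forall p, snd (f p) = 0) -> symmetric_image f.
Proof.
  intros H H0 p q. destruct (H (2 * fst (f p) - fst (f q))) as (r & E). exists r. rewrite E.
  unfold mid. cbn [fst snd]. rewrite H0, (surjective_pairing (f p)), H0. simpl. apply pair_eq; field.
Qed.

Lemma DE3_line a : exists p, nf_map DE3 p = (a, 0).
Proof. exists ((a + 1) / 2, (a - 1) / 2). simpl. apply pair_eq; field. Qed.

Lemma DP3_line a : exists p, nf_map DP3 p = (a, 0).
Proof. exists (0, a). simpl. apply pair_eq; ring. Qed.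

Lemma snd_DE3 p : snd (nf_map DE3 p) = 0.
Proof. now destruct p. Qed.

Lemma snd_DP3 p : snd (nf_map DP3 p) = 0.
Proof. now destruct p. Qed.

Lemma DP5_image : convex_image (nf_map DP5).
Proof.
  intros [x y] [x' y']. unfold mid. simpl.
  destruct (square_root ((x * x + x' * x') / 2)) as (r & _ & E);
    [pose proof (pow2_ge_0 x); pose proof (pow2_ge_0 x'); lra|].
  exists (r, 0). simpl in *. apply pair_eq; lra.
Qed.

Lemma DP5_not_symmetric : ~ symmetric_image (nf_map DP5).
Proof.
  intros H. destruct (H (0, 0) (1, 0)) as ([x y] & E). unfold mid in E. simpl in E.
  apply pair_equal_spec in E. nra.
Qed.

Lemma DP2_complement : convex_complement (nf_map DP2).
Proof.
  intros [a b] [a' b'] [x y] E. unfold mid in E. simpl in E. apply pair_equal_spec in E.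
  destruct (Rle_dec 0 a) as [Ha|Ha]; [left|right].
  - destruct (square_root a Ha) as (r & _ & ->). exists (r, b). reflexivity.
  - destruct (square_root a') as (r & _ & ->); [nra|]. exists (r, b'). reflexivity.
Qed.

Lemma DH1_complement : ~ convex_complement (nf_map DH1).
Proof.
  intros H. destruct (H (0, 1) (0, -1) (0, 0)) as [([x y] & E)|([x y] & E)].
  - unfold mid. simpl. apply pair_eq; field.
  - simpl in E. apply pair_equal_spec in E. nra.
  - simpl in E. apply pair_equal_spec in E. nra.
Qed.

Lemma DE3_fibre : midpoint_fibre (nf_map DE3).
Proof.
  exists (1, 1), (-1, -1). unfold mid. simpl. split; [|split; apply pair_eq; field].
  intros e. apply pair_equal_spec in e. lra.
Qed.

Lemma DP3_fibre : ~ midpoint_fibre (nf_map DP3).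
Proof.
  intros ([x y] & [x' y'] & N & E1 & E2). unfold mid in E2. simpl in E1, E2.
  apply pair_equal_spec in E1, E2. destruct E1 as [E1 _], E2 as [E2 _].
  apply N. assert ((x - x') * (x - x') = 0) by lra. assert (x = x') as -> by nra.
  apply pair_eq; lra.
Qed.

Lemma DE2_not_DH2 : ~ affinely_map_equivalent (nf_map DE2) (nf_map DH2).
Proof.
  intros He. pose proof (J0_equivalent _ _ J0_plane He (J0_nf_description DH2) (1, 0)) as H.
  rewrite J0_nf in H. simpl in H. lra.
Qed.

Ltac by_cardinality K :=
  let go k := first
   [ pose proof (proj1 (K k) ltac:(simpl; auto 6)) as M; simpl in M; intuition discriminate
   | pose proof (proj2 (K k) ltac:(simpl; auto 6)) as M; simpl in M; intuition discriminate ] in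
  exfalso; first [go (Fin 0) | go (Fin 1) | go (Fin 2) | go (Fin 3) | go (Fin 4) | go Inf].

(** Equal cardinality sets occur only within [H1], [H2]; [DE1], [DH1], [DP2]; [DE2], [DH2]; and
    [DE3], [DP3], [DP4], [DP5]. The geometric invariants split these four groups. *)
Lemma nf_equivalent_eq c c' : affinely_map_equivalent (nf_map c) (nf_map c') -> c = c'.
Proof.
  intros He. pose proof (equivalent_sym _ _ He) as He'.
  assert (K : forall k, In k (nf_preimage_cardinalities c) <-> In k (nf_preimage_cardinalities c')).
  { intros k. rewrite <- (nf_cards c k).
    apply (preimage_cardinalities_equivalent _ _ _ He (nf_cards c')). }
  pose proof (line_convex_image _ DE3_line snd_DE3) as CE3.
  pose proof (line_convex_image _ DP3_line snd_DP3) as CP3.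
  pose proof (line_symmetric_image _ DE3_line snd_DE3) as SE3.
  pose proof (line_symmetric_image _ DP3_line snd_DP3) as SP3.
  destruct c, c'; try reflexivity; simpl nf_preimage_cardinalities in K;
    try (clear - K; by_cardinality K);
    first [ elim (H1_not_H2 He) | elim (H1_not_H2 He') | elim (DE2_not_DH2 He) | elim (DE2_not_DH2 He')
          | elim DE1_image; apply (convex_image_invariant _ _ He); first [apply DH1_image | apply DP2_image]
          | elim DE1_image; apply (convex_image_invariant _ _ He'); first [apply DH1_image | apply DP2_image]
          | elim DH1_complement; apply (convex_complement_invariant _ _ He), DP2_complement
          | elim DH1_complement; apply (convex_complement_invariant _ _ He'), DP2_complement
          | elim DP4_image; apply (convex_image_invariant _ _ He); first [assumption | apply DP5_image]
          | elim DP4_image; apply (convex_image_invariant _ _ He'); first [assumption | apply DP5_image]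
          | elim DP5_not_symmetric; apply (symmetric_image_invariant _ _ He); assumption
          | elim DP5_not_symmetric; apply (symmetric_image_invariant _ _ He'); assumption
          | elim DP3_fibre; apply (midpoint_fibre_invariant _ _ He), DE3_fibre
          | elim DP3_fibre; apply (midpoint_fibre_invariant _ _ He'), DE3_fibre ].
Qed.

Theorem theorem2p1 :
  (forall f : plane -> plane, quadratic_map f ->
     exists! c : normal_form, affinely_map_equivalent f (nf_map c))
  /\
  (forall (f : plane -> plane) (c : normal_form),
     quadratic_map f -> affinely_map_equivalent f (nf_map c) ->
     J0_is f (nf_J0 c) /\
     J1_is f (nf_J1 c) /\
     preimage_cardinalities_are f (nf_preimage_cardinalities c)).
Proof.
  split.
  - intros f Hf. destruct (quadratic_classified f Hf) as (c & Hc). exists c. split; [exact Hc|].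
    intros c' Hc'. apply nf_equivalent_eq.
    apply equivalent_trans with f; [now apply equivalent_sym|exact Hc'].
  - intros f c _ He. split; [|split].
    + apply (J0_equivalent f c); auto using J0_nf_description.
    + apply (J1_equivalent f c); auto using J1_nf_description.
    + apply (preimage_cardinalities_equivalent f c); auto using nf_cards.
Qed.
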